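(* Let $\mathcal{G}=(V,E)$ be a finite undirected graph with $V=\{1,\dots,d\}$, let $r$ be the number of vertices of the largest clique of $\mathcal{G}$, and let $\mathcal{C}(\mathcal{G})$ be the set of (vertex sets of) maximal cliques of $\mathcal{G}$. There exist, for every sample size $n\in\mathbb{N}$, architecture parameters $\ell_{V'}^{(n)}$, $w_{V'}^{(n)}$ ($V'\in\mathcal{C}(\mathcal{G})$), $s^{(n)}$, $C^{(n)}$, depending only on $\mathcal{G}$ and $n$ (and not on any density), where $w_{V'}^{(n)}$ has first entry $|V'|$ and last entry $1$, such that the following holds for the function classes $$\mathcal{F}^*_n=\Big\{\prod_{V'\in\mathcal{C}(\mathcal{G})} q_{V'}\circ e_{V'} \;:\; q_{V'}\in\mathcal{F}\big(\ell_{V'}^{(n)},w_{V'}^{(n)},s^{(n)},C^{(n)}\big)\text{ for all }V'\in\mathcal{C}(\mathcal{G})\Big\}.$$ For every Lipschitz continuous, positive probability density $p$ on $[0,1]^d$ satisfying the Markov property with respect to $\mathcal{G}$, if $x_1,\dots,x_n$ are i.i.d. with density $p$ and $$\hat p_n \in \arg\min_{f\in\mathcal{F}^*_n}\Big(\|f\|_2^2-\frac{2}{n}\sum_{i=1}^n f(x_i)\Big),$$ then $$\|p-\hat p_n\|_1\in\tilde O_p\big(n^{-1/(4+r)}\big)\quad\text{as } n\to\infty.$$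
   Context: The data domain is $[0,1]^d$ with Lebesgue measure; $\|\cdot\|_1,\|\cdot\|_2$ are the $L^1,L^2$ norms on $[0,1]^d$. A density $p$ on $[0,1]^d$ is positive if $p(x)>0$ for all $x\in[0,1]^d$; it is Lipschitz continuous if for some $L\ge 0$, $|p(x)-p(y)|\le L\|x-y\|_2$ for all $x,y$. A clique is a set of pairwise adjacent vertices; a maximal clique is one not properly contained in another clique. For $V'=\{v_1<\dots<v_k\}\subset\{1,\dots,d\}$, $e_{V'}:\mathbb{R}^d\to\mathbb{R}^{k}$, $e_{V'}(x)=(x_{v_1},\dots,x_{v_k})$. Markov property: a density $p$ of a random vector $X=(X_1,\dots,X_d)$ satisfies the Markov property with respect to $\mathcal{G}$ if for all disjoint $A,B,C\subset\{1,\dots,d\}$ such that every path in $\mathcal{G}$ from $A$ to $B$ passes through $C$, $X_A$ and $X_B$ are conditionally independent given $X_C$. Neural network classes: let $\sigma(t)=\max(t,0)$ act entrywise on vectors. For $\ell\in\mathbb{N}$, $w=(w_0,\dots,w_{\ell+1})\in\mathbb{N}^{\ell+2}$ with $w_{\ell+1}=1$, $s\in\mathbb{N}$ and $F>0$, $\mathcal{F}(\ell,w,s,F)$ is the set of functions $f:[0,1]^{w_0}\to\mathbb{R}$ of the form $f(x)=W_\ell\,\sigma_{v_\ell}W_{\ell-1}\sigma_{v_{\ell-1}}\cdots W_1\sigma_{v_1}W_0x$, where $\sigma_{v}(y)=\sigma(y-v)$, $W_i\in\mathbb{R}^{w_{i+1}\times w_i}$, $v_i\in\mathbb{R}^{w_i}$,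 all entries of all $W_i,v_i$ have absolute value at most $1$, the total number of nonzero entries of all $W_i$ and $v_i$ is at most $s$, and $\|f\|_\infty\le F$. $Z_n\in\tilde O_p(a_n)$ means that for some $k\ge 0$, $Z_n=O_p(a_n(\log n)^k)$, i.e. the sequence $Z_n/(a_n(\log n)^k)$ is bounded in probability. The constants and $k$ may depend on $p$ and $\mathcal{G}$. *)

(* Defs.v *)
From HB Require Import structures.
From mathcomp Require Import all_boot all_order all_algebra.
From mathcomp Require Import all_classical all_reals all_analysis.

Set Implicit Arguments.
Unset Strict Implicit.
Unset Printing Implicit Defensive.
Import Order.TTheory GRing.Theory Num.Theory.
Import numFieldNormedType.Exports.

Local Open Scope classical_set_scope.
Local Open Scope ring_scope.

(* The library states [lebesgue_measure] on [measurableTypeR R]; this is the same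
   set function on the canonical (convertible) measurable structure of [R]. *)
Section lebesgue1.
Context (R : realType).

Definition lebesgue1 : set R -> \bar R := @lebesgue_measure R.

Let lebesgue1_sigma_additive : semi_sigma_additive lebesgue1.
Proof. exact: (@measure_semi_sigma_additive _ _ _ (@lebesgue_measure R)). Qed.

HB.instance Definition _ := isMeasure.Build _ _ _ lebesgue1
  (@measure0 _ _ _ (@lebesgue_measure R))
  (@measure_ge0 _ _ _ (@lebesgue_measure R)) lebesgue1_sigma_additive.

Let lebesgue1_sigma_finite : sigma_finite setT lebesgue1.
Proof. exact: (sigma_finiteT (@lebesgue_measure R)). Qed.

HB.instance Definition _ := Measure_isSigmaFinite.Build _ _ _ lebesgue1
  lebesgue1_sigma_finite.

End lebesgue1.

(* Points of R^n are n-tuples, with the product sigma-algebra of the library. *)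
Section lebesgue_tuple_succ.
Context (R : realType) (n : nat).

Definition cons_pair (z : R * n.-tuple R) : n.+1.-tuple R :=
  [the n.+1.-tuple R of z.1 :: z.2].

Lemma measurable_cons_pair : measurable_fun [set: R * n.-tuple R] cons_pair.
Proof. exact: measurable_cons. Qed.

Definition uncons_pair (x : n.+1.-tuple R) : R * n.-tuple R :=
  (thead x, [tuple of behead x]).

Lemma measurable_uncons_pair : measurable_fun [set: n.+1.-tuple R] uncons_pair.
Proof.
by apply: measurable_fun_pair; [exact: measurable_tnth|exact: measurable_behead].
Qed.

Lemma cons_pairK : cancel cons_pair uncons_pair.
Proof.
by case=> a t; rewrite /uncons_pair /cons_pair /=; congr pair; apply/val_inj.
Qed.

Context (mu : {sigma_finite_measure set (n.-tuple R) -> \bar R}).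

Definition lebesgue_cons : set (n.+1.-tuple R) -> \bar R :=
  pushforward (@lebesgue1 R \x mu)%E cons_pair.

Let lebesgue_cons0 : lebesgue_cons set0 = 0%E.
Proof. by rewrite /lebesgue_cons /pushforward preimage_set0 measure0. Qed.

Let lebesgue_cons_ge0 A : (0 <= lebesgue_cons A)%E.
Proof. by rewrite /lebesgue_cons /pushforward; exact: measure_ge0. Qed.

Let measurable_preim A : measurable A -> measurable (cons_pair @^-1` A).
Proof. by move=> mA; rewrite -[X in measurable X]setTI; exact: measurable_cons_pair. Qed.

Let lebesgue_cons_sigma_additive : semi_sigma_additive lebesgue_cons.
Proof.
move=> F mF tF mUF; rewrite /lebesgue_cons /pushforward preimage_bigcup.
apply: measure_semi_sigma_additive.
- by move=> i; exact: measurable_preim.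
- apply/trivIsetP => /= i j _ _ ij; rewrite -preimage_setI.
  by move/trivIsetP : tF => /(_ _ _ _ _ ij) ->//; rewrite preimage_set0.
- by rewrite -preimage_bigcup; exact: measurable_preim.
Qed.

HB.instance Definition _ := isMeasure.Build _ _ _ lebesgue_cons
  lebesgue_cons0 lebesgue_cons_ge0 lebesgue_cons_sigma_additive.

Let lebesgue_cons_sigma_finite : sigma_finite setT lebesgue_cons.
Proof.
have /sigma_finiteP[F [TF ndF Foo]] := sigma_finiteT (@lebesgue1 R).
have /sigma_finiteP[G [TG ndG Goo]] := sigma_finiteT mu.
exists (fun i => uncons_pair @^-1` (F i `*` G i)).
  rewrite -preimage_bigcup (_ : \bigcup_i _ = setT) ?preimage_setT//.
  rewrite -setXTT TF TG predeqE => -[x y]; split.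
    by move=> [i _ [Fx Gy]]; split; exists i.
  move=> [/= [i _ Fx] [j _ Gy]]; exists (maxn i j) => //; split.
    by move: x Fx; exact/subsetPset/ndF/leq_maxl.
  by move: y Gy; exact/subsetPset/ndG/leq_maxr.
move=> i; have [mF Fioo] := Foo i; have [mG Gioo] := Goo i; split.
  rewrite -[X in measurable X]setTI; apply: measurable_uncons_pair => //.
  exact: measurableX.
rewrite /lebesgue_cons /pushforward -comp_preimage.
rewrite (_ : _ \o _ = id); last by apply/funext => z; exact: cons_pairK.
rewrite preimage_id product_measure1E//.
by rewrite lte_mul_pinfty// ge0_fin_numE.
Qed.

HB.instance Definition _ := Measure_isSigmaFinite.Build _ _ _ lebesgue_cons
  lebesgue_cons_sigma_finite.

End lebesgue_tuple_succ.

Fixpoint lebesgue_tuple (R : realType) (n : nat) :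
    {sigma_finite_measure set (n.-tuple R) -> \bar R} :=
  match n with
  | 0 => \d_([tuple])
  | m.+1 => lebesgue_cons (lebesgue_tuple R m)
  end.

Lemma lebesgue_tuple_box (R : realType) (n : nat) (A : 'I_n -> set R) :
  (forall i, measurable (A i)) ->
  lebesgue_tuple R n [set x | forall i, A i (tnth x i)] =
  (\prod_(i < n) lebesgue1 (A i))%E.
Proof.
elim: n A => [|n ih] A mA.
  rewrite big_ord0 /= diracE mem_set//=; first by case.
rewrite big_ord_recl -ih; last by move=> i; exact: mA.
rewrite -product_measure1E//=; last first.
  rewrite [X in measurable X](_ : _ = \bigcap_(i in [set: 'I_n])
      ((fun x : n.-tuple R => tnth x i) @^-1` A (lift ord0 i))).
    apply: fin_bigcap_measurable => // i _.
    by rewrite -[X in measurable X]setTI; apply: measurable_tnth.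
  by apply/seteqP; split => x /= xA i; [move=> _|]; exact: xA.
rewrite /lebesgue_cons /pushforward; congr product_measure1.
apply/seteqP; split => -[a t] /=.
  move=> At; split; first exact: (At ord0).
  by move=> i; have := At (lift ord0 i); rewrite tnthS.
move=> [Aa At] i; have [j ->|->] := unliftP ord0 i; last exact: Aa.
by rewrite tnthS; exact: At.
Qed.

Section euclidean.
Context (R : realType).

Definition unit_cube (d : nat) : set (d.-tuple R) :=
  [set x | forall i, 0 <= tnth x i <= 1].
Arguments unit_cube : clear implicits.

Definition euclidean_dist (d : nat) (x y : d.-tuple R) : R :=
  Num.sqrt (\sum_(i < d) (tnth x i - tnth y i) ^+ 2).

(* The integrals below are meant for functions that are integrable on the cube
   ([Rintegral] is a total operator). *)
Definition L1norm (d : nat) (f : d.-tuple R -> R) : R :=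
  \int[lebesgue_tuple R d]_(x in unit_cube d) `|f x|.

Definition L2norm (d : nat) (f : d.-tuple R -> R) : R :=
  Num.sqrt (\int[lebesgue_tuple R d]_(x in unit_cube d) (f x ^+ 2)).

(* Functions on [0,1]^d are represented by functions on R^d; the predicates on
   densities only constrain and only use the values on the cube. *)
Definition prob_density (d : nat) (p : d.-tuple R -> R) : Prop :=
  [/\ measurable_fun (unit_cube d) p,
      forall x, unit_cube d x -> 0 <= p x &
      (\int[lebesgue_tuple R d]_(x in unit_cube d) (p x)%:E = 1)%E].

Definition positive_on_cube (d : nat) (p : d.-tuple R -> R) : Prop :=
  forall x, unit_cube d x -> 0 < p x.

Definition lipschitz_on_cube (d : nat) (p : d.-tuple R -> R) : Prop :=
  exists2 L : R, 0 <= L & forall x y, unit_cube d x -> unit_cube d y ->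
    `|p x - p y| <= L * euclidean_dist x y.

Definition has_density (d : nat) (P : set (d.-tuple R) -> \bar R)
    (p : d.-tuple R -> R) : Prop :=
  forall A, measurable A ->
    P A = (\int[lebesgue_tuple R d]_(x in A `&` unit_cube d) (p x)%:E)%E.

End euclidean.
Arguments unit_cube {R} d _.

(* [enum_val] lists the elements of [K] in increasing order. *)
Definition subvector (T : Type) (d : nat) (K : {set 'I_d}) (x : d.-tuple T) :
    #|K|.-tuple T :=
  [tuple tnth x (enum_val i) | i < #|K|].

(* A graph on 'I_d is its adjacency relation. *)
Section graphs.
Context (d : nat) (e : rel 'I_d).

Definition is_clique (K : {set 'I_d}) : bool :=
  [forall x in K, forall y in K, (x != y) ==> e x y].

Definition max_cliques : {set {set 'I_d}} := [set K | maxset is_clique K]%SET.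

Definition clique_number : nat := \max_(K : {set 'I_d} | is_clique K) #|K|.

Definition separates (C A B : {set 'I_d}) : Prop :=
  forall (x : 'I_d) (s : seq 'I_d), x \in A -> path e x s -> last x s \in B ->
    exists2 z, z \in x :: s & z \in C.

End graphs.

Section conditional_independence.
Context (R : realType) (d0 d1 d2 d3 : measure_display)
  (T : measurableType d0) (U1 : measurableType d1) (U2 : measurableType d2)
  (U3 : measurableType d3) (P : probability T R).

(* [h \o Z] is a version of the conditional probability of E given Z. *)
Definition cond_prob (Z : T -> U3) (E : set T) (h : U3 -> R) : Prop :=
  measurable_fun setT h /\
  forall D, measurable D ->
    P (E `&` Z @^-1` D) = (\int[P]_(t in Z @^-1` D) (h (Z t))%:E)%E.

(* P(X in A, Y in B | Z) = P(X in A | Z) P(Y in B | Z) almost surely; versions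
   always exist and are almost surely unique. *)
Definition cond_indep (X : T -> U1) (Y : T -> U2) (Z : T -> U3) : Prop :=
  forall (A : set U1) (B : set U2), measurable A -> measurable B ->
  exists f g : U3 -> R,
    [/\ cond_prob Z (X @^-1` A) f, cond_prob Z (Y @^-1` B) g &
        cond_prob Z (X @^-1` A `&` Y @^-1` B) (fun z => f z * g z)].

End conditional_independence.

(* The coordinate vectors are taken on the canonical space R^d, under the law
   with density p. *)
Definition markov_property (R : realType) (d : nat) (e : rel 'I_d)
    (p : d.-tuple R -> R) : Prop :=
  forall P : probability (d.-tuple R) R, has_density P p ->
  forall A B C : {set 'I_d},
    [disjoint A & B]%B -> [disjoint A & C]%B -> [disjoint B & C]%B ->
    separates e C A B ->
    cond_indep P (@subvector R d A) (@subvector R d B) (@subvector R d C).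

Section networks.
Context (R : realType).

Definition relu (t : R) : R := Num.max t 0.

Definition shifted_relu (k : nat) (v y : 'cV[R]_k) : 'cV[R]_k :=
  map_mx relu (y - v).

Local Notation width w i := (nth 0%N w i).

(* W_i sigma_(v_i) W_(i-1) ... sigma_(v_1) W_0 x *)
Fixpoint net_eval (w : seq nat)
    (W : forall i, 'M[R]_(width w i.+1, width w i))
    (v : forall i, 'cV[R]_(width w i)) (x : 'cV[R]_(width w 0)) (i : nat) :
    'cV[R]_(width w i.+1) :=
  match i with
  | 0 => W 0 *m x
  | j.+1 => W j.+1 *m shifted_relu (v j.+1) (net_eval W v x j)
  end.

Definition nnz_entries (m n : nat) (A : 'M[R]_(m, n)) : nat :=
  #|[set ij : 'I_m * 'I_n | A ij.1 ij.2 != 0]%SET|.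

(* Meaningful when the first width is k and the last one is 1, in which case
   [const_mx (f x)] is the 1 x 1 matrix f(x). Parameters W i with i > l and v i
   with i = 0 or i > l are unused and unconstrained. *)
Definition nn_class (k l : nat) (w : l.+2.-tuple nat) (s : nat) (F : R) :
    set (k.-tuple R -> R) :=
  [set f : k.-tuple R -> R | exists (W : forall i, 'M[R]_(width w i.+1, width w i))
                  (v : forall i, 'cV[R]_(width w i)),
    [/\ forall i a b, (i <= l)%N -> `|W i a b| <= 1,
        forall i a b, (0 < i <= l)%N -> `|v i a b| <= 1,
        (\sum_(0 <= i < l.+1) nnz_entries (W i) +
         \sum_(1 <= i < l.+1) nnz_entries (v i) <= s)%N,
        forall x : k.-tuple R, net_eval W v (\col_j nth 0 x j) l = const_mx (f x) &
        forall x, unit_cube k x -> `|f x| <= F]].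

(* The functions prod_K q_K o e_K, K ranging over the maximal cliques. *)
Definition clique_product_class (d : nat) (e : rel 'I_d)
    (l : {set 'I_d} -> nat) (w : forall K, (l K).+2.-tuple nat)
    (s : nat) (F : R) : set (d.-tuple R -> R) :=
  [set f | exists q : forall K : {set 'I_d}, #|K|.-tuple R -> R,
    (forall K, K \in max_cliques e -> nn_class (w K) s F (q K)) /\
    f = fun x => \prod_(K in max_cliques e) q K (subvector K x)].

End networks.

Section estimation.
Context (R : realType) (d : nat).

Definition empirical_risk (n : nat) (x : 'I_n -> d.-tuple R)
    (f : d.-tuple R -> R) : R :=
  L2norm f ^+ 2 - 2 / n%:R * \sum_(i < n) f (x i).

Definition minimizers (A : Type) (F : set A) (obj : A -> R) : set A :=
  [set f | F f /\ forall g, F g -> obj f <= obj g].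

Context (d0 : measure_display) (T : measurableType d0) (P : probability T R).

Definition mutually_indep (n : nat) (X : 'I_n -> T -> d.-tuple R) : Prop :=
  forall B : 'I_n -> set (d.-tuple R), (forall i, measurable (B i)) ->
    P (\bigcap_i (X i @^-1` B i)) = (\prod_(i < n) P (X i @^-1` B i))%E.

Definition iid_with_density (n : nat) (X : 'I_n -> {RV P >-> d.-tuple R})
    (p : d.-tuple R -> R) : Prop :=
  mutually_indep X /\ forall i, has_density (distribution P (X i)) p.

(* Z n is not required to be measurable: the bound holds on a measurable event
   of probability at least 1 - eps. For measurable Z n this is the usual
   P(|Z n| > M) <= eps. *)
Definition bounded_in_probability (Z : nat -> T -> R) : Prop :=
  forall eps : R, 0 < eps -> exists M : R, \forall n \near \oo,
    exists E : set T, [/\ measurable E, ((1 - eps)%:E <= P E)%E &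
      forall t, E t -> `|Z n t| <= M].

Definition Otilde_p (Z : nat -> T -> R) (a : nat -> R) : Prop :=
  exists k : nat,
    bounded_in_probability (fun n t => Z n t / (a n * ln n%:R ^+ k)).

End estimation.

(* Main.v *)
(* Hammersley-Clifford: for a positive Lipschitz density the Markov property,
   tested on shrinking boxes, gives p(x) p(x with x_i = x_j = 0) =
   p(x with x_i = 0) p(x with x_j = 0) for non-adjacent i and j, whence p is a
   product of positive Lipschitz functions of the maximal cliques.

   Approximation: on a grid with 2^q ~ n^(1/(4+r)) cells per unit length, the
   McShane-type function max_a (psi(a) - T |x - a|_1), with T ~ log n, is within
   O(T 2^-q) of a T-Lipschitz psi, and a network of logarithmic depth with
   O(2^(qr)) nonzero weights up to logarithms computes it exactly.

   Estimation: since |f - p|_2^2 = |f|_2^2 - 2 int f p + |p|_2^2, the squared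
   error of the minimizer is at most the squared approximation error plus four
   times the largest deviation of an empirical mean of the class. Rounding the
   weights codes the class by exp(2^(qr) polylog n) functions, and Hoeffding's
   inequality bounds the deviation by polylog(n) (2^(qr) / n)^(1/2), which is at
   most polylog(n) 4^-q; hence |p - f|_1 <= |p - f|_2 <= polylog(n) 2^-q. *)

Require Import Defs.
From mathcomp Require Import all_boot all_order all_algebra.
From mathcomp Require Import all_classical all_reals all_analysis.
From mathcomp Require Import measurable_realfun.
From mathcomp Require Import ring lra zify.

Set Implicit Arguments.
Unset Strict Implicit.
Unset Printing Implicit Defensive.
Import Order.TTheory GRing.Theory Num.Theory.
Import numFieldNormedType.Exports.

Local Open Scope classical_set_scope.
Local Open Scope ring_scope.

(** * Lebesgue measure on the cube *)

(** The exponent balances two bounds on the squared error: approximation contributes [4 ^ (- q)],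
    and the deviation of empirical means over the whole class, not localized around [p], contributes
    [(2 ^ (q * r) / n) ^ (1 / 2)], both up to logarithms. They agree when [2 ^ (q * (4 + r)) = n].
    Each network sees only the coordinates of one clique, whence [r] instead of [d].

    The architecture may not depend on the density, whereas the bounds and Lipschitz constants of
    its clique factors do. A parameter [T] growing like [log n] stands in for these constants: it
    exceeds them from some sample size on and costs only logarithmic factors. Weights are at most 1,
    so the networks work with [psi / T] and restore the scale at the end.

    Two obstacles shape the probabilistic side. Conditional probabilities are defined almost
    everywhere only, while the factorization needs identities of [p] at every point; continuity of
    [p] bridges the gap through boxes of positive volume. The minimizer is an arbitrary function of
    the sample, not assumed measurable in it; hence a single event must control the deviations of
    the whole class. *)

Section cube_measure.
Context (R : realType).

Lemma measurable_box (d : nat) (A : 'I_d -> set R) :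
  (forall i, measurable (A i)) ->
  measurable [set x : d.-tuple R | forall i, A i (tnth x i)].
Proof.
move=> mA; rewrite [X in measurable X](_ : _ = \bigcap_(i in [set: 'I_d])
    ((fun x : d.-tuple R => tnth x i) @^-1` A i)).
  apply: fin_bigcap_measurable => // i _.
  by rewrite -[X in measurable X]setTI; apply: measurable_tnth.
by apply/seteqP; split => x /= xA i; [move=> _|]; exact: xA.
Qed.

Lemma unit_cubeE (d : nat) :
  @unit_cube R d = [set x | forall i, `[0, 1]%classic (tnth x i)].
Proof. by apply/seteqP; split => x /= xi i; have := xi i; rewrite in_itv. Qed.

Lemma measurable_unit_cube (d : nat) : measurable (@unit_cube R d).
Proof.
rewrite unit_cubeE.
exact: (@measurable_box d (fun=> `[0, 1]%classic)).
Qed.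

Lemma lebesgue1_itv (b0 b1 : bool) (a b : R) : a <= b ->
  lebesgue1 [set` Interval (BSide b0 a) (BSide b1 b)] = (b - a)%:E.
Proof.
move=> ab; rewrite /lebesgue1 lebesgue_measure_itv/= lte_fin.
by case: ltgtP ab => // -> _; rewrite subrr.
Qed.

Lemma lebesgue_unit_cube (d : nat) : lebesgue_tuple R d (@unit_cube R d) = 1%E.
Proof.
rewrite unit_cubeE (lebesgue_tuple_box (A := fun=> `[0, 1]%classic))//.
rewrite big1// => i _.
by rewrite lebesgue1_itv// subr0.
Qed.

Lemma bounded_integrable (d : nat) (f : d.-tuple R -> R) (B : R) :
  measurable_fun (unit_cube d) f ->
  (forall x, unit_cube d x -> `|f x| <= B) ->
  (lebesgue_tuple R d).-integrable (unit_cube d) (EFin \o f).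
Proof.
move=> mf fB; have mC := @measurable_unit_cube d.
apply: (@le_integrable _ _ _ (lebesgue_tuple R d) _ mC _ (cst B%:E)).
- exact/measurable_EFinP.
- move=> x xC /=; rewrite lee_fin (le_trans (fB _ xC))// ler_norm//.
- apply/integrableP; split; [exact: measurable_cst|].
  have := @integral_cst _ _ _ (lebesgue_tuple R d) _ mC (`|B%:E|)%E.
  by rewrite [X in (_ * X)%E]lebesgue_unit_cube mule1 => -> ; rewrite ltry.
Qed.

(** Boxes are stable under intersection and generate the product sigma-algebra. The whole space is
    itself a box, so finiteness of [m1] there is the only exhaustion needed. *)
Lemma tuple_measure_unique (n : nat) (m1 m2 : {measure set (n.-tuple R) -> \bar R}) :
  (m1 setT < +oo)%E ->
  (forall A : 'I_n -> set R, (forall i, measurable (A i)) ->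
     m1 [set x | forall i, A i (tnth x i)] = m2 [set x | forall i, A i (tnth x i)]) ->
  forall D, measurable D -> m1 D = m2 D.
Proof.
move=> m1oo m12.
pose G : set (set (n.-tuple R)) := [set D | exists2 A : 'I_n -> set R,
  forall i, measurable (A i) & D = [set x | forall i, A i (tnth x i)]].
have GT : G setT by exists (fun=> setT) => //; apply/seteqP; split.
apply: (measure_unique G (fun=> setT)) => //.
- apply/seteqP; split; last first.
    apply: smallest_sub; first exact: sigma_algebra_measurable.
    by move=> _ [A mA ->]; exact: measurable_box.
  apply: sub_smallest2r; first exact: smallest_sigma_algebra.
  move=> D; rewrite -(bigcup_seq (index_enum _)) => -[i _ [A mA <-]].
  exists (fun j => if j == i then A else setT).
    by move=> j; case: ifP.
  apply/seteqP; split => x /=.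
    by move=> [_ xA] j; case: eqP => // ->.
  by move=> /(_ i); rewrite eqxx.
- move=> _ _ [A mA ->] [B mB ->]; exists (fun i => A i `&` B i).
    by move=> i; exact: measurableI.
  apply/seteqP; split => x /=; first by move=> [xA xB] i; split.
  by move=> xAB; split => i; have [] := xAB i.
- by apply/seteqP; split => // x _; exists 0.
- by move=> _ [A mA ->]; exact: m12.
Qed.

End cube_measure.

(** * Concentration of empirical means *)

Section finite_concentration.
Context (R : realType).

(** From [1 - y <= exp (- y)] follows [exp y * (1 - y) <= 1], while [(1 - y) * (1 + y + 2 * y ^ 2) =
    1 + y ^ 2 * (1 - 2 * y)] is at least 1. *)
Lemma expR_le_quadratic (y : R) : y <= 1 / 2 -> expR y <= 1 + y + 2 * y ^+ 2.
Proof.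
move=> y2; have h := expR_ge1Dx (- y).
have e0 := expR_gt0 y.
have : expR y * (1 - y) <= 1.
  by rewrite -ler_pdivlMl// mulr1 -expRN.
move=> h1; rewrite -(@ler_pM2r _ (1 - y)); last lra.
apply: (le_trans h1); nra.
Qed.

(** Chernoff's method on a finite alphabet: [k] is the word of outcomes of [n] independent draws
    from [pi], so the exponential moment is a sum over words that factors into a product. *)
Lemma hoeffding_upper_tail (I : finType) (pi v : I -> R) (n : nat) (B tau : R) :
  (forall i, 0 <= pi i) -> \sum_i pi i = 1 -> (forall i, `|v i| <= B) ->
  0 < tau ->
  \sum_(k : {ffun 'I_n -> I} |
      n%:R * (\sum_i pi i * v i + tau) < \sum_(i < n) v (k i))
    \prod_(i < n) pi (k i) <= expR (- (n%:R * tau ^+ 2 / (32 * B ^+ 2))).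
Proof.
move=> pi0 pi1 vB tau0; set mu := \sum_i pi i * v i.
have B0 : 0 <= B.
  have [i _|I0] := pickP (fun _ : I => true).
    by apply: le_trans (vB i).
  by move: pi1; rewrite big_pred0// => /eqP; rewrite eq_sym oner_eq0.
have muB : `|mu| <= B.
  apply: le_trans (ler_norm_sum _ _ _) _.
  rewrite -[B]mul1r -pi1 mulr_suml ler_sum// => i _.
  by rewrite normrM (ger0_norm (pi0 i)) ler_wpM2l.
(* If [tau > 2 * B] the event is empty. Otherwise [lam * (v j - mu)] stays below 1/2, where the
   quadratic bound on the exponential is valid. *)
have [tB|tB] := ltP (2 * B) tau.
  rewrite big_pred0 ?expR_ge0// => k; apply/negbTE; rewrite -leNgt.
  rewrite -[n in n%:R](card_ord n) -sumr_const mulr_suml ler_sum// => i _.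
  rewrite mul1r.
  have := vB (k i); rewrite ler_norml => /andP[_ h].
  by move: muB; rewrite ler_norml => /andP[h' _]; lra.
have Bp : 0 < B by lra.
(* Minimizer of [8 * B ^ 2 * lam ^ 2 - lam * tau], the exponent found below; its minimum is
   [- tau ^ 2 / (32 * B ^ 2)]. *)
pose lam : R := tau / (16 * B ^+ 2).
have B2 : 0 < B ^+ 2 by rewrite exprn_gt0.
have lam0 : 0 < lam by rewrite divr_gt0// mulr_gt0.
have step1 (k : {ffun 'I_n -> I}) :
    n%:R * (mu + tau) < \sum_(i < n) v (k i) ->
    \prod_(i < n) pi (k i) <=
    \prod_(i < n) (pi (k i) * expR (lam * (v (k i) - mu - tau))).
  move=> hk; rewrite big_split/= -expR_sum ler_peMr ?prodr_ge0//.
  rewrite -expR0 ler_expR -mulr_sumr mulr_ge0 ?(ltW lam0)//.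
  have -> : \sum_(i < n) (v (k i) - mu - tau) =
      \sum_(i < n) v (k i) - n%:R * (mu + tau).
    by rewrite !sumrB !sumr_const card_ord -(mulr_natl mu) -(mulr_natl tau) mulrDr opprD addrA.
  by rewrite subr_ge0 ltW.
have step2 : \sum_(k : {ffun 'I_n -> I} |
      n%:R * (mu + tau) < \sum_(i < n) v (k i)) \prod_(i < n) pi (k i) <=
    \prod_(i < n) \sum_j (pi j * expR (lam * (v j - mu - tau))).
  rewrite bigA_distr_bigA/=.
  apply: le_trans; first by apply: ler_sum => k; exact: step1.
  rewrite big_mkcond/=; apply: ler_sum => k _; case: ifP => // _.
  by apply: prodr_ge0 => i _; rewrite mulr_ge0// expR_ge0.
apply: (le_trans step2).
have step3 : \sum_j (pi j * expR (lam * (v j - mu - tau))) <=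
    expR (- (tau ^+ 2 / (32 * B ^+ 2))).
  have h j : pi j * expR (lam * (v j - mu - tau)) <=
     pi j * (1 + lam * (v j - mu) + 2 * lam ^+ 2 * (2 * B) ^+ 2) * expR (- lam * tau).
    rewrite -mulrA ler_wpM2l//.
    rewrite (_ : lam * (v j - mu - tau) = lam * (v j - mu) + (- lam * tau)); last ring.
    rewrite expRD ler_pM2r ?expR_gt0//.
    have /andP[v1 v2] : - B <= v j <= B by rewrite -ler_norml.
    have /andP[m1 m2] : - B <= mu <= B by rewrite -ler_norml.
    have d2 : (v j - mu) ^+ 2 <= (2 * B) ^+ 2.
      rewrite -(real_normK (num_real (v j - mu))) ler_sqr ?nnegrE ?mulr_ge0//.
      by rewrite ler_norml; apply/andP; split; lra.
    apply: le_trans (expR_le_quadratic _) _.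
      have : lam * (v j - mu) <= lam * (2 * B) by rewrite ler_pM2l//; lra.
      have -> : lam * (2 * B) = tau / (8 * B) by rewrite /lam; field; lra.
      move/le_trans; apply; rewrite ler_pdivrMr; lra.
    rewrite lerD2l exprMn mulrA ler_wpM2l// mulr_ge0// exprn_ge0// ltW//.
  apply: le_trans; first by apply: ler_sum => j _; exact: h.
  rewrite -mulr_suml.
  under eq_bigr do rewrite -addrA mulrDr mulr1 mulrDr mulrCA.
  rewrite !big_split/= pi1 -mulr_sumr -mulr_suml pi1 mul1r.
  have -> : \sum_i pi i * (v i - mu) = 0.
    under eq_bigr do rewrite mulrBr.
    by rewrite sumrB -mulr_suml pi1 mul1r subrr.
  rewrite mulr0 add0r.
  apply: (@le_trans _ _ (expR (2 * lam ^+ 2 * (2 * B) ^+ 2) * expR (- lam * tau))).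
    by rewrite ler_pM2r ?expR_gt0// expR_ge1Dx.
  rewrite -expRD ler_expR le_eqVlt; apply/orP; left; apply/eqP.
  by rewrite /lam; field; lra.
apply: (@le_trans _ _ (\prod_(i < n) expR (- (tau ^+ 2 / (32 * B ^+ 2))))).
  apply: ler_prod => i _; rewrite step3 andbT.
  by apply: sumr_ge0 => j _; rewrite mulr_ge0// expR_ge0.
rewrite -expR_sum ler_expR sumr_const card_ord.
by rewrite -(mulr_natl (- _) n) mulrN mulrA.
Qed.

Lemma hoeffding_finite (I : finType) (pi v : I -> R) (n : nat) (B tau : R) :
  (forall i, 0 <= pi i) -> \sum_i pi i = 1 -> (forall i, `|v i| <= B) ->
  0 < tau ->
  \sum_(k : {ffun 'I_n -> I} |
      n%:R * tau < `|\sum_(i < n) v (k i) - n%:R * \sum_i pi i * v i|)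
    \prod_(i < n) pi (k i) <= 2 * expR (- (n%:R * tau ^+ 2 / (32 * B ^+ 2))).
Proof.
move=> pi0 pi1 vB tau0; rewrite (mulr_natl (expR _) 2) mulr2n.
have vNB i : `|- v i| <= B by rewrite normrN.
apply: (le_trans _ (lerD (hoeffding_upper_tail n pi0 pi1 vB tau0)
  (hoeffding_upper_tail n pi0 pi1 vNB tau0))).
under [X in _ <= _ + X]eq_bigl => k.
  under eq_bigr do rewrite mulrN.
  rewrite !sumrN; over.
rewrite [X in X <= _]big_mkcond [X in _ <= X + _]big_mkcond [X in _ <= _ + X]big_mkcond/=.
rewrite -big_split/=; apply: ler_sum => k _.
have p0 : 0 <= \prod_(i < n) pi (k i) by apply: prodr_ge0.
set s := \sum_(i < n) v (k i); set m := \sum_i _.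
rewrite ltr_normr !mulrDr mulrN.
have -> : (n%:R * tau < s - n%:R * m) = (n%:R * m + n%:R * tau < s).
  by rewrite ltrBrDr addrC.
have -> : (n%:R * tau < - (s - n%:R * m)) = (- (n%:R * m) + n%:R * tau < - s).
  by rewrite opprB ltrBrDr -[RHS](ltrD2r (n%:R * m + s)); congr (_ < _); ring.
by case: (_ < s); case: (_ < - s); rewrite /= ?addr0 ?add0r ?lerDl.
Qed.

End finite_concentration.

Section concentration.
Context (R : realType).

Lemma measure_bigsetU_le (d0 : measure_display) (T : measurableType d0)
    (mu : {measure set T -> \bar R}) (I : Type) (s : seq I) (Q : pred I)
    (F : I -> set T) :
  (forall i, measurable (F i)) ->
  (mu (\big[setU/set0]_(i <- s | Q i) F i) <= \sum_(i <- s | Q i) mu (F i))%E.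
Proof.
move=> mF; elim: s => [|a s ih]; first by rewrite !big_nil measure0.
rewrite !big_cons; case: ifP => // _.
apply: le_trans (measureU2 _ _ _) _ => //; last exact: leeD2l.
exact: bigsetU_measurable.
Qed.

Lemma Rintegral_partition (d : nat) (I : finType) (A : I -> set (d.-tuple R))
    (g : d.-tuple R -> R) (B : R) :
  (forall i, measurable (A i)) -> trivIset setT A ->
  \big[setU/set0]_(i : I) A i = unit_cube d ->
  measurable_fun (unit_cube d) g -> (forall x, unit_cube d x -> `|g x| <= B) ->
  \int[lebesgue_tuple R d]_(x in unit_cube d) g x =
  \sum_i \int[lebesgue_tuple R d]_(x in A i) g x.
Proof.
move=> mA tA AC mg gB.
have AsubC i : A i `<=` unit_cube d.
  by rewrite -AC => x Ax; rewrite (bigD1 i)//=; left.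
rewrite /Rintegral -{1}AC integral_bigsetU_EFin ?AC//.
- rewrite -sum_fine// => i _; apply: integrable_fin_num => //.
  apply: integrableS (bounded_integrable mg gB) => //.
  exact: measurable_unit_cube.
- exact: index_enum_uniq.
- exact: sub_trivIset tA.
- exact/measurable_EFinP.
Qed.

(* [f] is rounded to finitely many values, so that the independence of events
   suffices to factor the exponential moments. *)
Lemma concentration (d : nat) (p : d.-tuple R -> R) (Mp : R)
    (d0 : measure_display) (T : measurableType d0) (P : probability T R)
    (n : nat) (X : 'I_n -> {RV P >-> d.-tuple R}) (f : d.-tuple R -> R)
    (B tau : R) :
  prob_density p -> (forall x, unit_cube d x -> p x <= Mp) ->
  measurable_fun (unit_cube d) f -> (forall x, unit_cube d x -> `|f x| <= B) ->
  (forall i t, unit_cube d (X i t)) -> iid_with_density X p ->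
  (0 < n)%N -> 0 < B -> 0 < tau ->
  exists E : set T, [/\ measurable E,
    ((1 - 2 * expR (- (n%:R * tau ^+ 2 / (32 * B ^+ 2))))%:E <= P E)%E &
    forall t, E t -> `|n%:R^-1 * (\sum_(i < n) f (X i t)) -
       \int[lebesgue_tuple R d]_(x in unit_cube d) (f x * p x)| <= 3 * tau].
Proof.
move=> [mp p0 p1] pM mf fB XC [indep dens] n0 B0 tau0.
have mC := @measurable_unit_cube R d.
(* Rounding to a mesh [delta <= tau] costs [delta] in the empirical mean and [delta] in the
   integral; with the fluctuation [tau] this makes [3 * tau]. *)
have [m m0 mtau] : exists2 m, (0 < m)%N & 2 * B / m%:R <= tau.
  exists (Num.truncn (2 * B / tau)).+1 => //.
  rewrite ler_pdivrMr ?ltr0n// (mulrC tau) -ler_pdivrMr//.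
  by rewrite ltW// truncnS_gt.
pose delta : R := 2 * B / m%:R.
have m0R : 0 < m%:R :> R by rewrite ltr0n.
have delta0 : 0 < delta by rewrite divr_gt0// mulr_gt0.
have mdelta : m%:R * delta = 2 * B by rewrite /delta mulrC divfK// gt_eqF.
(* The cells are half-open, so [m] of them miss the value [B]; the additional last one contains
   it. *)
pose v (k : 'I_m.+1) : R := - B + k%:R * delta.
have vB k : `|v k| <= B.
  have k0 : 0 <= k%:R * delta by rewrite mulr_ge0// ltW.
  have km : k%:R * delta <= m%:R * delta.
    by rewrite ler_pM2r// ler_nat -ltnS.
  by rewrite ler_norml /v; apply/andP; split; lra.
pose A (k : 'I_m.+1) := unit_cube d `&` f @^-1` `[v k, v k + delta[.
have mA k : measurable (A k) by exact: mf.
have AE k x : unit_cube d x -> A k x <-> Num.truncn ((f x + B) / delta) = k :> nat.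
  move=> xC; have /andP[fx1 fx2] : - B <= f x <= B by rewrite -ler_norml fB.
  have y0 : 0 <= (f x + B) / delta by rewrite divr_ge0 ?(ltW delta0)//; lra.
  have -> : (Num.truncn ((f x + B) / delta) = k :> nat) <->
    (k%:R <= (f x + B) / delta < k.+1%:R).
    by rewrite -truncn_eq//; split => [->|/eqP].
  rewrite ler_pdivlMr// ltr_pdivrMr//.
  rewrite /A /= in_itv/= /v -natr1 mulrDl mul1r.
  split; first by move=> [_ /andP[h1 h2]]; apply/andP; split; lra.
  by move=> /andP[h1 h2]; split => //; apply/andP; split; lra.
have Aex x : unit_cube d x -> exists k, A k x.
  move=> xC; have /andP[fx1 fx2] : - B <= f x <= B by rewrite -ler_norml fB.
  have km : (Num.truncn ((f x + B) / delta) < m.+1)%N.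
    rewrite ltnS -(ler_nat R); apply: (@le_trans _ _ ((f x + B) / delta)).
      by rewrite truncn_le divr_ge0 ?(ltW delta0)//; lra.
    by rewrite ler_pdivrMr// mdelta; lra.
  by exists (Ordinal km); apply/AE.
have tA : trivIset setT A.
  apply/trivIsetP => i j _ _ ij; apply/seteqP; split => // x [Ai Aj].
  have xC : unit_cube d x by case: Ai.
  move/(AE i _ xC) : Ai => Ai; move/(AE j _ xC) : Aj; rewrite Ai => /val_inj ij'.
  by move/eqP : ij.
have AC : \big[setU/set0]_(i < m.+1) A i = unit_cube d.
  apply/seteqP; split => x.
    by rewrite -(bigcup_seq (index_enum _)) => -[i _ []].
  move=> xC; have [k Ak] := Aex x xC.
  by rewrite -(bigcup_seq (index_enum _)); exists k => //=; rewrite mem_index_enum.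
have AsubC i : A i `<=` unit_cube d by move=> x [].
have Mp0 : 0 <= Mp.
  have xC : unit_cube d [tuple (0 : R) | i < d].
    by move=> i; rewrite tnth_mktuple lexx ler01.
  exact: le_trans (p0 _ xC) (pM _ xC).
have pB x : unit_cube d x -> `|p x| <= Mp.
  by move=> xC; rewrite ger0_norm ?p0 ?pM.
have fpB x : unit_cube d x -> `|f x * p x| <= B * Mp.
  by move=> xC; rewrite normrM ler_pM ?fB ?pB.
have mfp : measurable_fun (unit_cube d) (fun x => f x * p x).
  exact: measurable_funM.
have ip := bounded_integrable mp pB.
have ifp := bounded_integrable mfp fpB.
pose pi k : R := \int[lebesgue_tuple R d]_(x in A k) p x.
have pi0 k : 0 <= pi k by apply: Rintegral_ge0 => x /AsubC/p0.
have pi1 : \sum_k pi k = 1.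
  by rewrite /pi -(Rintegral_partition mA tA AC mp pB) /Rintegral p1.
have PX i k : P (X i @^-1` A k) = (pi k)%:E.
  have := dens i (A k) (mA k); rewrite /distribution/= /pushforward => ->.
  rewrite (setIidl (AsubC k)) /pi /Rintegral fineK//.
  by apply: integrable_fin_num => //; exact: integrableS ip.
have mu_near : `|\sum_k pi k * v k -
    \int[lebesgue_tuple R d]_(x in unit_cube d) (f x * p x)| <= delta.
  rewrite (Rintegral_partition mA tA AC mfp fpB) -sumrB.
  apply: le_trans (ler_norm_sum _ _ _) _.
  rewrite -[delta]mul1r -pi1 mulr_suml ler_sum// => k _.
  have iAp := integrableS mC (mA k) (AsubC k) ip.
  have iAfp := integrableS mC (mA k) (AsubC k) ifp.
  have lo : v k * pi k <= \int[lebesgue_tuple R d]_(x in A k) (f x * p x).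
    rewrite /pi -RintegralZl//; apply: le_Rintegral => //.
      by have := integrableZl (mA k) (v k) iAp.
    move=> x Ax; rewrite ler_wpM2r ?p0//; first exact: AsubC Ax.
    by case: Ax => _; rewrite /= in_itv/= => /andP[].
  have hi : \int[lebesgue_tuple R d]_(x in A k) (f x * p x) <= (v k + delta) * pi k.
    rewrite /pi -RintegralZl//; apply: le_Rintegral => //.
      by have := integrableZl (mA k) (v k + delta) iAp.
    move=> x Ax; rewrite ler_wpM2r ?p0//; first exact: AsubC Ax.
    by case: Ax => _; rewrite /= in_itv/= => /andP[_ /ltW].
  move: lo hi; set I := \int[_]_(x in _) _; move=> lo hi.
  by rewrite ler_norml; apply/andP; split; lra.
pose S (k : {ffun 'I_n -> 'I_m.+1}) : set T := \bigcap_i (X i @^-1` A (k i)).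
have mS k : measurable (S k).
  apply: fin_bigcap_measurable => // i _.
  by rewrite -[X in measurable X]setTI; exact: measurable_funP.
have PS k : P (S k) = (\prod_(i < n) pi (k i))%:E.
  rewrite /S (indep (fun i => A (k i)))//.
  by under eq_bigr do rewrite PX; rewrite prodEFin.
pose bad (k : {ffun 'I_n -> 'I_m.+1}) :=
  n%:R * tau < `|\sum_(i < n) v (k i) - n%:R * \sum_i pi i * v i|.
pose Bad := \big[setU/set0]_(k | bad k) S k.
have mBad : measurable Bad by apply: bigsetU_measurable.
exists (~` Bad); split; first exact: measurableC.
  rewrite probability_setC// EFinB leeB//.
  apply: le_trans (measure_bigsetU_le _ _ _ mS) _.
  rewrite (eq_bigr (fun k : {ffun _ -> _} => (\prod_(i < n) pi (k i))%:E)); last first.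
    by move=> k _; exact: PS.
  by rewrite sumEFin lee_fin; apply: hoeffding_finite.
move=> t tBad.
pose k : {ffun 'I_n -> 'I_m.+1} := [ffun i => sval (cid (Aex _ (XC i t)))].
have kA i : A (k i) (X i t) by rewrite ffunE; case: cid.
have : ~~ bad k.
  apply/negP => bk; apply: tBad; rewrite /Bad -bigcup_seq_cond.
  by exists k => [/=|i _]; [rewrite mem_index_enum|exact: kA].
rewrite -leNgt => hk.
have nR : 0 < n%:R :> R by rewrite ltr0n.
have hf : `|\sum_(i < n) f (X i t) - \sum_(i < n) v (k i)| <= n%:R * delta.
  rewrite -sumrB; apply: le_trans (ler_norm_sum _ _ _) _.
  rewrite mulr_natl -[n in _ *+ n](card_ord n) -sumr_const ler_sum// => i _.
  have [_] := kA i; rewrite /= in_itv/= => /andP[h1 h2].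
  by rewrite ler_norml; apply/andP; split; lra.
have hk' : `|n%:R^-1 * \sum_(i < n) f (X i t) - \sum_i pi i * v i| <= delta + tau.
  rewrite -(ler_pM2l nR) -[X in X * `|_|](ger0_norm (ltW nR)) -normrM mulrBr mulrA.
  rewrite mulfV ?gt_eqF// mul1r.
  rewrite -(subrKA (\sum_(i < n) v (k i))) mulrDr.
  by apply: le_trans (ler_normD _ _) _; rewrite lerD.
rewrite -(subrKA (\sum_i pi i * v i)).
apply: le_trans (ler_normD _ _) _.
have : delta <= tau by [].
lra.
Qed.

End concentration.

(** * Factorization of Markov densities *)

Section conditional_versions.
Context (R : realType) (d0 d3 : measure_display) (T : measurableType d0)
  (U : measurableType d3) (P : probability T R) (Z : T -> U).
Hypothesis mZ : measurable_fun setT Z.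

Lemma measurable_preimage (D : set U) : measurable D -> measurable (Z @^-1` D).
Proof. by move=> mD; rewrite -[X in measurable X]setTI; exact: mZ. Qed.

Lemma cond_probT : cond_prob P Z setT (cst 1).
Proof.
split; first exact: measurable_cst.
move=> D mD; rewrite setTI.
have := @integral_cst _ _ _ P _ (measurable_preimage mD) 1%E.
by rewrite mul1e => <-.
Qed.

(** The exceptional set is the union of the sets [N j] on which [h1 - k * h2 >= 1 / (j + 1)] and
    both versions are at most [j] in absolute value. Versions are only known to be measurable; this
    truncation makes them integrable, and the hypothesis tested on [D = N j] forces measure 0. *)
Lemma cond_prob_le (E1 E2 : set T) (h1 h2 : U -> R) (D0 : set U) (k : R) :
  cond_prob P Z E1 h1 -> cond_prob P Z E2 h2 -> measurable D0 ->
  (forall D, measurable D -> D `<=` D0 ->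
    (P (E1 `&` Z @^-1` D) <= k%:E * P (E2 `&` Z @^-1` D))%E) ->
  exists N : set U, [/\ measurable N, P (Z @^-1` N) = 0%E &
    forall z, D0 z -> ~ N z -> h1 z <= k * h2 z].
Proof.
move=> [mh1 ch1] [mh2 ch2] mD0 le12.
pose g z := h1 z - k * h2 z.
have mg : measurable_fun setT g by apply: measurable_funB => //; exact: measurable_funM.
pose N (j : nat) := D0 `&` [set z | `|h1 z| <= j%:R] `&` [set z | `|h2 z| <= j%:R]
  `&` [set z | j.+1%:R^-1 <= g z].
have mN j : measurable (N j).
  apply: measurableI; first apply: measurableI; first apply: measurableI => //.
  - rewrite -[X in measurable X]setTI; apply: measurable_fun_le => //.
    exact: measurableT_comp.
  - rewrite -[X in measurable X]setTI; apply: measurable_fun_le => //.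
    exact: measurableT_comp.
  - by rewrite -[X in measurable X]setTI; apply: measurable_fun_le.
have N0 j : P (Z @^-1` N j) = 0%E.
  have mD := measurable_preimage (mN j).
  have cst_int (r : R) : P.-integrable (Z @^-1` N j) (cst r%:E).
    apply/integrableP; split; first exact: measurable_cst.
    have := @integral_cst _ _ _ P _ mD (`|r%:E|)%E => ->.
    rewrite lte_mul_pinfty// ?ltry//.
    by rewrite (le_lt_trans (probability_le1 _ _)) ?ltry.
  have ih1 : P.-integrable (Z @^-1` N j) (fun t => (h1 (Z t))%:E).
    apply: (@le_integrable _ _ _ P _ mD _ (cst j%:R%:E)) => //.
    - apply/measurable_EFinP/measurable_funTS.
      exact: measurableT_comp.
    - by move=> t [[[_ ht] _] _] /=; rewrite lee_fin (le_trans ht)// ler_norm.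
  have ih2 : P.-integrable (Z @^-1` N j) (fun t => (h2 (Z t))%:E).
    apply: (@le_integrable _ _ _ P _ mD _ (cst j%:R%:E)) => //.
    - apply/measurable_EFinP/measurable_funTS.
      exact: measurableT_comp.
    - by move=> t [[[_ _] ht] _] /=; rewrite lee_fin (le_trans ht)// ler_norm.
  have NsubD0 : N j `<=` D0 by move=> z [[[]]].
  have := le12 _ (mN j) NsubD0; rewrite ch1// ch2//.
  have hge : (j.+1%:R^-1%:E * P (Z @^-1` N j) <=
      \int[P]_(t in Z @^-1` N j) (h1 (Z t) - k * h2 (Z t))%:E)%E.
    rewrite -integral_cst//; apply: le_integral => //.
      exact: (integrableB mD ih1 (integrableZl mD k ih2)).
    by move=> t; rewrite inE => -[_ /=]; rewrite lee_fin.
  move: hge; under eq_integral do rewrite EFinB EFinM.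
  rewrite integralB//; last exact: integrableZl.
  rewrite integralZl//.
  have f1 := integrable_fin_num mD ih1; have f2 := integrable_fin_num mD ih2.
  move=> hge hle.
  (* The integral of [h1 - k * h2] over [N j] is at most 0 by hypothesis and at least
     [P (N j) / (j + 1)]. *)
  have := le_trans hge (leeB hle (lexx _)).
  rewrite subee ?fin_numM// => h.
  apply/eqP; rewrite eq_le measure_ge0 andbT.
  move: h; rewrite -(fineK (fin_num_measure P _ mD)) -EFinM !lee_fin.
  by rewrite pmulr_rle0// invr_gt0 ltr0n.
exists (\bigcup_j N j); split.
- exact: bigcupT_measurable.
- rewrite preimage_bigcup; apply/eqP; rewrite -measure_le0.
  have mF j : measurable (Z @^-1` N j) by exact: measurable_preimage.
  have := @measure_sigma_subadditive _ _ _ P (\bigcup_j (Z @^-1` N j))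
    (fun j => Z @^-1` N j) mF (bigcupT_measurable _ mF) (@subset_refl _ _).
  by move/le_trans; apply; rewrite eseries0 // => j _ _; exact: N0.
- move=> z D0z NN; rewrite leNgt; apply/negP => hlt.
  have g0 : 0 < g z by rewrite subr_gt0.
  pose j := maxn (Num.truncn `|h1 z|).+1 (maxn (Num.truncn `|h2 z|).+1 (Num.truncn (g z)^-1).+1).
  apply: NN; exists j => //; split; [split; [split => //|]|] => /=.
  - by apply: ltW; apply: lt_le_trans (truncnS_gt _) _; rewrite ler_nat leq_maxl.
  - by apply: ltW; apply: lt_le_trans (truncnS_gt _) _; rewrite ler_nat !leq_max leqnn orbT.
  - rewrite -[leRHS]invrK lef_pV2 ?posrE ?invr_gt0// ltW//.
    apply: lt_le_trans (truncnS_gt _) _; rewrite ler_nat.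
    by rewrite leqW// !leq_max leqnn !orbT.
Qed.

End conditional_versions.

Section tuple_preimage.
Context (R : realType) (d0 : measure_display) (T : measurableType d0)
  (mu : {measure set T -> \bar R}).

(** Both sides are finite measures in [D]: the images under [Z] of [mu] restricted to [S1] and,
    scaled by [r], to [S2]. Agreement on boxes is therefore enough. *)
Lemma tuple_preimage_unique (n : nat) (Z : T -> n.-tuple R) (S1 S2 : set T) (r : R) :
  measurable_fun setT Z -> measurable S1 -> measurable S2 -> 0 <= r ->
  (mu S1 < +oo)%E ->
  (forall A : 'I_n -> set R, (forall i, measurable (A i)) ->
     mu (Z @^-1` [set x | forall i, A i (tnth x i)] `&` S1) =
     (r%:E * mu (Z @^-1` [set x | forall i, A i (tnth x i)] `&` S2))%E) ->
  forall D, measurable D ->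
    mu (Z @^-1` D `&` S1) = (r%:E * mu (Z @^-1` D `&` S2))%E.
Proof.
move=> mZ mS1 mS2 r0 S1oo boxE D mD.
pose m1 : {measure set (n.-tuple R) -> \bar R} := pushforward (mrestr mu mS1) Z.
pose m2 : {measure set (n.-tuple R) -> \bar R} :=
  mscale (NngNum r0) (pushforward (mrestr mu mS2) Z).
change (m1 mZ D = m2 mZ D).
apply: tuple_measure_unique => //.
by rewrite /m1/= /pushforward /mrestr preimage_setT setTI.
Qed.

End tuple_preimage.

Section almost_everywhere_on.
Context (R : realType) (d0 d3 : measure_display) (T : measurableType d0)
  (U : measurableType d3) (P : probability T R) (Z : T -> U) (D0 : set U).
Hypothesis mZ : measurable_fun setT Z.

(** Almost everywhere on [D0] for the law of [Z]. The null set is explicit and measurable, so that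
    finitely many such statements can be intersected. *)
Definition ae_on (Q : U -> Prop) : Prop :=
  exists N : set U, [/\ measurable N, P (Z @^-1` N) = 0%E &
    forall z, D0 z -> ~ N z -> Q z].

Lemma ae_onW (Q Q' : U -> Prop) :
  (forall z, Q z -> Q' z) -> ae_on Q -> ae_on Q'.
Proof.
move=> QQ' [N [mN N0 NQ]]; exists N; split => // z D0z Nz.
exact: QQ' (NQ _ D0z Nz).
Qed.

Lemma ae_on_and (Q Q' : U -> Prop) :
  ae_on Q -> ae_on Q' -> ae_on (fun z => Q z /\ Q' z).
Proof.
move=> [N [mN N0 NQ]] [N' [mN' N0' NQ']]; exists (N `|` N'); split.
- exact: measurableU.
- rewrite preimage_setU; apply/eqP; rewrite -measure_le0.
  have := measureU2 P (measurable_preimage mZ mN) (measurable_preimage mZ mN').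
  by move/le_trans; apply; rewrite [X in (X + _)%E]N0 [X in (_ + X)%E]N0' adde0.
- by move=> z D0z /not_orP[Nz N'z]; split; [exact: NQ|exact: NQ'].
Qed.

(** A null set cannot cover an event of positive probability; this turns almost sure comparisons
    into comparisons at an actual point. *)
Lemma ae_on_exists (Q : U -> Prop) : measurable D0 ->
  (0 < P (Z @^-1` D0))%E -> ae_on Q -> exists z, Q z.
Proof.
move=> mD0 PD0 [N [mN N0 NQ]]; apply: contrapT => /forallNP nQ.
have sub : Z @^-1` D0 `<=` Z @^-1` N.
  by move=> t Dt; apply: contrapT => Nt; exact: nQ (Z t) (NQ _ Dt Nt).
have : (P (Z @^-1` D0) <= P (Z @^-1` N))%E.
  by apply: le_measure; rewrite ?inE//; exact: measurable_preimage.
by rewrite N0 leNgt PD0.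
Qed.

Lemma cond_prob_ae_le (E1 E2 : set T) (h1 h2 : U -> R) (k : R) :
  cond_prob P Z E1 h1 -> cond_prob P Z E2 h2 -> measurable D0 ->
  (forall D, measurable D -> D `<=` D0 ->
    (P (E1 `&` Z @^-1` D) <= k%:E * P (E2 `&` Z @^-1` D))%E) ->
  ae_on (fun z => h1 z <= k * h2 z).
Proof. by move=> c1 c2 mD0 /(cond_prob_le mZ c1 c2 mD0). Qed.

Lemma cond_prob_ae_eq (E : set T) (h1 h2 : U -> R) :
  cond_prob P Z E h1 -> cond_prob P Z E h2 -> measurable D0 ->
  ae_on (fun z => h1 z = h2 z).
Proof.
move=> c1 c2 mD0.
have le12 D : measurable D -> D `<=` D0 ->
    (P (E `&` Z @^-1` D) <= 1%:E * P (E `&` Z @^-1` D))%E.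
  by rewrite mul1e.
apply: ae_onW (ae_on_and (cond_prob_ae_le c1 c2 mD0 le12)
  (cond_prob_ae_le c2 c1 mD0 le12)) => z.
by rewrite !mul1r => -[z1 z2]; apply/eqP; rewrite eq_le z1.
Qed.

End almost_everywhere_on.

(** * Small boxes and cylinders in the cube *)

Section near_intervals.
Context (R : realType).

(* For [s] and [h] in [0, 1]: an interval of length exactly [h] inside [0, 1]
   that contains [s]. *)
Definition near_itv (h s : R) : set R := `[s * (1 - h), s * (1 - h) + h]%classic.

Lemma near_itv_measurable h s : measurable (near_itv h s).
Proof. exact: measurable_itv. Qed.

Lemma near_itv01 h s t : 0 <= h <= 1 -> 0 <= s <= 1 -> near_itv h s t ->
  0 <= t <= 1.
Proof.
rewrite /near_itv /= in_itv/= => /andP[h0 h1] /andP[s0 s1] /andP[t0 t1].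
by apply/andP; split; nra.
Qed.

Lemma near_itv_dist h s t : 0 <= h <= 1 -> 0 <= s <= 1 -> near_itv h s t ->
  `|t - s| <= h.
Proof.
rewrite /near_itv /= in_itv/= => /andP[h0 h1] /andP[s0 s1] /andP[t0 t1].
by rewrite ler_norml; apply/andP; split; nra.
Qed.

Lemma lebesgue_near_itv h s : 0 <= h -> lebesgue1 (near_itv h s) = h%:E.
Proof. by move=> h0; rewrite lebesgue1_itv ?lerDl// addrC addKr. Qed.

End near_intervals.

Section coordinates.
Context (R : realType) (d : nat).

Lemma measurable_subvector (K : {set 'I_d}) :
  measurable_fun [set: d.-tuple R] (subvector K).
Proof.
apply/measurable_fun_tnthP => i.
rewrite (_ : _ \o _ = fun x : d.-tuple R => tnth x (enum_val i)).
  exact: measurable_tnth.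
by apply/funext => x; rewrite /= tnth_mktuple.
Qed.

Lemma subvector_box (K : {set 'I_d}) (I : 'I_d -> set R) :
  subvector K @^-1` [set z | forall k, I (enum_val k) (tnth z k)] =
  [set x : d.-tuple R | forall l, l \in K -> I l (tnth x l)].
Proof.
apply/seteqP; split => x /= xI.
  move=> l lK; have := xI (enum_rank_in lK l).
  by rewrite tnth_mktuple enum_rankK_in.
by move=> k; rewrite tnth_mktuple; apply: xI; exact: enum_valP.
Qed.

(** Fubini's theorem for the coordinates [i] and [j] against all others. For a box [D] both sides
    are products of lengths; uniqueness of measures extends the identity to measurable [D]. *)
Lemma lebesgue_cylinder (i j : 'I_d) (I J : set R) (D : set (#|~: [set i; j]|.-tuple R)) :
  i != j -> measurable I -> measurable J -> I `<=` `[0, 1]%classic -> J `<=` `[0, 1]%classic ->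
  measurable D ->
  lebesgue_tuple R d (subvector (~: [set i; j]) @^-1` D `&`
    [set x | [/\ unit_cube d x, I (tnth x i) & J (tnth x j)]]) =
  (lebesgue1 I * lebesgue1 J *
   lebesgue_tuple R d (subvector (~: [set i; j]) @^-1` D `&` unit_cube d))%E.
Proof.
move=> ij mI mJ I01 J01; move: D.
have fin1 (A : set R) : measurable A -> A `<=` `[0, 1]%classic ->
    exists2 a : R, 0 <= a & lebesgue1 A = a%:E.
  move=> mA A01; exists (fine (lebesgue1 A)); first exact: fine_ge0.
  rewrite fineK// ge0_fin_numE//.
  apply: (@le_lt_trans _ _ (lebesgue1 `[0, 1]%classic)).
    by apply: le_measure; rewrite ?inE.
  by rewrite lebesgue1_itv ?ltry.
have I01' y : I y -> 0 <= y <= 1 by move/I01; rewrite /= in_itv.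
have J01' y : J y -> 0 <= y <= 1 by move/J01; rewrite /= in_itv.
have [a a0 Ia] := fin1 _ mI I01; have [b b0 Jb] := fin1 _ mJ J01.
pose B (l : 'I_d) : set R := if l == i then I else if l == j then J else `[0, 1]%classic.
have mB l : measurable (B l) by rewrite /B; case: ifP => // _; case: ifP.
have BE : [set x | [/\ unit_cube d x, I (tnth x i) & J (tnth x j)]] =
    [set x : d.-tuple R | forall l, B l (tnth x l)].
  apply/seteqP; split => x /=.
    move=> [xC xi xj] l; rewrite /B; case: eqP => [->//|_]; case: eqP => [->//|_].
    by have := xC l; rewrite /= in_itv.
  move=> xB; split.
  - move=> l; have := xB l; rewrite /B; case: eqP => [_|_].
      by move=> /I01'.
    by case: eqP => [_ /J01'|_].
  - by have := xB i; rewrite /B eqxx.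
  - by have := xB j; rewrite /B (negbTE (_ : j != i)) ?eqxx// eq_sym.
have mS : measurable [set x | [/\ unit_cube d x, I (tnth x i) & J (tnth x j)]].
  by rewrite BE; exact: measurable_box.
rewrite Ia Jb -EFinM; apply: tuple_preimage_unique => //.
- exact: measurable_subvector.
- exact: measurable_unit_cube.
- exact: mulr_ge0.
- apply: (@le_lt_trans _ _ (lebesgue_tuple R d (unit_cube d))).
    apply: le_measure; rewrite ?inE//; first exact: measurable_unit_cube.
    by move=> x [].
  by rewrite lebesgue_unit_cube ltry.
move=> A mA.
(* The constraint of the box on coordinate [l]: an intersection over the at most one index sent to
   [l] by [enum_val], hence the full line for [l = i] and [l = j]. *)
pose A' (l : 'I_d) : set R := \bigcap_(k in [set k : 'I_#|~: [set i; j]| | enum_val k = l]) A k.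
have mA' l : measurable (A' l) by apply: fin_bigcap_measurable.
have A'E l : l \notin ~: [set i; j] -> A' l = setT.
  move=> lC; apply/seteqP; split => // y _ k /= kl.
  by move: lC; rewrite -kl enum_valP.
have boxE (G : 'I_d -> set R) :
    subvector (~: [set i; j]) @^-1` [set x | forall k, A k (tnth x k)] `&`
      [set x | forall l, G l (tnth x l)] =
    [set x : d.-tuple R | forall l, (A' l `&` G l) (tnth x l)].
  apply/seteqP; split => x /=.
    move=> [xA xG] l; split => // k /= kl.
    by have := xA k; rewrite tnth_mktuple kl.
  move=> xAG; split => l; last by case: (xAG l).
  by rewrite tnth_mktuple; case: (xAG (enum_val l)) => + _; apply.
rewrite unit_cubeE BE (boxE B) (boxE (fun=> `[0, 1]%classic)).
transitivity (\prod_(l < d) lebesgue1 (A' l `&` B l))%E.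
  apply: (lebesgue_tuple_box (A := fun l => A' l `&` B l)) => l.
  exact: measurableI.
rewrite [X in _ = (_ * X)%E](_ : _ =
    \prod_(l < d) lebesgue1 (A' l `&` `[0%R, 1%R]%classic))%E; last first.
  apply: (lebesgue_tuple_box (A := fun l => A' l `&` `[0, 1]%classic)) => l.
  exact: measurableI.
have ji : j != i by rewrite eq_sym.
have iC : i \notin ~: [set i; j] by rewrite !inE eqxx.
have jC : j \notin ~: [set i; j] by rewrite !inE eqxx orbT.
rewrite (bigD1 i)//= (bigD1 j)//= [in RHS](bigD1 i)//= [in RHS](bigD1 j)//=.
rewrite (A'E _ iC) (A'E _ jC) !setTI /B eqxx (negbTE ji) eqxx Ia Jb.
rewrite lebesgue1_itv// subr0 !mul1e muleA -EFinM.
congr (_ * _)%E; apply: eq_bigr => l /andP[li lj].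
by rewrite (negbTE li) (negbTE lj).
Qed.

End coordinates.

Definition set_coord (T : Type) (d : nat) (i : 'I_d) (s : T) (x : d.-tuple T) :
  d.-tuple T := [tuple if l == i then s else tnth x l | l < d].

(** * Cross ratios of a density with two conditionally independent coordinates *)

Section cross_ratio.
Context (R : realType) (d : nat).

Lemma unit_cube_set_coord (i : 'I_d) (s : R) x :
  0 <= s <= 1 -> unit_cube d x -> unit_cube d (set_coord i s x).
Proof. by move=> s01 xC l; rewrite tnth_mktuple; case: ifP. Qed.

Lemma density_bounds (p : d.-tuple R -> R) (P : probability (d.-tuple R) R)
    (U : set (d.-tuple R)) (a b : R) :
  measurable_fun (unit_cube d) p -> has_density P p -> measurable U ->
  U `<=` unit_cube d -> 0 <= a -> (forall x, U x -> a <= p x <= b) ->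
  (a%:E * lebesgue_tuple R d U <= P U)%E /\ (P U <= b%:E * lebesgue_tuple R d U)%E.
Proof.
move=> mp dens mU UC a0 pab; rewrite (dens _ mU) (setIidl UC).
have mpU : measurable_fun U (EFin \o p).
  by apply/measurable_EFinP; apply: measurable_funS mp => //; exact: measurable_unit_cube.
split.
- have := @integral_cst _ _ _ (lebesgue_tuple R d) _ mU a%:E => <-.
  apply: ge0_le_integral => //.
  by move=> x /pab/andP[h _]; rewrite lee_fin.
- have := @integral_cst _ _ _ (lebesgue_tuple R d) _ mU b%:E => <-.
  apply: ge0_le_integral => //.
  + by move=> x /pab/andP[h _]; rewrite lee_fin (le_trans a0).
  + by move=> x /pab/andP[_ h]; rewrite lee_fin.
Qed.

Variables (p : d.-tuple R -> R) (L : R) (P : probability (d.-tuple R) R).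
Variables (i j : 'I_d).
Hypothesis mp : measurable_fun (unit_cube d) p.
Hypothesis p_gt0 : forall x, unit_cube d x -> 0 < p x.
Hypothesis L0 : 0 <= L.
Hypothesis p_lip : forall x y, unit_cube d x -> unit_cube d y ->
  `|p x - p y| <= L * \sum_(l < d) `|tnth x l - tnth y l|.
Hypothesis dens : has_density P p.
Hypothesis ij : i != j.
Hypothesis indep : cond_indep P (@subvector R d [set i]) (@subvector R d [set j])
  (@subvector R d (~: [set i; j])).

Let C := ~: [set i; j]%SET.
Let Z := @subvector R d C.
Let mZ : measurable_fun setT Z := @measurable_subvector R d C.
Let at2 (x : d.-tuple R) s t := set_coord i s (set_coord j t x).

(* Conditional independence writes the versions of P(X_i in I, X_j in J | rest) as
   products f_I g_J. Near [x] the versions for two different [J] are comparable,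
   with the ratio of the values of [p] as constant; at a point where the four
   comparisons hold simultaneously, the f_I and g_J cancel. *)
Lemma cross_ratio_approx (x : d.-tuple R) (s s' t t' h : R) :
  unit_cube d x -> 0 <= s <= 1 -> 0 <= s' <= 1 -> 0 <= t <= 1 -> 0 <= t' <= 1 ->
  0 < h -> h <= 1 -> let kappa := L * d%:R * h in
  kappa < p (at2 x s t) -> kappa < p (at2 x s t') ->
  kappa < p (at2 x s' t) -> kappa < p (at2 x s' t') ->
  (p (at2 x s t') - kappa) * (p (at2 x s' t) - kappa) <=
  (p (at2 x s t) + kappa) * (p (at2 x s' t') + kappa).
Proof.
move=> xC s01 s'01 t01 t'01 h0 h1 kappa k00 k01 k10 k11.
have hh : 0 <= h <= 1 by rewrite (ltW h0).
have kappa0 : 0 <= kappa by rewrite !mulr_ge0// ltW.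
have at2C a b : 0 <= a <= 1 -> 0 <= b <= 1 -> unit_cube d (at2 x a b).
  by move=> a01 b01; do 2 apply: unit_cube_set_coord => //.
pose F (l : 'I_d) (a : R) : set (#|[set l]%SET|.-tuple R) :=
  [set z | forall k, near_itv h a (tnth z k)].
have mF l a : measurable (F l a).
  by apply: (@measurable_box R _ (fun=> near_itv h a)) => k; exact: near_itv_measurable.
have FE l a : subvector [set l] @^-1` F l a = [set y | near_itv h a (tnth y l)].
  have := subvector_box [set l] (fun=> near_itv h a) => ->.
  apply/seteqP; split => y /=; first by apply; rewrite inE.
  by move=> yl l'; rewrite inE => /eqP ->.
pose D0 : set (#|C|.-tuple R) :=
  [set z | forall k, near_itv h (tnth x (enum_val k)) (tnth z k)].
have mD0 : measurable D0.
  apply: (@measurable_box R _ (fun k => near_itv h (tnth x (enum_val k)))) => k.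
  exact: near_itv_measurable.
have ZD0 : Z @^-1` D0 = [set y | forall l, l \in C -> near_itv h (tnth x l) (tnth y l)].
  exact: (subvector_box C (fun l => near_itv h (tnth x l))).
pose E a b : set (d.-tuple R) :=
  subvector [set i] @^-1` F i a `&` subvector [set j] @^-1` F j b.
pose Q (a b : R) (D : set (#|C|.-tuple R)) : set (d.-tuple R) :=
  Z @^-1` D `&` [set y | [/\ unit_cube d y, near_itv h a (tnth y i) &
    near_itv h b (tnth y j)]].
have mC := @measurable_unit_cube R d.
have mIl l a : measurable [set y : d.-tuple R | near_itv h a (tnth y l)].
  rewrite -FE; apply: measurable_preimage (mF l a).
  exact: measurable_subvector.
have mQ a b D : measurable D -> measurable (Q a b D).
  move=> mD; apply: measurableI; first exact: (measurable_preimage mZ mD).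
  rewrite (_ : mkset _ = unit_cube d `&` [set y | near_itv h a (tnth y i)] `&`
    [set y | near_itv h b (tnth y j)]).
    by apply: measurableI => //; exact: measurableI.
  by apply/seteqP; split => y /= [] // [].
have mE a b : measurable (E a b) by rewrite /E !FE; exact: measurableI.
have PQ a b D : measurable D -> P (E a b `&` Z @^-1` D) = P (Q a b D).
  move=> mD; have mZD := measurable_preimage mZ mD.
  rewrite !dens//; last by apply: measurableI => //; exact: mE.
    by congr (integral _ _ _); apply/seteqP; split => y /=;
      rewrite /E !FE /Q /=; [move=> [[[yi yj] yD] yC]|move=> [[yD [yC yi yj]] _]].
  exact: mQ.
(* In a box of side [h] around the point, each of the [d] coordinates moves by at most [h], so [p]
   moves by at most [L * d * h = kappa]. *)
have near_p a b D y : 0 <= a <= 1 -> 0 <= b <= 1 -> D `<=` D0 -> Q a b D y ->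
    p (at2 x a b) - kappa <= p y <= p (at2 x a b) + kappa.
  move=> a01 b01 DD0 [Dy [yC yi yj]].
  have := p_lip yC (at2C _ _ a01 b01).
  have sumle : \sum_(l < d) `|tnth y l - tnth (at2 x a b) l| <= d%:R * h.
    rewrite mulr_natl -[d in _ *+ d](card_ord d) -sumr_const ler_sum// => l _.
    rewrite !tnth_mktuple; case: eqP => [->|/eqP li]; first exact: near_itv_dist.
    case: eqP => [->|/eqP lj]; first exact: near_itv_dist.
    apply: near_itv_dist => //.
    have : (Z @^-1` D0) y by exact: DD0.
    by rewrite ZD0 => /(_ l); apply; rewrite !inE negb_or li.
  have : L * \sum_(l < d) `|tnth y l - tnth (at2 x a b) l| <= kappa.
    by rewrite /kappa -mulrA ler_wpM2l.
  move=> h3 h4; have := le_trans h4 h3.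
  by rewrite ler_norml => /andP[h5 h6]; apply/andP; split; lra.
pose nu (D : set (#|C|.-tuple R)) : R :=
  fine (lebesgue_tuple R d (Z @^-1` D `&` unit_cube d)).
have nuE D : measurable D ->
    lebesgue_tuple R d (Z @^-1` D `&` unit_cube d) = (nu D)%:E.
  move=> mD; rewrite fineK// ge0_fin_numE//.
  apply: (@le_lt_trans _ _ (lebesgue_tuple R d (unit_cube d))).
    apply: le_measure; rewrite ?inE//.
    by apply: measurableI => //; exact: (measurable_preimage mZ mD).
  by rewrite lebesgue_unit_cube ltry.
have nu0 D : 0 <= nu D by rewrite fine_ge0.
have itvsub a : 0 <= a <= 1 -> near_itv h a `<=` `[0, 1]%classic.
  by move=> a01 y /(near_itv01 hh a01); rewrite /= in_itv.
have lamQ a b D : 0 <= a <= 1 -> 0 <= b <= 1 -> measurable D ->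
    lebesgue_tuple R d (Q a b D) = (h * h * nu D)%:E.
  move=> a01 b01 mD; have mI := @near_itv_measurable R.
  rewrite /Q /Z (lebesgue_cylinder ij (mI h a) (mI h b) (itvsub a a01) (itvsub b b01) mD).
  by rewrite !lebesgue_near_itv ?ltW// -/Z nuE.
have PEbounds : forall a b D, 0 <= a <= 1 -> 0 <= b <= 1 -> kappa < p (at2 x a b) ->
    measurable D -> D `<=` D0 -> exists r : R, [/\ P (E a b `&` Z @^-1` D) = r%:E,
      (p (at2 x a b) - kappa) * (h * h * nu D) <= r &
      r <= (p (at2 x a b) + kappa) * (h * h * nu D)].
  move=> a b D a01 b01 kab mD DD0; exists (fine (P (Q a b D))).
  have PQfin : P (Q a b D) \is a fin_num by rewrite fin_num_measure//; exact: mQ.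
  have QC : Q a b D `<=` unit_cube d by move=> y [_ []].
  have pk : 0 <= p (at2 x a b) - kappa by rewrite subr_ge0 ltW.
  have [] := density_bounds mp dens (mQ a b D mD) QC pk
    (fun y Qy => @near_p a b D y a01 b01 DD0 Qy).
  by rewrite lamQ// PQ// -[P (Q a b D)]fineK// -!EFinM !lee_fin => lo hi; split.
(* Both probabilities are, up to [kappa], a value of [p] times the same volume [h * h * nu D], which
   cancels in the ratio. *)
have ae_h : forall (a b b' : R) (f g f' g' : #|C|.-tuple R -> R),
    0 <= a <= 1 -> 0 <= b <= 1 -> 0 <= b' <= 1 ->
    kappa < p (at2 x a b) -> kappa < p (at2 x a b') ->
    cond_prob P Z (E a b) (fun z => f z * g z) ->
    cond_prob P Z (E a b') (fun z => f' z * g' z) ->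
    ae_on P Z D0 (fun z => f z * g z <=
      ((p (at2 x a b) + kappa) / (p (at2 x a b') - kappa)) * (f' z * g' z)).
  move=> a b b' f g f' g' a01 b01 b'01 kab kab' c1 c2.
  apply: cond_prob_ae_le c1 c2 mD0 _ => // D mD DD0.
  have [r [-> _ r1]] := PEbounds a b D a01 b01 kab mD DD0.
  have [r' [-> r1' _]] := PEbounds a b' D a01 b'01 kab' mD DD0.
  have pos : 0 < p (at2 x a b') - kappa by rewrite subr_gt0.
  rewrite -EFinM lee_fin (le_trans r1)// [leRHS]mulrAC ler_pdivlMr// -[leLHS]mulrA ler_wpM2l//.
    by rewrite addr_ge0// ltW// p_gt0//; exact: at2C.
  by rewrite [leLHS]mulrC.
have hh0 : 0 < h * h by rewrite mulr_gt0.
pose Mp := p x + L * d%:R.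
have pMp y : unit_cube d y -> p y <= Mp.
  move=> yC; have := p_lip yC xC.
  have : L * \sum_(l < d) `|tnth y l - tnth x l| <= L * d%:R.
    rewrite ler_wpM2l// -[d in d%:R](card_ord d) -sumr_const ler_sum// => l _.
    have /andP[y0 y1] := yC l; have /andP[x0 x1] := xC l.
    by rewrite ler_norml; apply/andP; split; lra.
  move=> h3 h4; have := le_trans h4 h3; rewrite ler_norml /Mp => /andP[_]; lra.
(* Comparison with the sure event, whose conditional probability is 1, bounds the product of
   versions away from 0, so that it may be cancelled. *)
have ae_pos : forall (a b : R) (f g : #|C|.-tuple R -> R),
    0 <= a <= 1 -> 0 <= b <= 1 -> kappa < p (at2 x a b) ->
    cond_prob P Z (E a b) (fun z => f z * g z) ->
    ae_on P Z D0 (fun z => 1 <= Mp / ((p (at2 x a b) - kappa) * (h * h)) * (f z * g z)).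
  move=> a b f g a01 b01 kab c1.
  apply: (cond_prob_ae_le mZ (cond_probT P mZ) c1 mD0) => // D mD DD0.
  have [r [-> r1 _]] := PEbounds a b D a01 b01 kab mD DD0.
  have mZD := measurable_preimage mZ mD.
  have pos : 0 < (p (at2 x a b) - kappa) * (h * h) by rewrite mulr_gt0 ?subr_gt0.
  rewrite setTI dens//.
  have mZDC : measurable (Z @^-1` D `&` unit_cube d) by exact: measurableI.
  have ZC : Z @^-1` D `&` unit_cube d `<=` unit_cube d by move=> y [].
  have pb y : (Z @^-1` D `&` unit_cube d) y -> 0 <= p y <= Mp.
    by move=> [_ yC]; rewrite pMp// ltW// p_gt0.
  have [_] := density_bounds mp dens mZDC ZC (lexx 0) pb.
  rewrite dens// -setIA setIid nuE// => /le_trans; apply.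
  rewrite -!EFinM lee_fin [leRHS]mulrAC ler_pdivlMr// -[leLHS]mulrA ler_wpM2l//.
    by apply: le_trans (pMp _ xC); rewrite ltW// p_gt0.
  by rewrite [leLHS]mulrC -[leLHS]mulrA.
have nuD0 : 0 < nu D0.
  pose B (l : 'I_d) : set R := if l \in C then near_itv h (tnth x l) else `[0, 1]%classic.
  have -> : nu D0 = fine (lebesgue_tuple R d [set y | forall l, B l (tnth y l)]).
    congr (fine (lebesgue_tuple R d _)); rewrite ZD0; apply/seteqP; split => y /=.
      move=> [yD yC] l; rewrite /B; case: ifP => [/yD//|_].
      by have := yC l; rewrite /= in_itv.
    move=> yB; split => [l lC|l]; have := yB l; rewrite /B; first by rewrite lC.
    by case: ifP => [_ /(near_itv01 hh (xC l))|_]; rewrite /= ?in_itv.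
  have mB l : measurable (B l) by rewrite /B; case: ifP => _ //; exact: near_itv_measurable.
  rewrite (lebesgue_tuple_box mB).
  rewrite (eq_bigr (fun l : 'I_d => (if l \in C then h else 1)%:E)).
    by rewrite prodEFin/=; apply: prodr_gt0 => l _; case: ifP.
  move=> l _; rewrite /B; case: ifP => _; first by rewrite lebesgue_near_itv// ltW.
  by rewrite lebesgue1_itv// subr0.
have PD0 : (0 < P (Z @^-1` D0))%E.
  have [r [PE lo _]] := PEbounds s t D0 s01 t01 k00 mD0 (@subset_refl _ _).
  apply: (@lt_le_trans _ _ (P (E s t `&` Z @^-1` D0))).
    rewrite PE lte_fin (lt_le_trans _ lo)// mulr_gt0 ?subr_gt0//.
    by rewrite mulr_gt0.
  apply: le_measure; rewrite ?inE//.
    by apply: measurableI => //; exact: measurable_preimage.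
  exact: measurable_preimage.
have [f1 [g1 [cf1 cg1 c1]]] := indep (mF i s) (mF j t).
have [f2 [g2 [cf2 cg2 c2]]] := indep (mF i s) (mF j t').
have [f3 [g3 [cf3 cg3 c3]]] := indep (mF i s') (mF j t).
have [f4 [g4 [cf4 cg4 c4]]] := indep (mF i s') (mF j t').
have H1 := ae_h _ _ _ _ _ _ _ s01 t01 t'01 k00 k01 c1 c2.
have H2 := ae_h _ _ _ _ _ _ _ s'01 t'01 t01 k11 k10 c4 c3.
have H3 := ae_pos _ _ _ _ s01 t01 k00 c1.
have H4 := ae_pos _ _ _ _ s'01 t'01 k11 c4.
(* Each use of conditional independence returned its own versions; those of the same event are now
   identified almost everywhere. *)
have Ef12 := cond_prob_ae_eq mZ cf1 cf2 mD0.
have Ef34 := cond_prob_ae_eq mZ cf3 cf4 mD0.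
have Eg13 := cond_prob_ae_eq mZ cg1 cg3 mD0.
have Eg24 := cond_prob_ae_eq mZ cg2 cg4 mD0.
have [z] := ae_on_exists mZ mD0 PD0 (ae_on_and mZ
  (ae_on_and mZ (ae_on_and mZ H1 H2) (ae_on_and mZ H3 H4))
  (ae_on_and mZ (ae_on_and mZ Ef12 Ef34) (ae_on_and mZ Eg13 Eg24))).
move=> [[[{}H1 {}H2] [{}H3 {}H4]] [[{}Ef12 {}Ef34] [{}Eg13 {}Eg24]]].
move: H1 H2 H3 H4; rewrite -Ef12 -Eg24 -Eg13 Ef34.
have Mpk a b : 0 <= a <= 1 -> 0 <= b <= 1 -> kappa < p (at2 x a b) ->
    forall u : R, 1 <= Mp / ((p (at2 x a b) - kappa) * (h * h)) * u -> 0 < u.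
  move=> a01 b01 kab u hu.
  have Mp0 : 0 < Mp by rewrite (lt_le_trans _ (pMp _ xC))// p_gt0.
  have : 0 < Mp / ((p (at2 x a b) - kappa) * (h * h)) * u by rewrite (lt_le_trans ltr01).
  by rewrite pmulr_rgt0// divr_gt0// mulr_gt0 ?subr_gt0.
move=> H1 H2 /(Mpk _ _ s01 t01 k00) u1 /(Mpk _ _ s'01 t'01 k11) u4.
have pos01 : 0 < p (at2 x s t') - kappa by rewrite subr_gt0.
have pos10 : 0 < p (at2 x s' t) - kappa by rewrite subr_gt0.
have pos00 : 0 <= p (at2 x s t) + kappa by rewrite addr_ge0// ltW// p_gt0//; exact: at2C.
have pos11 : 0 <= p (at2 x s' t') + kappa by rewrite addr_ge0// ltW// p_gt0//; exact: at2C.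
move: H1 H2; rewrite [leRHS]mulrAC ler_pdivlMr// => H1.
rewrite [leRHS]mulrAC ler_pdivlMr// => H2.
(* The two right sides carry [f1 * g2] and [f4 * g1], the left sides [f1 * g1] and [f4 * g2]: after
   multiplication the same positive factor stands on both sides. *)
have U : 0 < (f1 z * g1 z) * (f4 z * g2 z) by rewrite mulr_gt0.
rewrite -(ler_pM2l U).
have := ler_pM (mulr_ge0 (ltW u1) (ltW pos01)) (mulr_ge0 (ltW u4) (ltW pos10)) H1 H2.
by congr (_ <= _); ring.
Qed.

(** Limit [h -> 0] of the approximate inequality. If it failed with gap [eps], the squares of
    [kappa] would cancel and leave [eps <= kappa * S], with [S] the sum of the four values; [h] is
    chosen so that [kappa * S <= eps / 2] and [kappa] is below each value. *)
Lemma cross_ratio_le (x : d.-tuple R) (s s' t t' : R) :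
  unit_cube d x -> 0 <= s <= 1 -> 0 <= s' <= 1 -> 0 <= t <= 1 -> 0 <= t' <= 1 ->
  p (at2 x s t') * p (at2 x s' t) <= p (at2 x s t) * p (at2 x s' t').
Proof.
move=> xC s01 s'01 t01 t'01.
have at2C a b : 0 <= a <= 1 -> 0 <= b <= 1 -> unit_cube d (at2 x a b).
  by move=> a01 b01; do 2 apply: unit_cube_set_coord => //.
have := p_gt0 (at2C _ _ s01 t01); have := p_gt0 (at2C _ _ s01 t'01).
have := p_gt0 (at2C _ _ s'01 t01); have := p_gt0 (at2C _ _ s'01 t'01).
have approx h := @cross_ratio_approx x s s' t t' h xC s01 s'01 t01 t'01.
move: approx; set p00 := p (at2 x s t); set p01 := p (at2 x s t').
set p10 := p (at2 x s' t); set p11 := p (at2 x s' t') => approx q11 q10 q01 q00.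
rewrite leNgt; apply/negP => lt.
pose eps := p01 * p10 - p00 * p11.
have eps0 : 0 < eps by rewrite subr_gt0.
pose S := p00 + p01 + p10 + p11.
have S0 : 0 < S by rewrite !addr_gt0.
pose m := Num.min (eps / (2 * S)) (Num.min (Num.min p00 p01) (Num.min p10 p11) / 2).
have m0 : 0 < m.
  have mm0 : 0 < Num.min (Num.min p00 p01) (Num.min p10 p11).
    by rewrite !lt_min q00 q01 q10 q11.
  by rewrite lt_min !divr_gt0// mulr_gt0.
pose h := Num.min 1 (m / (L * d%:R + 1)).
have Ld0 : 0 <= L * d%:R by rewrite mulr_ge0.
have h0 : 0 < h by rewrite lt_min ltr01 divr_gt0// ltr_wpDl.
have h1 : h <= 1 by rewrite ge_min lexx.
have km : L * d%:R * h <= m.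
  have : h <= m / (L * d%:R + 1) by rewrite ge_min lexx orbT.
  rewrite ler_pdivlMr ?ltr_wpDl// => /(le_trans _); apply.
  by rewrite mulrC ler_pM2l// lerDl.
have kappa0 : 0 <= L * d%:R * h by rewrite mulr_ge0// ltW.
have mS : m * S <= eps / 2.
  have : m <= eps / (2 * S) by rewrite ge_min lexx.
  by rewrite !ler_pdivlMr ?mulr_gt0//; lra.
have mp4 : [/\ m < p00, m < p01, m < p10 & m < p11].
  have : m <= Num.min (Num.min p00 p01) (Num.min p10 p11) / 2 by rewrite ge_min lexx orbT.
  rewrite ler_pdivlMr// !le_min => /andP[/andP[a1 a2] /andP[a3 a4]].
  by split; lra.
case: mp4 => a1 a2 a3 a4.
have := approx h h0 h1; move: kappa0 km; set kappa := L * d%:R * h => kappa0 km.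
have l1 : kappa < p00 by exact: le_lt_trans a1.
have l2 : kappa < p01 by exact: le_lt_trans a2.
have l3 : kappa < p10 by exact: le_lt_trans a3.
have l4 : kappa < p11 by exact: le_lt_trans a4.
move=> /(_ l1 l2 l3 l4).
have kS : kappa * S <= m * S by rewrite ler_pM2r.
rewrite /eps /S in eps0 mS kS *; lra.
Qed.

(** Exchanging [t] and [t'] turns the inequality into its converse. *)
Lemma cross_ratio (x : d.-tuple R) (s s' t t' : R) :
  unit_cube d x -> 0 <= s <= 1 -> 0 <= s' <= 1 -> 0 <= t <= 1 -> 0 <= t' <= 1 ->
  p (set_coord i s (set_coord j t x)) * p (set_coord i s' (set_coord j t' x)) =
  p (set_coord i s (set_coord j t' x)) * p (set_coord i s' (set_coord j t x)).
Proof.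
move=> xC s01 s'01 t01 t'01; apply/eqP; rewrite eq_le.
by rewrite !cross_ratio_le.
Qed.

End cross_ratio.

(** * From absent interactions to a product over maximal cliques *)

Section regular_functions.
Context (R : realType) (d : nat).
Implicit Types (f g : d.-tuple R -> R) (x y : d.-tuple R) (K S : {set 'I_d}).

Definition l1_dist x y : R := \sum_(l < d) `|tnth x l - tnth y l|.

Lemma l1_dist_ge0 x y : 0 <= l1_dist x y.
Proof. exact: sumr_ge0. Qed.

Lemma euclidean_dist_le_l1 x y : euclidean_dist x y <= l1_dist x y.
Proof.
have h : 0 <= l1_dist x y /\
    \sum_(l < d) (tnth x l - tnth y l) ^+ 2 <= l1_dist x y ^+ 2.
  rewrite /l1_dist; elim/big_ind2 : _ => [|a a' b b' [a0 aa'] [b0 bb']|l _].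
  - by rewrite expr0n.
  - by rewrite addr_ge0// sqrrD; split => //; rewrite -addrA; nra.
  - by rewrite real_normK ?num_real.
rewrite /euclidean_dist -[leRHS]ger0_norm ?l1_dist_ge0// -sqrtr_sqr ler_wsqrtr//.
by case: h.
Qed.

Definition depends_on K f : Prop :=
  forall x y, (forall l, l \in K -> tnth x l = tnth y l) -> f x = f y.

(** The class in which the factorization takes place: the lower bound [c] makes it stable under
    inverses, the upper bound [M] makes the Lipschitz property stable under products. *)
Definition regular f : Prop := exists c M L : R, [/\ 0 < c, 0 <= L,
  forall x, unit_cube d x -> c <= f x <= M &
  forall x y, unit_cube d x -> unit_cube d y -> `|f x - f y| <= L * l1_dist x y].

Lemma regular_cst (a : R) : 0 < a -> regular (fun=> a).
Proof.
move=> a0; exists a, a, 0; split => // [x _|x y _ _]; first by rewrite lexx.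
by rewrite subrr normr0 mul0r.
Qed.

Lemma regularM f g : regular f -> regular g -> regular (fun x => f x * g x).
Proof.
move=> [c [M [L [c0 L0 fc fL]]]] [c' [M' [L' [c'0 L'0 gc gL]]]].
have fM x : unit_cube d x -> `|f x| <= `|M|.
  move=> xC; have /andP[f1 f2] := fc x xC.
  by rewrite ger0_norm ?(le_trans f2) ?ler_norm// (le_trans _ f1)// ltW.
have gM x : unit_cube d x -> `|g x| <= `|M'|.
  move=> xC; have /andP[f1 f2] := gc x xC.
  by rewrite ger0_norm ?(le_trans f2) ?ler_norm// (le_trans _ f1)// ltW.
exists (c * c'), (`|M| * `|M'|), (`|M| * L' + L * `|M'|); split.
- exact: mulr_gt0.
- by rewrite addr_ge0// mulr_ge0.
- move=> x xC; have /andP[f1 f2] := fc x xC; have /andP[g1 g2] := gc x xC.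
  apply/andP; split; first by rewrite ler_pM// ltW.
  by rewrite (le_trans (ler_norm _))// normrM ler_pM// ?fM ?gM.
- move=> x y xC yC.
  have -> : f x * g x - f y * g y = f x * (g x - g y) + (f x - f y) * g y by ring.
  apply: le_trans (ler_normD _ _) _; rewrite !normrM mulrDl lerD//.
    by rewrite -mulrA ler_pM// ?fM ?gL.
  by rewrite mulrAC ler_pM// ?gM ?fL.
Qed.

Lemma regularV f : regular f -> regular (fun x => (f x)^-1).
Proof.
move=> [c [M [L [c0 L0 fc fL]]]].
have f0 x : unit_cube d x -> 0 < f x.
  by move=> /fc/andP[f1 _]; exact: lt_le_trans f1.
have M0 : 0 < `|M| + 1 by rewrite ltr_wpDl.
exists (`|M| + 1)^-1, c^-1, (L / c ^+ 2); split.
- by rewrite invr_gt0.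
- by rewrite divr_ge0// exprn_ge0// ltW.
- move=> x xC; have /andP[f1 f2] := fc x xC; have fx0 := f0 x xC.
  rewrite !lef_pV2 ?posrE// f1 andbT (le_trans f2)// (le_trans (ler_norm _))//.
  by rewrite lerDl.
- move=> x y xC yC; have fx0 := f0 x xC; have fy0 := f0 y yC.
  have /andP[fx1 _] := fc x xC; have /andP[fy1 _] := fc y yC.
  have -> : (f x)^-1 - (f y)^-1 = (f y - f x) / (f x * f y).
    by field; rewrite !gt_eqF.
  rewrite normrM distrC mulrAC ler_pM ?fL//.
  rewrite normfV lef_pV2 ?posrE ?exprn_gt0// ?normr_gt0 ?mulf_neq0 ?gt_eqF//.
  rewrite ger0_norm; first by rewrite expr2 ler_pM// ltW.
  by rewrite mulr_ge0// ltW.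
Qed.

Definition zero_coord (i : 'I_d) x : d.-tuple R := set_coord i 0 x.

Lemma unit_cube_zero_coord i x : unit_cube d x -> unit_cube d (zero_coord i x).
Proof. by apply: unit_cube_set_coord; rewrite lexx ler01. Qed.

Lemma zero_coordK i x : zero_coord i (zero_coord i x) = zero_coord i x.
Proof. by apply: eq_from_tnth => l; rewrite !tnth_mktuple; case: eqP. Qed.

Lemma zero_coordC i j x : zero_coord i (zero_coord j x) = zero_coord j (zero_coord i x).
Proof. by apply: eq_from_tnth => l; rewrite !tnth_mktuple; case: eqP; case: eqP. Qed.

Lemma regular_zero_coord f i : regular f -> regular (f \o zero_coord i).
Proof.
move=> [c [M [L [c0 L0 fc fL]]]]; exists c, M, L; split => //.
- by move=> x xC; apply/fc/unit_cube_zero_coord.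
- move=> x y xC yC /=.
  apply: le_trans (fL _ _ (unit_cube_zero_coord i xC) (unit_cube_zero_coord i yC)) _.
  rewrite ler_wpM2l// ler_sum// => l _; rewrite !tnth_mktuple.
  by case: eqP => // _; rewrite subrr normr0.
Qed.

Lemma depends_on_zero_coord f S i :
  depends_on S f -> depends_on (S :\ i) (f \o zero_coord i).
Proof.
move=> fS x y xy; apply: fS => l lS; rewrite !tnth_mktuple.
by case: eqP => // /eqP li; apply: xy; rewrite !inE li.
Qed.

Lemma depends_onS f S S' : S \subset S' -> depends_on S f -> depends_on S' f.
Proof. by move=> SS' fS x y xy; apply: fS => l /(fintype.subsetP SS')/xy. Qed.

Variable e : rel 'I_d.

(** For positive [f], this says that the mixed second difference of [ln f] in the coordinates [i]
    and [j], anchored at 0, vanishes. *)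
Definition no_interaction f : Prop := forall i j x, i != j -> ~~ e i j ->
  unit_cube d x ->
  f x * f (zero_coord i (zero_coord j x)) = f (zero_coord i x) * f (zero_coord j x).

Lemma no_interaction_zero_coord f k :
  no_interaction f -> no_interaction (f \o zero_coord k).
Proof.
move=> nf i j x ij eij xC /=.
have [->|ki] := eqVneq k i.
  by rewrite !zero_coordK.
have [->|kj] := eqVneq k j.
  by rewrite (zero_coordC i j) !zero_coordK mulrC.
by rewrite !(zero_coordC k) nf// ; exact: unit_cube_zero_coord.
Qed.

(* If [i] and [j] in [S] are not adjacent, f(x) = f(x with x_i = 0)
   f(x with x_j = 0) / f(x with x_i = x_j = 0), and every factor depends on fewer
   coordinates than [f]. *)
Lemma clique_factorization f S :
  regular f -> no_interaction f -> depends_on S f ->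
  exists psi : {set 'I_d} -> d.-tuple R -> R,
    (forall K, regular (psi K) /\ depends_on K (psi K)) /\
    forall x, unit_cube d x -> f x = \prod_(K in max_cliques e) psi K x.
Proof.
have [n] := ubnP #|S|; elim: n f S => // n ih f S /ltnSE Sn rf nf fS.
have [cS|ncS] := boolP (is_clique e S).
  (* A clique lies in some maximal clique, which receives all of [f]; the other factors are 1. *)
  have [K0 maxK0 SK0] := maxset_exists cS.
  exists (fun K => if K == K0 then f else fun=> 1); split => [K|x xC].
    have [->|_] := eqVneq K K0; first by split => //; exact: depends_onS fS.
    by split => //; exact: regular_cst.
  rewrite (bigD1 K0) ?inE//= eqxx big1 ?mulr1// => K /andP[_ KK0].
  by rewrite (negbTE KK0).
have [i [j [iS jS ij eij]]] : exists i j, [/\ i \in S, j \in S, i != j & ~~ e i j].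
  move: ncS; rewrite negb_forall => /existsP[i].
  rewrite negb_imply negb_forall => /andP[iS /existsP[j]].
  rewrite !negb_imply => /andP[jS /andP[ij eij]].
  by exists i, j.
have cardS k : k \in S -> (#|S :\ k| < n)%N.
  by move=> kS; rewrite (leq_trans _ Sn)// [X in (_ < X)%N](cardsD1 k) kS.
have [psi1 [h1 E1]] := ih _ _ (cardS i iS) (regular_zero_coord i rf)
  (@no_interaction_zero_coord _ i nf) (@depends_on_zero_coord _ _ i fS).
have [psi2 [h2 E2]] := ih _ _ (cardS j jS) (regular_zero_coord j rf)
  (@no_interaction_zero_coord _ j nf) (@depends_on_zero_coord _ _ j fS).
have [psi3 [h3 E3]] : exists psi : {set 'I_d} -> d.-tuple R -> R,
    (forall K, regular (psi K) /\ depends_on K (psi K)) /\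
    forall x, unit_cube d x -> f (zero_coord i (zero_coord j x)) =
      \prod_(K in max_cliques e) psi K x.
  (* This function does not depend on coordinate [i] either, but [S :\ j] is already smaller than
     [S], which is all the induction asks for. *)
  apply: (ih (f \o zero_coord i \o zero_coord j) (S :\ j)).
  - exact: cardS.
  - exact/regular_zero_coord/regular_zero_coord.
  - exact/no_interaction_zero_coord/no_interaction_zero_coord.
  - apply: depends_on_zero_coord; apply: depends_onS (subD1set S i) _.
    exact: depends_on_zero_coord.
exists (fun K x => psi1 K x * psi2 K x * (psi3 K x)^-1); split => [K|x xC].
  have [r1 d1] := h1 K; have [r2 d2] := h2 K; have [r3 d3] := h3 K; split.
    by apply: regularM; [exact: regularM|exact: regularV].
  by move=> x y xy; rewrite (d1 x y)// (d2 x y)// (d3 x y).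
rewrite !big_split/= -E1// -E2//= prodfV -E3// -(nf i j x)// mulfK//.
case: rf => c [M [L [c0 _ fc _]]].
have /fc/andP[h _] : unit_cube d (zero_coord i (zero_coord j x)).
  by do 2 apply: unit_cube_zero_coord.
by rewrite gt_eqF// (lt_le_trans c0).
Qed.

End regular_functions.

Section positive_lipschitz.
Context (R : realType) (d : nat).

Let clamp (t : R) := Num.max 0 (Num.min 1 t).

Let clamp01 t : 0 <= clamp t <= 1.
Proof. by rewrite /clamp le_max lexx/= ge_max ler01/= ge_min lexx. Qed.

Let clamp_id t : 0 <= t <= 1 -> clamp t = t.
Proof. by move=> /andP[t0 t1]; rewrite /clamp min_r// max_r. Qed.

Let clamp_lip s t : `|clamp s - clamp t| <= `|s - t|.
Proof.
have clampP u : [\/ u <= 0 /\ clamp u = 0, (0 <= u) /\ (u <= 1 /\ clamp u = u) |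
    1 <= u /\ clamp u = 1].
  have [u0|u0] := leP u 0.
    by constructor 1; rewrite /clamp min_r ?max_l// (le_trans u0).
  have [u1|u1] := leP u 1; first by constructor 2; rewrite clamp_id (ltW u0).
  by constructor 3; rewrite ltW// /clamp min_l ?max_r// ltW.
rewrite ler_norml.
case: (clampP s) => [[hs ->]|[hs [hs' ->]]|[hs ->]];
  case: (clampP t) => [[ht ->]|[ht [ht' ->]]|[ht ->]];
  case: (ger0P (s - t)) => hst; apply/andP; split; lra.
Qed.

(** Compactness of the cube. Precomposition with the coordinatewise clamp to [0, 1] extends [p] to a
    continuous function on the space of row vectors, which attains its minimum on the cube. *)
Lemma positive_lower_bound (p : d.-tuple R -> R) (L : R) :
  0 <= L -> (forall x, unit_cube d x -> 0 < p x) ->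
  (forall x y, unit_cube d x -> unit_cube d y -> `|p x - p y| <= L * l1_dist x y) ->
  exists2 c, 0 < c & forall x, unit_cube d x -> c <= p x.
Proof.
move=> L0 p0 pL.
pose t_of (v : 'rV[R]_d) : d.-tuple R := [tuple clamp (v ord0 l) | l < d].
have tC v : unit_cube d (t_of v) by move=> l; rewrite tnth_mktuple; exact: clamp01.
have cf : continuous (p \o t_of).
  move=> v; apply/(cvgrPdist_le (FF := nbhs_filter v)) => eps eps0; apply/nbhs_ballP.
  exists (eps / (L * d%:R + 1)) => /=.
    by rewrite divr_gt0// ltr_wpDl// mulr_ge0.
  move=> w [_ vw] /=; apply: le_trans (pL _ _ (tC v) (tC w)) _.
  have h : l1_dist (t_of v) (t_of w) <= d%:R * (eps / (L * d%:R + 1)).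
    rewrite mulr_natl -[d in _ *+ d](card_ord d) -sumr_const ler_sum// => l _.
    rewrite !tnth_mktuple (le_trans (clamp_lip _ _))// ltW//.
    exact: (vw ord0 l).
  apply: (le_trans (ler_wpM2l L0 h)).
  rewrite !mulrA ler_pdivrMr; last by rewrite ltr_wpDl// mulr_ge0.
  by rewrite mulrDr mulr1 mulrC lerDl ltW.
pose A : set 'rV[R]_d := [set v | forall l, `[0, 1]%classic (v ord0 l)].
have A0 : A !=set0.
  by exists 0 => l; rewrite /= in_itv/= mxE lexx ler01.
have cA : compact A.
  have := @rV_compact R d (fun=> `[0, 1]%classic) (fun=> @segment_compact R 0 1).
  exact.
have [c cA' cmin] := EVT_min_rV A0 cA (continuous_subspaceT cf).
exists (p (t_of c)); first exact: p0.
move=> x xC; have xE : x = t_of (\row_l tnth x l).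
  by apply: eq_from_tnth => l; rewrite tnth_mktuple mxE clamp_id.
rewrite xE; apply: (cmin (\row_l tnth x l)).
by rewrite inE => l; rewrite /= in_itv/= mxE; exact: xC.
Qed.

Lemma lipschitz_regular (p : d.-tuple R -> R) :
  lipschitz_on_cube p -> positive_on_cube p -> regular p.
Proof.
move=> [L L0 pL] p0.
have pL1 x y : unit_cube d x -> unit_cube d y -> `|p x - p y| <= L * l1_dist x y.
  move=> xC yC; apply: le_trans (pL _ _ xC yC) _.
  by rewrite ler_wpM2l// euclidean_dist_le_l1.
have [c c0 cp] := positive_lower_bound L0 p0 pL1.
pose o : d.-tuple R := [tuple (0 : R) | l < d].
have oC : unit_cube d o by move=> l; rewrite tnth_mktuple lexx ler01.
exists c, (p o + L * d%:R), L; split => // x xC; rewrite cp//=.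
have h : l1_dist x o <= d%:R.
  rewrite -[leRHS]mulr1 mulr_natl -[d in _ *+ d](card_ord d) -sumr_const ler_sum// => l _.
  by rewrite tnth_mktuple subr0; have /andP[x0 x1] := xC l; rewrite ger0_norm.
have := le_trans (pL1 _ _ xC oC) (ler_wpM2l L0 h).
by rewrite ler_norml => /andP[_]; lra.
Qed.

End positive_lipschitz.

(** * Factorization of a positive Lipschitz Markov density *)

Section markov_factorization.
Context (R : realType) (d : nat) (e : rel 'I_d).

(** The Markov property is used for [{i}], [{j}] and the set of all other vertices; the cross ratio
    is then read with one pair of values equal to the coordinates of [x] and the other equal to
    0. *)
Lemma markov_no_interaction (p : d.-tuple R -> R) (P : probability (d.-tuple R) R) :
  measurable_fun (unit_cube d) p -> regular p ->
  has_density P p -> markov_property e p -> no_interaction e p.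
Proof.
move=> mp [c [M [L [c0 L0 pc pL]]]] dens mark i j x ij eij xC.
have p0 y : unit_cube d y -> 0 < p y.
  by move=> /pc/andP[h _]; exact: lt_le_trans h.
have ji : j != i by rewrite eq_sym.
have indep : cond_indep P (@subvector R d [set i]) (@subvector R d [set j])
    (@subvector R d (~: [set i; j])).
  apply: mark => //.
  - by rewrite disjoints1 inE.
  - by rewrite disjoints1 !inE eqxx.
  - by rewrite disjoints1 !inE eqxx orbT.
  (* A path may repeat [i] if [e] has loops. Its first vertex other than [i] is adjacent to [i],
     hence differs from [j] and lies in the separating set. *)
  - move=> y s; rewrite inE => /eqP ->; elim: s => [|a s ih] /=.
      by rewrite inE => _ /eqP ij'; move: ij; rewrite ij' eqxx.
    move=> /andP[ia pas] las.
    have [ai|ai] := eqVneq a i.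
      move: pas las; rewrite ai => pas las; have [z zs zC] := ih pas las.
      by exists z => //; move: zs; rewrite !inE => /orP[->//|->]; rewrite !orbT.
    have [aj|aj] := eqVneq a j; first by move: eij; rewrite -aj ia.
    by exists a; rewrite !inE ?eqxx ?orbT// negb_or ai.
have z01 : 0 <= (0 : R) <= 1 by rewrite lexx ler01.
have := cross_ratio mp p0 L0 pL dens ij indep xC (xC i) z01 (xC j) z01.
have setx k y : tnth y k = tnth x k -> set_coord k (tnth x k) y = y :> d.-tuple R.
  by move=> yk; apply: eq_from_tnth => l; rewrite tnth_mktuple; case: eqP => [->|].
rewrite (setx j x)// (setx i x)// (setx i (set_coord j 0 x)).
  by rewrite /zero_coord => ->; rewrite mulrC.
by rewrite tnth_mktuple (negbTE ij).
Qed.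

(** A right inverse of [subvector K] that pads with 0: outside [K] the index is out of range and
    [nth] returns its default. *)
Definition extend_vector (K : {set 'I_d}) (y : #|K|.-tuple R) : d.-tuple R :=
  [tuple nth 0 y (index l (enum K)) | l < d].

Lemma tnth_extend_vector (K : {set 'I_d}) (y : #|K|.-tuple R) (k : 'I_#|K|) :
  tnth (extend_vector y) (enum_val k) = tnth y k.
Proof.
rewrite tnth_mktuple (tnth_nth 0); congr nth.
by rewrite (enum_val_nth (enum_val k)) index_uniq ?enum_uniq// -cardE.
Qed.

Lemma tnth_extend_vector0 (K : {set 'I_d}) (y : #|K|.-tuple R) l :
  l \notin K -> tnth (extend_vector y) l = 0.
Proof.
move=> lK; rewrite tnth_mktuple nth_default// size_tuple cardE.
by rewrite leqNgt index_mem mem_enum.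
Qed.

Lemma enum_valE (K : {set 'I_d}) l : l \in K -> exists k : 'I_#|K|, l = enum_val k.
Proof. by move=> lK; exists (enum_rank_in lK l); rewrite enum_rankK_in. Qed.

Lemma unit_cube_extend_vector (K : {set 'I_d}) (y : #|K|.-tuple R) :
  unit_cube #|K| y -> unit_cube d (extend_vector y).
Proof.
move=> yC l; have [/enum_valE[k ->]|lK] := boolP (l \in K).
  by rewrite tnth_extend_vector.
by rewrite tnth_extend_vector0// lexx ler01.
Qed.

Lemma l1_dist_extend_vector (K : {set 'I_d}) (y y' : #|K|.-tuple R) :
  l1_dist (extend_vector y) (extend_vector y') = l1_dist y y'.
Proof.
rewrite /l1_dist (bigID (mem K))/= [X in _ + X]big1 => [|l lK]; last first.
  by rewrite !tnth_extend_vector0// subrr normr0.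
rewrite addr0 big_enum_val/=; apply: eq_bigr => k _.
by rewrite !tnth_extend_vector.
Qed.

(** A factor depending only on the coordinates in [K] becomes a function of [#|K|] variables through
    [extend_vector], which preserves the l1 distance and so the Lipschitz constant. *)
Lemma markov_factorization (p : d.-tuple R -> R) (P : probability (d.-tuple R) R) :
  measurable_fun (unit_cube d) p ->
  lipschitz_on_cube p -> positive_on_cube p -> has_density P p ->
  markov_property e p ->
  exists psi : forall K : {set 'I_d}, #|K|.-tuple R -> R,
    (forall K, regular (psi K)) /\
    forall x, unit_cube d x -> p x = \prod_(K in max_cliques e) psi K (subvector K x).
Proof.
move=> mp plip ppos dens mark.
have rp := lipschitz_regular plip ppos.
have ni := markov_no_interaction mp rp dens mark.
have dT : depends_on [set: 'I_d]%SET p.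
  by move=> x y xy; congr p; apply: eq_from_tnth => l; apply: xy; rewrite inE.
have [psi [psiK pE]] := clique_factorization rp ni dT.
exists (fun K y => psi K (extend_vector y)); split => [K|x xC].
  have [[c [M [L [c0 L0 pc pL]]]] _] := psiK K.
  exists c, M, L; split => // [y yC|y y' yC y'C].
    by apply: pc; exact: unit_cube_extend_vector.
  by rewrite -l1_dist_extend_vector pL//; exact: unit_cube_extend_vector.
rewrite pE//; apply: eq_bigr => K _; apply: (psiK K).2 => l /enum_valE[k ->].
by rewrite tnth_extend_vector tnth_mktuple.
Qed.

End markov_factorization.

(** * Approximation by networks *)

Section explicit_networks.
Context (R : realType) (l : nat) (wd : nat -> nat).
Variables (Wf : nat -> nat -> nat -> R) (vf : nat -> nat -> R).

Definition widths : l.+2.-tuple nat := [tuple of mkseq wd l.+2].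

Lemma nth_widths i : (i <= l.+1)%N -> nth 0%N widths i = wd i.
Proof. by move=> il; rewrite nth_mkseq. Qed.

Definition weight_mx i : 'M[R]_(nth 0%N widths i.+1, nth 0%N widths i) :=
  \matrix_(a, b) Wf i a b.

Definition bias_mx i : 'cV[R]_(nth 0%N widths i) := \col_a vf i a.

(** The recursion of [net_eval] with indices in [nat], so that explicit networks are computed
    without dependent matrix dimensions. *)
Fixpoint layer (x : nat -> R) (i a : nat) : R :=
  match i with
  | 0 => \sum_(0 <= b < wd 0) Wf 0 a b * x b
  | j.+1 => \sum_(0 <= b < wd j.+1) Wf j.+1 a b * relu (layer x j b - vf j.+1 b)
  end.

Lemma net_eval_layer (x : nat -> R) i a b : (i <= l)%N ->
  net_eval weight_mx bias_mx (\col_j x j) i a b = layer x i a.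
Proof.
elim: i a b => [|i ih] a b il /=; rewrite !mxE -[in RHS](nth_widths (leqW il)) big_mkord.
  by apply: eq_bigr => j _; rewrite !mxE.
apply: eq_bigr => j _; rewrite !mxE; congr (_ * relu (_ - _)).
by apply: ih; exact: ltnW.
Qed.

(** Each of [l + 1] layers has at most [Wd] rows with at most [rho] nonzero weights, and at most
    [Wd] biases; this is the count [l.+1 * Wd * rho.+1]. *)
Lemma explicit_nn_class (k s : nat) (F : R) (f : k.-tuple R -> R) (rho Wd : nat) :
  wd l.+1 = 1%N ->
  (forall i a b, (i <= l)%N -> (a < wd i.+1)%N -> (b < wd i)%N -> `|Wf i a b| <= 1) ->
  (forall i a, (0 < i <= l)%N -> (a < wd i)%N -> `|vf i a| <= 1) ->
  (forall i, (i <= l.+1)%N -> (wd i <= Wd)%N) ->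
  (forall i a, (i <= l)%N -> (a < wd i.+1)%N ->
     (#|[set b : 'I_(wd i) | Wf i a b != 0%R]%SET| <= rho)%N) ->
  (l.+1 * Wd * rho.+1 <= s)%N ->
  (forall x : k.-tuple R, f x = layer (nth 0 x) l 0) ->
  (forall x, unit_cube k x -> `|f x| <= F) ->
  nn_class widths s F f.
Proof.
move=> wl W1 v1 wdW rhoW sW fE fF; exists weight_mx, bias_mx; split => //.
- move=> i a b il; rewrite mxE; apply: W1 => //.
    by rewrite -[X in (_ < X)%N](@nth_widths i.+1)//.
  by rewrite -[X in (_ < X)%N](@nth_widths i)// leqW.
- move=> i a b /andP[i0 il]; rewrite mxE; apply: v1; first by rewrite i0.
  by rewrite -[X in (_ < X)%N](@nth_widths i)// leqW.
- apply: leq_trans sW.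
  have hW i : (i <= l)%N -> (nnz_entries (weight_mx i) <= Wd * rho)%N.
    move=> il; rewrite /nnz_entries.
    rewrite -sum1dep_card -(pair_big_dep xpredT
      (fun a b => weight_mx i a b != 0%R) (fun _ _ => 1%N))/=.
    apply: (@leq_trans (\sum_(a < nth 0%N widths i.+1) rho)).
      apply: leq_sum => a _; rewrite sum1dep_card.
      under eq_finset do rewrite mxE.
      have := ltn_ord a; rewrite [X in (_ < X)%N](@nth_widths i.+1)// => ai.
      have := rhoW i a il ai; move: (nth_widths (leqW il)); move: (wd i) => m <-.
      by [].
    by rewrite sum_nat_const card_ord leq_mul2r (@nth_widths i.+1)// wdW ?orbT.
  have hv i : (i <= l)%N -> (nnz_entries (bias_mx i) <= Wd)%N.
    move=> il; rewrite /nnz_entries (leq_trans (max_card _))// card_prod !card_ord muln1.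
    by rewrite nth_widths ?wdW// leqW.
  apply: (@leq_trans (\sum_(0 <= i < l.+1) Wd * rho + \sum_(1 <= i < l.+1) Wd)).
    rewrite leq_add// big_nat_cond [leqRHS]big_nat_cond leq_sum// => i.
      by rewrite andbT ltnS => /andP[_ il]; exact: hW.
    by rewrite andbT ltnS => /andP[_ il]; exact: hv.
  rewrite !sum_nat_const_nat subn0 subn1 /=.
  apply: (@leq_trans (l.+1 * (Wd * rho) + l.+1 * Wd)).
    by rewrite leq_add2l leq_mul.
  by rewrite -mulnDr -mulnA leq_mul2l mulnS addnC leqnn orbT.
- move=> x; apply/matrixP => a b; rewrite net_eval_layer// mxE.
  have := ltn_ord a; rewrite [X in (_ < X)%N](@nth_widths l.+1)// wl ltnS leqn0.
  by rewrite fE => /eqP ->.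
Qed.

End explicit_networks.

Lemma sum_nat_block (R : realType) (n c : nat) (G : nat -> R) :
  \sum_(0 <= b < n * c) G b = \sum_(0 <= a < n) \sum_(0 <= j < c) G (a * c + j)%N.
Proof.
elim: n => [|n ih]; first by rewrite mul0n !big_geq.
rewrite big_nat_recr//= -ih mulSn addnC (@big_cat_nat _ _ _ (n * c))//=; last first.
  exact: leq_addr.
congr (_ + _); rewrite -{1}[(n * c)%N]add0n big_addn addKn.
by apply: eq_bigr => j _; rewrite addnC.
Qed.

Lemma sum_nat_pick (R : realType) (n a0 : nat) (G : nat -> R) : (a0 < n)%N ->
  \sum_(0 <= a < n) (if a == a0 then G a else 0) = G a0.
Proof.
move=> a0n; rewrite big_mkord (bigD1 (Ordinal a0n))//= eqxx big1 ?addr0//.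
by move=> a; rewrite -val_eqE /= => /negbTE ->.
Qed.

Lemma card_block (n c a : nat) : (0 < c)%N ->
  (#|[set b : 'I_n | b %/ c == a]%SET| <= c)%N.
Proof.
move=> c0; rewrite -[X in (_ <= X)%N](card_ord c).
pose h (b : 'I_n) : 'I_c := Ordinal (ltn_pmod b c0).
rewrite -(card_in_imset (f := h)); first exact: max_card.
move=> b b'; rewrite !inE => /eqP ba /eqP b'a /(congr1 val)/= bb'.
by apply/val_inj; rewrite /= (divn_eq b c) (divn_eq b' c) ba b'a bb'.
Qed.

(** * The tournament network *)

Section max_tree.
Context (R : realType).

Lemma relu_max (a b : R) : 0 <= a -> 0 <= b -> relu (a - b) + relu b = Num.max a b.
Proof.
move=> a0 b0; rewrite /relu (max_l b0).
have [ab|ab] := leP a b; first by rewrite max_r ?subr_le0// add0r.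
by rewrite max_l ?subrK// subr_ge0 ltW.
Qed.

Lemma relu_abs (a : R) : relu a + relu (- a) = `|a|.
Proof.
rewrite /relu; have [a0|/ltW a0] := leP 0 a.
  by rewrite ger0_norm// max_r ?oppr_le0// addr0.
by rewrite ler0_norm// max_l ?add0r// oppr_ge0.
Qed.

(* Layer 0 lists [x_j] and [- x_j] for every grid point, layer 1 computes the
   distances to the grid points, and layers 2 to [Q + 1] are the rounds of a
   knockout tournament: [max a b = relu (a - b) + relu b] for [a, b >= 0], the
   two summands being carried by consecutive neurons. The last two layers
   multiply the result by [T]. *)
Variables (k q T : nat) (psi : k.-tuple R -> R).

Let Q := (q * k)%N.
Let N := (2 ^ Q)%N.

Lemma pow2_gt0 : (0 < 2 ^ q)%N. Proof. by rewrite expn_gt0. Qed.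

Let grid_index (a : nat) : {ffun 'I_k -> 'I_(2 ^ q)} :=
  nth [ffun=> Ordinal pow2_gt0] (enum {: {ffun 'I_k -> 'I_(2 ^ q)}}) a.

Definition grid_point (a : nat) : k.-tuple R :=
  [tuple (grid_index a j : nat)%:R / (2 ^ q)%:R | j < k].

Definition grid_coord (a j : nat) : R := nth 0 (grid_point a) j.

(** A cone of the McShane-type maximum, divided by [T] so that its apex is an admissible bias, and
    cut at 0, which is harmless for nonnegative [psi]. *)
Definition tent (a : nat) (x : nat -> R) : R :=
  relu (psi (grid_point a) / T%:R -
    \sum_(0 <= j < k) `|x j - grid_coord a j|).

Definition maxnet_width (i : nat) : nat :=
  if i == 0%N then k
  else if i == 1%N then (N * k * 2)%N
  else if (i <= Q.+2)%N then (2 ^ (Q.+2 - i) * 2)%N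
  else if i == Q.+3 then T else 1%N.

Lemma maxnet_width_last : maxnet_width Q.+4 = 1%N.
Proof.
rewrite /maxnet_width; have -> : (Q.+4 <= Q.+2)%N = false by lia.
by case: eqP => [e|_]; [lia|]; case: eqP => [e|_]; [lia|]; case: eqP => [e|_]; [lia|].
Qed.

Lemma maxnet_width_le i : (maxnet_width i <= N * k * 2 + N * 2 + T + k + 1)%N.
Proof.
have N0 : (0 < N)%N by rewrite expn_gt0.
rewrite /maxnet_width; case: eqP => [_|i0]; first by lia.
case: eqP => [_|i1]; first by lia.
case: ifP => hi; last by case: ifP => _; lia.
have : (2 ^ (Q.+2 - i) <= N)%N by rewrite leq_exp2l//; lia.
by lia.
Qed.

(** In a tournament layer, row [2a] computes the left contestant minus the right one and row
    [2a + 1] the right one. A contestant is a sum of two neurons, so a match reads a block of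
    four. *)
Definition maxnet_weight (i a b : nat) : R :=
  if i == 0%N then (if (b == (a %/ 2) %% k)%N then (if odd a then -1 else 1) else 0)
  else if i == 1%N then
    (if (b %/ (k * 2) == a %/ 2)%N && ~~ odd a then -1 else 0)
  else if (i <= Q.+1)%N then
    (if (b %/ 4 == a %/ 2)%N then
       (if odd a then (if (2 <= b %% 4)%N then 1 else 0)
        else (if (2 <= b %% 4)%N then -1 else 1))
     else 0)
  else 1.

(** Biases are subtracted: hence the sign of [psi / T], and the pairs [x_j - g], [g - x_j] whose
    positive parts add up to a distance. *)
Definition maxnet_bias (i a : nat) : R :=
  if i == 1%N then
    (if odd a then - grid_coord (a %/ 2 %/ k) (a %/ 2 %% k)
     else grid_coord (a %/ 2 %/ k) (a %/ 2 %% k))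
  else if i == 2%N then (if odd a then 0 else - (psi (grid_point (a %/ 2)%N) / T%:R))
  else 0.

Let lay := layer maxnet_width maxnet_weight maxnet_bias.

Let pos (x : nat -> R) m b := relu (lay x m.+1 b - maxnet_bias m.+2 b).
Let champion (x : nat -> R) m a := pos x m (a * 2)%N + pos x m (a * 2).+1.

Lemma sum_nat2 (G : nat -> R) : \sum_(0 <= j < 2) G j = G 0%N + G 1%N.
Proof. by rewrite !big_nat_recr//= big_geq// add0r. Qed.

(** Before the matches the odd neuron of a pair is 0; in the even one, the [2 * k] neurons of block
    [a] add up to minus the distance to the grid point, and the bias adds [psi / T]. *)
Lemma champion0 x a : (a < N)%N -> champion x 0 a = tent a x.
Proof.
move=> aN; rewrite /champion /pos /tent.
have -> : lay x 1 (a * 2).+1 = 0.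
  rewrite /lay [LHS]/=; apply: big1 => b _.
  by rewrite /maxnet_weight/= oddM andbF andbF mul0r.
rewrite /maxnet_bias/= !oddM !andbF/= subr0 [relu 0]/relu maxxx addr0.
rewrite mulnK//; congr relu; rewrite opprK addrC; congr (_ + _).
pose G b := maxnet_weight 1 (a * 2) b *
  relu (\sum_(0 <= j < k) maxnet_weight 0 b j * x j - maxnet_bias 1 b).
transitivity (\sum_(0 <= b < N * k * 2) G b); first by [].
rewrite sum_nat_block.
rewrite (eq_bigr (fun e => G (e * 2)%N + G (e * 2).+1)); last first.
  by move=> e _; rewrite sum_nat2 addn0 addn1.
rewrite sum_nat_block.
have E (a' j : nat) : (j < k)%N ->
   G ((a' * k + j) * 2)%N + G ((a' * k + j) * 2).+1 =
   if a' == a then - `|x j - grid_coord a j| else 0.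
  move=> jk; have k0 : (0 < k)%N by exact: leq_ltn_trans jk.
  have h2 : ((((a' * k + j) * 2).+1) %/ 2 = a' * k + j)%N.
    by rewrite -addn1 divnMDl// addn0.
  have hk : ((a' * k + j) %/ k = a')%N by rewrite divnMDl// divn_small// addn0.
  have hm : ((a' * k + j) %% k = j)%N by rewrite modnMDl modn_small.
  rewrite /G /maxnet_weight /maxnet_bias/= !(mulnC k 2) !divnMA !h2 !mulnK// !hk !hm.
  rewrite !oddM !andbF/= !andbT.
  have pickM c : \sum_(0 <= b < k) (if (b == j)%N then c else 0) * x b = c * x j.
    rewrite -(sum_nat_pick (fun b => c * x b) jk); apply: eq_bigr => b _.
    by case: eqP => // _; rewrite mul0r.
  rewrite !pickM; case: eqP => [->|_]; last by rewrite !mul0r addr0.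
  rewrite mul1r !mulN1r -opprD opprK (addrC (- x j)) -(opprB (x j)); congr (- _).
  by rewrite relu_abs.
rewrite (eq_big_nat _ _ (F2 := fun a' => if a' == a then
    - \sum_(0 <= j < k) `|x j - grid_coord a j| else 0)); last first.
  move=> a' _; case: eqP => [->|/eqP aa'].
    rewrite -sumrN; apply: eq_big_nat => j /andP[_ jk].
    by rewrite E// eqxx.
  by rewrite big_nat_cond big1// => j /andP[/andP[_ jk] _]; rewrite E// (negbTE aa').
by rewrite (sum_nat_pick (fun=> _) aN).
Qed.

Lemma champion_max x m a : (m < Q)%N -> (a < 2 ^ (Q - m.+1))%N ->
  champion x m.+1 a = Num.max (champion x m (a * 2)%N) (champion x m (a * 2).+1).
Proof.
move=> mQ aQ.
have pos0 b : 0 <= pos x m b by rewrite /pos /relu le_max lexx orbT.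
rewrite -relu_max ?addr_ge0//.
have layE b : (b %/ 2 < 2 ^ (Q - m.+1))%N -> lay x m.+2 b =
    \sum_(0 <= j < 4) maxnet_weight m.+2 b (b %/ 2 * 4 + j)%N *
      pos x m (b %/ 2 * 4 + j)%N.
  move=> bQ; rewrite /lay [LHS]/=.
  have -> : maxnet_width m.+2 = (2 ^ (Q - m.+1) * 4)%N.
    rewrite /maxnet_width/= !ltnS (ltnW mQ) !subSS.
    by rewrite -(subnSK mQ) expnSr -mulnA.
  rewrite sum_nat_block.
  rewrite (eq_bigr (fun a' => if (a' == b %/ 2)%N then
     \sum_(0 <= j < 4) maxnet_weight m.+2 b (a' * 4 + j)%N * pos x m (a' * 4 + j)%N
     else 0)); last first.
    move=> a' _; case: eqP => // /eqP ab; rewrite big_nat_cond big1// => j.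
    rewrite andbT /= => j4; rewrite /maxnet_weight/= ltnS mQ.
    by rewrite divnMDl// divn_small// addn0 (negbTE ab) mul0r.
  by rewrite (sum_nat_pick (fun a' => \sum_(0 <= j < 4) _ * _)).
have h1 : (a * 2 %/ 2 = a)%N by rewrite mulnK.
have h2 : ((a * 2).+1 %/ 2 = a)%N by rewrite -addn1 divnMDl// addn0.
have sum4 (G : nat -> R) :
    \sum_(0 <= j < 4) G j = G 0%N + G 1%N + G 2%N + G 3%N.
  by rewrite !big_nat_recr//= big_geq// add0r.
have w0 j : (j < 4)%N -> maxnet_weight m.+2 (a * 2) (a * 4 + j) =
    if (2 <= j)%N then - 1 else 1.
  move=> j4; rewrite /maxnet_weight/= ltnS mQ h1 divnMDl// divn_small// addn0 eqxx.
  by rewrite oddM andbF modnMDl modn_small.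
have w1 j : (j < 4)%N -> maxnet_weight m.+2 (a * 2).+1 (a * 4 + j) =
    if (2 <= j)%N then 1 else 0.
  move=> j4; rewrite /maxnet_weight/= ltnS mQ h2 divnMDl// divn_small// addn0 eqxx.
  by rewrite oddM andbF/= modnMDl modn_small.
have c0 : champion x m (a * 2)%N = pos x m (a * 4 + 0)%N + pos x m (a * 4 + 1)%N.
  by rewrite /champion; congr (pos _ _ _ + pos _ _ _); lia.
have c1 : champion x m (a * 2).+1 = pos x m (a * 4 + 2)%N + pos x m (a * 4 + 3)%N.
  by rewrite /champion; congr (pos _ _ _ + pos _ _ _); lia.
have L0 : lay x m.+2 (a * 2) = champion x m (a * 2)%N - champion x m (a * 2).+1.
  by rewrite layE h1// sum4 !w0// c0 c1 /= !mulN1r !mul1r opprD !addrA.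
have L1 : lay x m.+2 (a * 2).+1 = champion x m (a * 2).+1.
  by rewrite layE h2// sum4 !w1// c1 /= !mul0r !mul1r !add0r.
by rewrite {1}/champion /pos L0 L1 /maxnet_bias/= !subr0.
Qed.

(** By induction on [m], contestant [a] after [m] rounds is the maximum over the leaves [b] with
    [b %/ 2 ^ m = a]. *)
Lemma champion_final x :
  (forall b, (b < N)%N -> tent b x <= champion x Q 0) /\
  exists2 b, (b < N)%N & champion x Q 0 = tent b x.
Proof.
have main m a : (m <= Q)%N -> (a < 2 ^ (Q - m))%N ->
    (forall b, (b %/ 2 ^ m = a)%N -> tent b x <= champion x m a) /\
    exists2 b, (b %/ 2 ^ m = a)%N & champion x m a = tent b x.
  elim: m a => [|m ih] a mQ aQ.
    rewrite subn0 in aQ; rewrite champion0//; split => [b|]; first by rewrite divn1 => ->.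
    by exists a => //; rewrite divn1.
  have E : (2 ^ (Q - m) = 2 ^ (Q - m.+1) * 2)%N by rewrite -(subnSK mQ) expnSr.
  have [||h1 [b1 hb1 E1]] := ih (a * 2)%N.
  - exact: ltnW.
  - by rewrite E ltn_pmul2r.
  have [||h2 [b2 hb2 E2]] := ih (a * 2).+1.
  - exact: ltnW.
  - by rewrite E; lia.
  have dE b : (b %/ 2 ^ m.+1 = b %/ 2 ^ m %/ 2)%N by rewrite expnSr divnMA.
  rewrite champion_max//; split => [b|].
    rewrite dE le_max => ba; apply/orP.
    have : (b %/ 2 ^ m = a * 2 \/ b %/ 2 ^ m = (a * 2).+1)%N by lia.
    by case=> [/h1|/h2]; [left|right].
  have [_|_] := leP (champion x m (a * 2)%N) (champion x m (a * 2).+1).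
    by exists b2 => //; rewrite dE hb2; lia.
  by exists b1 => //; rewrite dE hb1; lia.
have [||h1 [b hb E]] := main Q 0%N; rewrite ?subnn//.
have dN c : (c < N)%N -> (c %/ 2 ^ Q = 0)%N by move=> cN; rewrite divn_small.
split; first by move=> c /dN; exact: h1.
exists b => //; rewrite ltnNge; apply/negP => Nb.
have : (0 < b %/ 2 ^ Q)%N by rewrite divn_gt0// expn_gt0.
by rewrite hb.
Qed.

(** A weight is at most 1, so the factor [T] arises as the sum of [T] identical neurons. *)
Lemma maxnet_output x : lay x Q.+3 0 = T%:R * champion x Q 0.
Proof.
have c0 : 0 <= champion x Q 0 by rewrite addr_ge0// /pos /relu le_max lexx orbT.
have layS i a : lay x i.+1 a = \sum_(0 <= b < maxnet_width i.+1)
    maxnet_weight i.+1 a b * relu (lay x i b - maxnet_bias i.+1 b) by [].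
have E a : lay x Q.+2 a = champion x Q 0.
  rewrite layS (_ : maxnet_width Q.+2 = 2%N).
    by rewrite sum_nat2 /maxnet_weight/= ltnn !mul1r.
  by rewrite /maxnet_width/= leqnn subnn.
rewrite layS (_ : maxnet_width Q.+3 = T); last by rewrite /maxnet_width/= ltnn eqxx.
rewrite (eq_bigr (fun=> champion x Q 0)); last first.
  move=> a _; rewrite E /maxnet_bias/= subr0.
  by rewrite /maxnet_weight/= ltnNge leqnSn mul1r /relu max_l.
by rewrite sumr_const_nat subn0 mulr_natl.
Qed.

Hypothesis T0 : (0 < T)%N.
Hypothesis psi0 : forall x, unit_cube k x -> 0 <= psi x <= T%:R.
Hypothesis psi_lip : forall x y, unit_cube k x -> unit_cube k y ->
  `|psi x - psi y| <= T%:R * l1_dist x y.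

Lemma grid_point_cube a : unit_cube k (grid_point a).
Proof.
move=> j; rewrite tnth_mktuple; have q0 : 0 < (2 ^ q)%:R :> R by rewrite ltr0n pow2_gt0.
by rewrite divr_ge0 ?ler0n//= ler_pdivrMr// mul1r ler_nat ltnW// ltn_ord.
Qed.

Lemma grid_coordE a (j : 'I_k) : grid_coord a j = tnth (grid_point a) j.
Proof. by rewrite (tnth_nth 0). Qed.

Lemma tentE a (x : k.-tuple R) :
  tent a (nth 0 x) = relu (psi (grid_point a) / T%:R - l1_dist x (grid_point a)).
Proof.
rewrite /tent /l1_dist big_mkord; congr (relu (_ - _)).
by apply: eq_bigr => j _; rewrite grid_coordE (tnth_nth 0 x).
Qed.

Lemma grid_point_near (x : k.-tuple R) : unit_cube k x ->
  exists2 a, (a < N)%N & l1_dist x (grid_point a) <= k%:R / (2 ^ q)%:R.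
Proof.
move=> xC; have q0 : 0 < (2 ^ q)%:R :> R by rewrite ltr0n pow2_gt0.
(* The cap serves the coordinate 1, whose truncation [2 ^ q] is not a grid index. *)
pose dig (t : R) := minn (Num.truncn ((2 ^ q)%:R * t)) (2 ^ q).-1.
have dig_lt t : (dig t < 2 ^ q)%N.
  by rewrite /dig (leq_ltn_trans (geq_minr _ _))// ltn_predL pow2_gt0.
pose g : {ffun 'I_k -> 'I_(2 ^ q)} := [ffun j => Ordinal (dig_lt (tnth x j))].
have gE : (index g (enum {: {ffun 'I_k -> 'I_(2 ^ q)}}) < N)%N.
  have := mem_enum {: {ffun 'I_k -> 'I_(2 ^ q)}} g.
  by rewrite inE -index_mem -cardT card_ffun !card_ord -expnM.
exists (index g (enum {: {ffun 'I_k -> 'I_(2 ^ q)}})) => //.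
rewrite /l1_dist -[k in k%:R](card_ord k) -sumr_const mulr_suml ler_sum// => j _.
rewrite tnth_mktuple /grid_index nth_index ?mem_enum// ffunE /= /dig.
have /andP[x0 x1] := xC j.
have y0 : 0 <= (2 ^ q)%:R * tnth x j by rewrite mulr_ge0.
have /andP[t1 t2] := truncn_itv y0.
set m := Num.truncn _ in t1 t2 *.
rewrite ler_norml mul1r -[X in - X <= _ - _]mul1r -[X in _ && (_ <= X)]mul1r.
rewrite lerBrDr -mulNr -mulrDl lerBlDr -mulrDl ler_pdivrMr// ler_pdivlMr//.
rewrite (mulrC (tnth x j)); move: y0 t1 t2; set y := _ * tnth x j => y0 t1 t2.
have yq : y <= (2 ^ q)%:R by rewrite /y ger_pMr.
have qE : (2 ^ q)%:R = (2 ^ q).-1%:R + 1 :> R by rewrite natr1 prednK ?pow2_gt0.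
rewrite -natr1 in t2.
have [mq|mq] := leqP m (2 ^ q).-1; first by apply/andP; split; lra.
have : (2 ^ q).-1%:R <= m%:R - 1 :> R.
  by rewrite lerBrDr natr1 ler_nat.
by move=> h; apply/andP; split; lra.
Qed.

(** No cone exceeds [psi], by the Lipschitz bound. The cone of a nearby grid point loses [T] times
    the distance twice: once from the value of [psi] at its apex, once from its slope. *)
Lemma maxnet_approx (x : k.-tuple R) : unit_cube k x ->
  [/\ 0 <= lay (nth 0 x) Q.+3 0, lay (nth 0 x) Q.+3 0 <= psi x &
   psi x - lay (nth 0 x) Q.+3 0 <= 2 * T%:R * (k%:R / (2 ^ q)%:R)].
Proof.
move=> xC; rewrite maxnet_output.
have TR : 0 < T%:R :> R by rewrite ltr0n.
have [cmax [b bN cE]] := champion_final (nth 0 x).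
have [a aN xa] := grid_point_near xC.
have up c : T%:R * tent c (nth 0 x) <= psi x.
  rewrite tentE /relu maxr_pMr ?ler0n// mulr0 ge_max.
  have /andP[-> _] := psi0 xC; rewrite andbT mulrBr (mulrC T%:R (_ / _)) divfK ?gt_eqF//.
  have := psi_lip xC (grid_point_cube c); rewrite ler_norml => /andP[h _]; lra.
have lo : psi x - 2 * T%:R * (k%:R / (2 ^ q)%:R) <= T%:R * tent a (nth 0 x).
  rewrite tentE /relu maxr_pMr ?ler0n// mulr0 le_max; apply/orP; left.
  rewrite mulrBr (mulrC T%:R (_ / _)) divfK ?gt_eqF//.
  have := psi_lip xC (grid_point_cube a); rewrite ler_norml => /andP[_].
  have : T%:R * l1_dist x (grid_point a) <= T%:R * (k%:R / (2 ^ q)%:R).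
    by rewrite ler_pM2l.
  lra.
split.
- by rewrite cE mulr_ge0// /tent /relu le_max lexx orbT.
- by rewrite cE.
- by rewrite lerBlDr -lerBlDl (le_trans lo)// ler_pM2l// cmax.
Qed.

(** A row reads one input, the [2 * k] neurons of a distance, the four of a match, or the [T] copies
    of the result, whence the row bound [k * 2 + 4 + T]. *)
Lemma maxnet_nn_class (s : nat) :
  (Q.+4 * (N * k * 2 + N * 2 + T + k + 1) * (k * 2 + 4 + T).+1 <= s)%N ->
  nn_class (widths Q.+3 maxnet_width) s T%:R
    (fun x : k.-tuple R => lay (nth 0 x) Q.+3 0).
Proof.
move=> hs; have N0 : (0 < N)%N by rewrite expn_gt0.
apply: explicit_nn_class hs _ _ => //.
- exact: maxnet_width_last.
- move=> i a b _ _ _; rewrite /maxnet_weight.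
  by do !case: ifP => _; rewrite ?normrN ?normr1 ?normr0.
- move=> i a /andP[i0 il] aw; rewrite /maxnet_bias.
  case: eqP => [i1|_].
    have k0 : (0 < k)%N by move: aw; rewrite i1 /maxnet_width/=; case: (k) => //; rewrite muln0.
    have h : `|grid_coord (a %/ 2 %/ k) (a %/ 2 %% k)| <= 1.
      have jk : (a %/ 2 %% k < k)%N by rewrite ltn_mod.
      rewrite (grid_coordE _ (Ordinal jk)).
      by have /andP[h0 h1] := grid_point_cube (a %/ 2 %/ k) (Ordinal jk); rewrite ger0_norm.
    by case: ifP; rewrite ?normrN.
  case: eqP => [_|_]; last by rewrite normr0.
  case: ifP => _; first by rewrite normr0.
  have /andP[h0 h1] := psi0 (grid_point_cube (a %/ 2)).
  by rewrite normrN ger0_norm ?divr_ge0// ler_pdivrMr ?mul1r// ltr0n.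
- by move=> i _; exact: maxnet_width_le.
- move=> i a il aw; rewrite /maxnet_weight.
  have sub1 (m : nat) (g : 'I_m -> R) (A : {set 'I_m}) (c : nat) : (#|A| <= c)%N ->
      (c <= k * 2 + 4 + T)%N -> (forall b, b \notin A -> g b = 0) ->
      (#|[set b | g b != 0%R]%SET| <= k * 2 + 4 + T)%N.
    move=> Ac cR g0; apply: leq_trans (leq_trans Ac cR).
    apply/subset_leq_card/fintype.subsetP => b; rewrite inE.
    by apply: contraNT => /g0 ->.
  case: eqP => [i0|/eqP i0].
    apply: (sub1 _ _ [set b : 'I_(maxnet_width i) | b %/ 1 == (a %/ 2) %% k]%N%SET 1%N).
    + exact: card_block.
    + by lia.
    + by move=> b; rewrite inE divn1 => /negbTE ->.
  case: eqP => [i1|/eqP i1].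
    have [k0|k0] := posnP k.
      move: i1; rewrite /maxnet_width => ->/=; rewrite k0 muln0 mul0n.
      by rewrite (leq_trans (max_card _))// card_ord.
    apply: (sub1 _ _ [set b : 'I_(maxnet_width i) | b %/ (k * 2) == a %/ 2]%N%SET (k * 2)%N).
    + by apply: card_block; rewrite muln_gt0 k0.
    + by lia.
    + by move=> b; rewrite inE => /negbTE ->.
  have [hi|hi] := boolP (i <= Q.+1)%N.
    apply: (sub1 _ _ [set b : 'I_(maxnet_width i) | b %/ 4 == a %/ 2]%N%SET 4%N).
    + exact: card_block.
    + by lia.
    + by move=> b; rewrite inE => /negbTE ->.
  rewrite (leq_trans (max_card _))// card_ord /maxnet_width (negbTE i0) (negbTE i1).
  case: ifP => hi2; last by case: ifP => _; lia.
  by rewrite (_ : Q.+2 - i = 0)%N//; lia.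
- move=> x xC; have [h0 h1 _] := maxnet_approx xC.
  by rewrite ger0_norm// (le_trans h1)//; have /andP[] := psi0 xC.
Qed.

End max_tree.

(** * Covering numbers *)

Section sparse_codes.
Context (R : realType) (pos : finType) (s M : nat).
Hypothesis M0 : (0 < M)%N.

Let cell (t : R) : 'I_(M * 2).+1 := inord (Num.truncn (M%:R * (t + 1))).

Let cell_near (t t' : R) : `|t| <= 1 -> `|t'| <= 1 -> cell t = cell t' ->
  `|t - t'| <= M%:R^-1.
Proof.
have MR : 0 < M%:R :> R by rewrite ltr0n.
have trE u : `|u| <= 1 -> cell u = Num.truncn (M%:R * (u + 1)) :> nat.
  rewrite ler_norml => /andP[u0 u1]; rewrite /cell inordK// ltnS -(ler_nat R).
  have y0 : 0 <= M%:R * (u + 1) by rewrite mulr_ge0 ?ler0n//; lra.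
  have /andP[h _] := truncn_itv y0; apply: (le_trans h).
  by rewrite natrM ler_pM2l//; lra.
move=> t1 t'1 /(congr1 val); rewrite /= !trE// => E.
have bnd (u : R) : `|u| <= 1 -> (Num.truncn (M%:R * (u + 1)))%:R <= M%:R * (u + 1) <
    (Num.truncn (M%:R * (u + 1)))%:R + 1.
  move=> u1; rewrite natr1; apply: truncn_itv.
  by move: u1; rewrite ler_norml => /andP[u0 u1]; rewrite mulr_ge0 ?ler0n//; lra.
have /andP[a1 a2] := bnd _ t1; have /andP[b1 b2] := bnd _ t'1.
rewrite -(ler_pM2l MR) mulfV ?gt_eqF// -[X in X * `|_|](ger0_norm (ltW MR)) -normrM.
rewrite -E in b1 b2.
by rewrite ler_norml; apply/andP; split; lra.
Qed.

(* The list of the positions of the nonzero entries of [th], each with the cell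
   of its value. *)
Definition sparse_code (th : pos -> R) : {ffun 'I_s -> option (pos * 'I_(M * 2).+1)} :=
  [ffun k : 'I_s => nth None [seq Some (p, cell (th p)) | p <- enum [set p | th p != 0%R]%SET] k].

(** As supports have at most [s] elements, the code lists them completely. Equal codes thus have
    equal supports and equal cells on them, and both parameters vanish elsewhere. *)
Lemma sparse_code_near (th th' : pos -> R) :
  (forall p, `|th p| <= 1) -> (forall p, `|th' p| <= 1) ->
  (#|[set p | th p != 0%R]%SET| <= s)%N -> (#|[set p | th' p != 0%R]%SET| <= s)%N ->
  sparse_code th = sparse_code th' -> forall p, `|th p - th' p| <= M%:R^-1.
Proof.
have supp (u u' : pos -> R) p : (#|[set p | u p != 0%R]%SET| <= s)%N ->
    sparse_code u = sparse_code u' -> u p != 0 -> u' p != 0 /\ cell (u p) = cell (u' p).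
  move=> us E up; set L := enum [set p | u p != 0%R]%SET.
  have pL : p \in L by rewrite mem_enum inE.
  have iL : (index p L < size L)%N by rewrite index_mem.
  have is' : (index p L < s)%N by rewrite (leq_trans iL)// -cardE.
  move/ffunP : E => /(_ (Ordinal is')); rewrite !ffunE /= (nth_map p)// nth_index//.
  set L' := enum [set p | u' p != 0%R]%SET.
  have [iL'|iL'] := ltnP (index p L) (size L'); last first.
    by rewrite [in RHS]nth_default// size_map.
  rewrite (nth_map p)// => -[pE ->]; split; last by rewrite -pE.
  by have := mem_nth p iL'; rewrite -pE mem_enum inE.
move=> th1 th'1 ths th's E p.
have [p0|p0] := eqVneq (th p) 0; last first.
  have [_ h] := supp _ _ _ ths E p0; exact: cell_near.
have [p'0|p'0] := eqVneq (th' p) 0; first by rewrite p0 p'0 subrr normr0 invr_ge0.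
by have [] := supp _ _ _ th's (esym E) p'0; rewrite p0 eqxx.
Qed.

End sparse_codes.

(** * Stability under perturbation of the parameters *)

Section network_perturbation.
Context (R : realType).

Lemma relu_lip (a b : R) : `|relu a - relu b| <= `|a - b|.
Proof.
rewrite /relu ler_norml.
have [a0|a0] := leP a 0; have [b0|b0] := leP b 0; case: (ger0P (a - b)) => h;
  apply/andP; split; lra.
Qed.

Lemma relu_norm (a : R) : `|relu a| <= `|a|.
Proof. by have := relu_lip a 0; rewrite {2}/relu maxxx !subr0. Qed.

Variables (w : seq nat) (Wd l : nat).
Hypothesis wWd : forall i, (i <= l.+1)%N -> (nth 0%N w i <= Wd)%N.

Lemma sum_entries_le (i : nat) (G : 'I_(nth 0%N w i) -> R) (c : R) :
  (i <= l.+1)%N -> 0 <= c -> (forall j, `|G j| <= c) -> `|\sum_j G j| <= Wd%:R * c.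
Proof.
move=> il c0 Gc; apply: le_trans (ler_norm_sum _ _ _) _.
apply: (@le_trans _ _ (\sum_(j < nth 0%N w i) c)); first exact: ler_sum.
by rewrite sumr_const card_ord -(mulr_natl c) ler_wpM2r// ler_nat wWd.
Qed.

(** The summand 1 on the left makes room for the bias subtracted in the next layer, so the induction
    closes with the factor [Wd + 1]. *)
Lemma net_eval_bounded (W : forall i, 'M[R]_(nth 0%N w i.+1, nth 0%N w i))
    (v : forall i, 'cV[R]_(nth 0%N w i)) (x : 'cV[R]_(nth 0%N w 0)) (i : nat) a b :
  (forall i a b, (i <= l)%N -> `|W i a b| <= 1) ->
  (forall i a b, (0 < i <= l)%N -> `|v i a b| <= 1) ->
  (forall j b, `|x j b| <= 1) -> (i <= l)%N ->
  `|net_eval W v x i a b| + 1 <= (Wd%:R + 1) ^+ i.+1.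
Proof.
move=> W1 v1 x1; elim: i a b => [|i ih] a b il /=; rewrite mxE.
  rewrite expr1 lerD2r -[leRHS]mulr1; apply: sum_entries_le => // j.
  by rewrite normrM -[leRHS]mul1r ler_pM// W1.
have K1 : 1 <= (Wd%:R + 1) ^+ i.+1 :> R by rewrite exprn_ege1// lerDr.
rewrite exprSr mulrDr mulr1 lerD// mulrC; apply: sum_entries_le.
- exact: leqW.
- by rewrite exprn_ge0// addr_ge0.
move=> j; rewrite !mxE normrM -[leRHS]mul1r ler_pM// ?W1//.
apply: le_trans (relu_norm _) _; apply: le_trans (ler_normB _ _) _.
apply: le_trans (ih j b (ltnW il)); rewrite lerD2l v1//.
Qed.

(** By [W y - W' y' = (W - W') y + W' (y - y')], each entry of a layer meets three errors, from the
    weight, from the previous layer and from the bias. Each is at most [eta * K ^ i.+1], whence the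
    3 in [K = 3 * (Wd + 1)]. *)
Lemma net_eval_perturb (W W' : forall i, 'M[R]_(nth 0%N w i.+1, nth 0%N w i))
    (v v' : forall i, 'cV[R]_(nth 0%N w i)) (x : 'cV[R]_(nth 0%N w 0)) (eta : R)
    (i : nat) a b :
  (forall i a b, (i <= l)%N -> `|W i a b| <= 1) ->
  (forall i a b, (0 < i <= l)%N -> `|v i a b| <= 1) ->
  (forall i a b, (i <= l)%N -> `|W' i a b| <= 1) ->
  (forall i a b, (i <= l)%N -> `|W i a b - W' i a b| <= eta) ->
  (forall i a b, (0 < i <= l)%N -> `|v i a b - v' i a b| <= eta) ->
  (forall j b, `|x j b| <= 1) -> 0 <= eta -> (i <= l)%N ->
  `|net_eval W v x i a b - net_eval W' v' x i a b| <= eta * (3 * (Wd%:R + 1)) ^+ i.+1.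
Proof.
move=> W1 v1 W'1 WW' vv' x1 eta0; elim: i a b => [|i ih] a b il /=; rewrite !mxE -sumrB.
  apply: (@le_trans _ _ (Wd%:R * eta)).
    apply: sum_entries_le => // j.
    by rewrite -mulrBl normrM -[leRHS]mulr1 ler_pM// WW'.
  by rewrite expr1 mulrC ler_wpM2l//; have := ler0n R Wd; lra.
set K := 3 * (Wd%:R + 1).
have D0 := ler0n R Wd.
have K1 : 1 <= K by rewrite /K; lra.
have KD : (Wd%:R + 1) ^+ i.+1 <= K ^+ i.+1 by rewrite lerXn2r ?nnegrE /K; lra.
have Ki : 1 <= K ^+ i.+1 by rewrite exprn_ege1.
apply: (@le_trans _ _ (Wd%:R * (eta * K ^+ i.+1 + (eta * K ^+ i.+1 + eta)))).
  apply: sum_entries_le; first exact: leqW.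
    by rewrite !addr_ge0// mulr_ge0// (le_trans _ Ki).
  move=> j; rewrite !mxE; set y := (X in W i.+1 a j * relu X);
    set y' := (X in W' i.+1 a j * relu X).
  have -> : W i.+1 a j * relu y - W' i.+1 a j * relu y' =
    (W i.+1 a j - W' i.+1 a j) * relu y + W' i.+1 a j * (relu y - relu y') by ring.
  apply: le_trans (ler_normD _ _) _; rewrite !normrM lerD//.
    rewrite ler_pM// ?WW'// (le_trans (relu_norm _))// (le_trans (ler_normB _ _))//.
    apply: le_trans _ KD; apply: le_trans (net_eval_bounded j b W1 v1 x1 (ltnW il)).
    by rewrite lerD2l v1.
  rewrite -[leRHS]mul1r ler_pM// ?W'1// (le_trans (relu_lip _ _))//.
  have -> : y - y' = (net_eval W v x i j b - net_eval W' v' x i j b) +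
      (v' i.+1 j 0 - v i.+1 j 0) by rewrite /y /y' (ord1 b); ring.
  rewrite (le_trans (ler_normD _ _))// lerD//; first by apply: ih; exact: ltnW.
  by rewrite distrC vv'.
rewrite [K ^+ i.+2]exprS mulrCA.
have e1 : 0 <= eta * K ^+ i.+1 by rewrite mulr_ge0// (le_trans _ Ki).
have e2 : eta <= eta * K ^+ i.+1 by rewrite ler_peMr.
apply: (@le_trans _ _ (Wd%:R * (3 * (eta * K ^+ i.+1)))).
  by rewrite ler_wpM2l//; lra.
rewrite mulrA ler_wpM2r// /K; lra.
Qed.

End network_perturbation.

Section network_cover.
Context (R : realType) (k l : nat) (w : l.+2.-tuple nat) (s Wd M : nat) (F : R).
Hypothesis wWd : forall i, (i <= l.+1)%N -> (nth 0%N w i <= Wd)%N.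
Hypothesis w_last : nth 0%N w l.+1 = 1%N.
Hypothesis M0 : (0 < M)%N.

Let pos : finType :=
  ({i : 'I_l.+1 & 'I_(nth 0%N w i.+1) * 'I_(nth 0%N w i)} +
   {i : 'I_l.+1 & 'I_(nth 0%N w i)})%type.

(** The bias of index 0 carries no bound in [nn_class]; reading it as 0 keeps all parameters in
    [-1, 1] and within the sparsity count. *)
Let params (W : forall i, 'M[R]_(nth 0%N w i.+1, nth 0%N w i))
    (v : forall i, 'cV[R]_(nth 0%N w i)) (p : pos) : R :=
  match p with
  | inl (existT i ab) => W i ab.1 ab.2
  | inr (existT i a) => if (0 < i)%N then v i a ord0 else 0
  end.

Let card_pos : (#|pos| <= l.+1 * (Wd * Wd + Wd))%N.
Proof.
rewrite -sum1_card big_sumType/= mulnDr leq_add//.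
- apply: (@leq_trans (\sum_(i < l.+1) \sum_(ab : 'I_(nth 0%N w i.+1) * 'I_(nth 0%N w i)) 1)).
    by rewrite sig_big_dep/= leq_eqVlt; apply/orP; left; apply/eqP/eq_bigl.
  rewrite -[l.+1 in leqRHS]card_ord -sum_nat_const leq_sum// => i _.
  by rewrite sum1_card card_prod !card_ord leq_mul// wWd// ltnW.
- apply: (@leq_trans (\sum_(i < l.+1) \sum_(a : 'I_(nth 0%N w i)) 1)).
    by rewrite sig_big_dep/= leq_eqVlt; apply/orP; left; apply/eqP/eq_bigl.
  rewrite -[l.+1 in leqRHS]card_ord -sum_nat_const leq_sum// => i _.
  by rewrite sum1_card card_ord wWd// ltnW.
Qed.

Let card_support W v :
  (#|[set p | params W v p != 0%R]%SET| <= \sum_(0 <= i < l.+1) nnz_entries (W i) +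
     \sum_(1 <= i < l.+1) nnz_entries (v i))%N.
Proof.
rewrite -sum1dep_card big_sumType/= leq_add//.
- apply: (@leq_trans (\sum_(i < l.+1)
      \sum_(ab : 'I_(nth 0%N w i.+1) * 'I_(nth 0%N w i) | W i ab.1 ab.2 != 0%R) 1)).
    by rewrite sig_big_dep/= leq_eqVlt; apply/orP; left; apply/eqP/eq_bigl => -[].
  by rewrite big_mkord; apply: leq_sum => i _; rewrite sum1dep_card.
- apply: (@leq_trans (\sum_(i < l.+1 | (0 < i)%N)
      \sum_(a : 'I_(nth 0%N w i) | v i a ord0 != 0%R) 1)%N).
    rewrite sig_big_dep/= leq_eqVlt; apply/orP; left; apply/eqP/eq_bigl => -[i a] /=.
    by case: ifP => //= _; rewrite eqxx.
  rewrite big_add1 /= big_mkord big_mkcond big_ord_recl/= add0n.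
  apply: leq_sum => i _; rewrite sum1dep_card /nnz_entries.
  rewrite -(card_in_imset (f := fun a : 'I__ => (a, ord0 : 'I_1))); last by move=> a a' _ _ [].
  apply/subset_leq_card/fintype.subsetP => -[a z] /imsetP[a']; rewrite !inE => va [-> ->].
  exact: va.
Qed.

Let class_params (f : k.-tuple R -> R) : nn_class w s F f ->
  exists th : pos -> R, [/\ forall p, `|th p| <= 1,
    (#|[set p | th p != 0%R]%SET| <= s)%N &
    exists W v, th = params W v /\
      forall x : k.-tuple R, net_eval W v (\col_j nth 0 x j) l = const_mx (f x)].
Proof.
move=> [W [v [W1 v1 sW fE fF]]]; exists (params W v); split.
- move=> [[i [a b]]|[i a]] /=; first by apply: W1; have := ltn_ord i.
  case: ifP => i0; last by rewrite normr0.
  by apply: v1; rewrite i0; have := ltn_ord i.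
- exact: leq_trans (card_support W v) sW.
- by exists W, v.
Qed.

(** Each of [s] slots is empty or holds a position with a cell, whence the condition on [m]. A code
    with fibres of small diameter spares the choice of centres inside the class. *)
Lemma nn_class_cover (m : nat) :
  ((1 + l.+1 * (Wd * Wd + Wd) * (M * 2).+1) ^ s <= m.+1)%N ->
  exists c : (k.-tuple R -> R) -> 'I_m.+1,
    forall f g, nn_class w s F f -> nn_class w s F g -> c f = c g ->
    forall x, unit_cube k x ->
      `|f x - g x| <= M%:R^-1 * (3 * (Wd%:R + 1)) ^+ l.+1.
Proof.
move=> hm.
pose th f : pos -> R := if pselect (nn_class w s F f) is left h
  then sval (cid (class_params h)) else fun=> 0.
pose C := {ffun 'I_s -> option (pos * 'I_(M * 2).+1)}.
have cardC : (#|C| <= m.+1)%N.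
  rewrite card_ffun card_ord card_option card_prod card_ord (leq_trans _ hm)//.
  case: (s) => // s'; rewrite leq_exp2r// add1n ltnS leq_mul2r card_pos orbT//.
exists (fun f => widen_ord cardC (enum_rank (sparse_code s M (th f)))).
move=> f g hf hg /(congr1 val)/= /ord_inj/enum_rank_inj E x xC.
have [ [tf1 tfs [W [v [tfE fE]]]] [tg1 tgs [W' [v' [tgE gE]]]] ] :
    [/\ forall p, `|th f p| <= 1, (#|[set p | th f p != 0%R]%SET| <= s)%N &
      exists W v, th f = params W v /\
        forall x : k.-tuple R, net_eval W v (\col_j nth 0 x j) l = const_mx (f x)] /\
    [/\ forall p, `|th g p| <= 1, (#|[set p | th g p != 0%R]%SET| <= s)%N &
      exists W v, th g = params W v /\
        forall x : k.-tuple R, net_eval W v (\col_j nth 0 x j) l = const_mx (g x)].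
  by split; rewrite /th; case: pselect => // h; case: cid.
have near := sparse_code_near M0 tf1 tg1 tfs tgs E.
have o : 'I_(nth 0%N w l.+1) by rewrite w_last; exact: ord0.
have -> : f x - g x = net_eval W v (\col_j nth 0 x j) l o ord0 -
    net_eval W' v' (\col_j nth 0 x j) l o ord0 by rewrite fE gE !mxE.
rewrite tfE tgE in near tf1 tg1.
pose iW (i : nat) (il : (i <= l)%N) (a : 'I_(nth 0%N w i.+1)) (b : 'I_(nth 0%N w i)) : pos :=
  inl (existT (fun i : 'I_l.+1 => ('I_(nth 0%N w i.+1) * 'I_(nth 0%N w i))%type)
    (Ordinal (il : (i < l.+1)%N)) (a, b)).
pose iv (i : nat) (il : (i <= l)%N) (a : 'I_(nth 0%N w i)) : pos :=
  inr (existT (fun i : 'I_l.+1 => 'I_(nth 0%N w i)) (Ordinal (il : (i < l.+1)%N)) a).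
apply: (net_eval_perturb wWd) => //.
- by move=> i a b il; have := tf1 (iW i il a b).
- move=> i a b /andP[i0 il]; have := tf1 (iv i il a).
  by rewrite /= i0 (ord1 b).
- by move=> i a b il; have := tg1 (iW i il a b).
- by move=> i a b il; have := near (iW i il a b).
- move=> i a b /andP[i0 il]; have := near (iv i il a).
  by rewrite /= i0 (ord1 b).
- move=> j b; rewrite mxE; have [jk|jk] := ltnP j k; last first.
    by rewrite nth_default ?size_tuple// normr0.
  have := xC (Ordinal jk); rewrite (tnth_nth 0) /= => /andP[x0 x1].
  by rewrite ger0_norm.
Qed.

End network_cover.

Section product_cover.
Context (R : realType).

Lemma prod_bounded (I : Type) (s : seq I) (a : I -> R) (F : R) :
  1 <= F -> (forall i, `|a i| <= F) -> `|\prod_(i <- s) a i| <= F ^+ size s.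
Proof.
move=> F1 aF; elim: s => [|i s ih]; first by rewrite big_nil normr1.
by rewrite big_cons exprS normrM ler_pM.
Qed.

Lemma prod_perturb (I : Type) (s : seq I) (a b : I -> R) (F delta : R) :
  1 <= F -> 0 <= delta -> (forall i, `|a i| <= F) -> (forall i, `|b i| <= F) ->
  (forall i, `|a i - b i| <= delta) ->
  `|\prod_(i <- s) a i - \prod_(i <- s) b i| <= (size s)%:R * F ^+ size s * delta.
Proof.
move=> F1 d0 aF bF ab; have F0 : 0 <= F by lra.
elim: s => [|i s ih]; first by rewrite !big_nil subrr normr0 !mul0r.
rewrite !big_cons /=.
have -> : a i * \prod_(j <- s) a j - b i * \prod_(j <- s) b j =
  a i * (\prod_(j <- s) a j - \prod_(j <- s) b j) + (a i - b i) * \prod_(j <- s) b j.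
  by ring.
apply: le_trans (ler_normD _ _) _; rewrite !normrM.
have h1 := ler_pM (normr_ge0 _) (normr_ge0 _) (aF i) ih.
have h2 := ler_pM (normr_ge0 _) (normr_ge0 _) (ab i) (prod_bounded s F1 bF).
apply: le_trans (lerD h1 h2) _.
rewrite exprS -natr1.
have Fs : 0 <= F ^+ size s by rewrite exprn_ge0.
have := mulr_ge0 d0 Fs; set n : R := (size s)%:R; set P := F ^+ size s => dP.
have : delta * P <= delta * P * F by rewrite ler_peMr.
lra.
Qed.

(** Indices outside [A] are padded by the factor 1; as [1 <= F], the bound depends on [I] only. This
    is the origin of the exponent [#|{set 'I_d}|] in all later constants. *)
Lemma finprod_bounded (I : finType) (A : {set I}) (a : I -> R) (F : R) :
  1 <= F -> (forall i, i \in A -> `|a i| <= F) ->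
  `|\prod_(i in A) a i| <= F ^+ #|I|.
Proof.
move=> F1 aF; rewrite big_mkcond/= cardE enumT.
apply: prod_bounded => // i; case: ifP => [/aF//|_].
by rewrite normr1.
Qed.

Lemma finprod_perturb (I : finType) (A : {set I}) (a b : I -> R) (F delta : R) :
  1 <= F -> 0 <= delta -> (forall i, i \in A -> `|a i| <= F) ->
  (forall i, i \in A -> `|b i| <= F) ->
  (forall i, i \in A -> `|a i - b i| <= delta) ->
  `|\prod_(i in A) a i - \prod_(i in A) b i| <= #|I|%:R * F ^+ #|I| * delta.
Proof.
move=> F1 d0 aF bF ab; rewrite big_mkcond/= [X in _ - X]big_mkcond/= cardE enumT.
apply: prod_perturb => // i.
- by case: ifP => [/aF//|_]; rewrite normr1.
- by case: ifP => [/bF//|_]; rewrite normr1.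
- by case: ifP => [/ab//|_]; rewrite subrr normr0.
Qed.

End product_cover.

(** * Risk of the minimizer *)

Section network_measurability.
Context (R : realType).

Lemma measurable_relu : measurable_fun [set: R] (@relu R).
Proof. by apply: measurable_maxr => //; exact: measurable_cst. Qed.

Lemma measurable_net_eval (k : nat) (w : seq nat)
    (W : forall i, 'M[R]_(nth 0%N w i.+1, nth 0%N w i))
    (v : forall i, 'cV[R]_(nth 0%N w i)) i a b :
  measurable_fun [set: k.-tuple R]
    (fun x : k.-tuple R => net_eval W v (\col_j nth 0 x j) i a b).
Proof.
elim: i a b => [|i ih] a b /=; under eq_fun do rewrite mxE.
  apply: measurable_sum => j; under eq_fun do rewrite mxE.
  apply: measurable_funM; first exact: measurable_cst.
  have [jk|jk] := ltnP j k.
    rewrite (_ : (fun x => _) = fun x : k.-tuple R => tnth x (Ordinal jk)).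
      exact: measurable_tnth.
    by apply/funext => x; rewrite (tnth_nth 0).
  rewrite (_ : (fun x => _) = cst 0); first exact: measurable_cst.
  by apply/funext => x; rewrite nth_default ?size_tuple.
apply: measurable_sum => j; under eq_fun do rewrite !mxE.
apply: measurable_funM; first exact: measurable_cst.
apply: (measurableT_comp measurable_relu).
by apply: measurable_funB => //; exact: ih.
Qed.

Lemma measurable_nn_class (k l : nat) (w : l.+2.-tuple nat) (s : nat) (F : R) f :
  nth 0%N w l.+1 = 1%N -> nn_class w s F f -> measurable_fun [set: k.-tuple R] f.
Proof.
move=> wl [W [v [_ _ _ fE _]]].
have o : 'I_(nth 0%N w l.+1) by rewrite wl; exact: ord0.
rewrite (_ : f = fun x => net_eval W v (\col_j nth 0 x j) l o ord0).
  exact: measurable_net_eval.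
by apply/funext => x; rewrite fE mxE.
Qed.

End network_measurability.

Section product_class.
Context (R : realType) (d : nat) (e : rel 'I_d) (l : {set 'I_d} -> nat)
  (w : forall K, (l K).+2.-tuple nat) (s : nat) (F : R).
Hypothesis w_last : forall K, K \in max_cliques e -> nth 0%N (w K) (l K).+1 = 1%N.

Lemma unit_cube_subvector (K : {set 'I_d}) (x : d.-tuple R) :
  unit_cube d x -> unit_cube #|K| (subvector K x).
Proof. by move=> xC i; rewrite tnth_mktuple. Qed.

Lemma product_class_bounded f x : 1 <= F -> clique_product_class e w s F f ->
  unit_cube d x -> `|f x| <= F ^+ #|{set 'I_d}|.
Proof.
move=> F1 [q [qF ->]] xC; apply: finprod_bounded => // K /qF[W [v [_ _ _ _ qb]]].
exact/qb/unit_cube_subvector.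
Qed.

Lemma measurable_product_class f :
  clique_product_class e w s F f -> measurable_fun [set: d.-tuple R] f.
Proof.
move=> [q [qF ->]].
under eq_fun do rewrite big_mkcond/=.
apply: measurable_prod => K _.
have [KC|_] := boolP (K \in max_cliques e); last exact: measurable_cst.
apply: measurableT_comp; last exact: measurable_subvector.
exact: measurable_nn_class (w_last KC) (qF _ KC).
Qed.

(** A product is coded by the codes of one chosen family of factors. *)
Lemma product_class_cover (m M Wd : nat) :
  1 <= F -> (0 < M)%N ->
  (forall K i, K \in max_cliques e -> (i <= (l K).+1)%N -> (nth 0%N (w K) i <= Wd)%N) ->
  (forall K, K \in max_cliques e ->
    ((1 + (l K).+1 * (Wd * Wd + Wd) * (M * 2).+1) ^ s <= m.+1)%N) ->
  forall Lm : nat, (forall K, K \in max_cliques e -> (l K <= Lm)%N) ->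
  exists c : (d.-tuple R -> R) -> {ffun {set 'I_d} -> 'I_m.+1},
    forall f g, clique_product_class e w s F f -> clique_product_class e w s F g ->
    c f = c g -> forall x, unit_cube d x ->
      `|f x - g x| <= #|{set 'I_d}|%:R * F ^+ #|{set 'I_d}| *
        (M%:R^-1 * (3 * (Wd%:R + 1)) ^+ Lm.+1).
Proof.
move=> F1 M0 wWd hm Lm lLm.
have cov (K : {set 'I_d}) : exists c : (#|K|.-tuple R -> R) -> 'I_m.+1, K \in max_cliques e ->
    forall f g, nn_class (w K) s F f -> nn_class (w K) s F g -> c f = c g ->
    forall x, unit_cube #|K| x ->
      `|f x - g x| <= M%:R^-1 * (3 * (Wd%:R + 1)) ^+ (l K).+1.
  have [KC|KC] := boolP (K \in max_cliques e); last by exists (fun=> ord0).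
  have wK i : (i <= (l K).+1)%N -> (nth 0%N (w K) i <= Wd)%N by exact: wWd.
  by have [c hc] := nn_class_cover #|K| F wK (w_last KC) M0 (hm K KC); exists c.
pose c K := sval (cid (cov K)).
have cP K := svalP (cid (cov K)).
pose q f : forall K : {set 'I_d}, #|K|.-tuple R -> R :=
  if pselect (clique_product_class e w s F f) is left h then sval (cid h)
  else fun _ _ => 0.
have qP f : clique_product_class e w s F f ->
    (forall K, K \in max_cliques e -> nn_class (w K) s F (q f K)) /\
    f = fun x => \prod_(K in max_cliques e) q f K (subvector K x).
  by move=> fF; rewrite /q; case: pselect => // h; case: cid.
exists (fun f => [ffun K => c K (q f K)]) => f g /qP[qf fE] /qP[qg gE] cfg x xC.
rewrite [X in X - _](congr1 (@^~ x) fE) [X in _ - X](congr1 (@^~ x) gE).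
have K1 : 1 <= 3 * (Wd%:R + 1) :> R by have := ler0n R Wd; lra.
have bnd (K : {set 'I_d}) r : K \in max_cliques e -> nn_class (w K) s F r ->
    `|r (subvector K x)| <= F.
  by move=> _ [W [v [_ _ _ _ qb]]]; exact/qb/unit_cube_subvector.
apply: finprod_perturb => //.
- by move=> K KC; exact: bnd KC (qf K KC).
- by move=> K KC; exact: bnd KC (qg K KC).
move=> K KC; have cE : c K (q f K) = c K (q g K).
  by move/ffunP : cfg => /(_ K); rewrite !ffunE.
apply: le_trans (cP K KC _ _ (qf K KC) (qg K KC) cE _ (unit_cube_subvector xC)) _.
by rewrite ler_wpM2l ?invr_ge0// ler_weXn2l// ltnS lLm.
Qed.

End product_class.

(** * From the empirical risk to the L1 error *)

Section oracle_inequality.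
Context (R : realType) (d : nat).
Local Notation lam := (lebesgue_tuple R d).
Local Notation cube := (@unit_cube R d).
Implicit Types f g p : d.-tuple R -> R.

Definition cube_bounded f := measurable_fun cube f /\
  exists B : R, forall x, cube x -> `|f x| <= B.

Lemma cube_bounded_integrable f : cube_bounded f -> lam.-integrable cube (EFin \o f).
Proof. by move=> [mf [B fB]]; exact: bounded_integrable mf fB. Qed.

Lemma cube_boundedM f g : cube_bounded f -> cube_bounded g ->
  cube_bounded (fun x => f x * g x).
Proof.
move=> [mf [B fB]] [mg [B' gB]]; split; first exact: measurable_funM.
by exists (B * B') => x xC; rewrite normrM ler_pM ?fB ?gB.
Qed.

Lemma cube_boundedB f g : cube_bounded f -> cube_bounded g ->
  cube_bounded (fun x => f x - g x).
Proof.
move=> [mf [B fB]] [mg [B' gB]]; split; first exact: measurable_funB.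
by exists (B + B') => x xC; rewrite (le_trans (ler_normB _ _))// lerD ?fB ?gB.
Qed.

Lemma cube_bounded_norm f : cube_bounded f -> cube_bounded (fun x => `|f x|).
Proof.
move=> [mf [B fB]]; split; first exact: measurableT_comp.
by exists B => x xC; rewrite normr_id fB.
Qed.

Lemma cube_bounded_cst (c : R) : cube_bounded (fun=> c).
Proof. by split; [exact: measurable_cst|exists `|c|]. Qed.

Local Notation I f := (\int[lam]_(x in cube) f x).

Lemma cube_integralB f g : cube_bounded f -> cube_bounded g ->
  \int[lam]_(x in cube) (f x - g x) = I f - I g.
Proof.
move=> bf bg; apply: RintegralB; [exact: measurable_unit_cube|..];
  exact: cube_bounded_integrable.
Qed.

Lemma cube_integralZ (c : R) f : cube_bounded f ->
  \int[lam]_(x in cube) (c * f x) = c * I f.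
Proof.
move=> bf; apply: RintegralZl; [exact: measurable_unit_cube|].
exact: cube_bounded_integrable.
Qed.

Lemma cube_integral_cst (c : R) : \int[lam]_(x in cube) c = c.
Proof.
rewrite Rintegral_cst; last exact: measurable_unit_cube.
by rewrite [X in fine X]lebesgue_unit_cube mulr1.
Qed.

Lemma cube_integral_le f g : cube_bounded f -> cube_bounded g ->
  (forall x, cube x -> f x <= g x) -> I f <= I g.
Proof.
move=> bf bg fg; apply: le_Rintegral => //; [exact: measurable_unit_cube|..];
  exact: cube_bounded_integrable.
Qed.

Lemma L2normE f : L2norm f ^+ 2 = \int[lam]_(x in cube) (f x * f x).
Proof.
rewrite /L2norm sqr_sqrtr; last by apply: Rintegral_ge0 => x _; rewrite sqr_ge0.
by apply: eq_Rintegral => x _; rewrite expr2.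
Qed.

Lemma integral_sqrB f g : cube_bounded f -> cube_bounded g ->
  \int[lam]_(x in cube) ((f x - g x) * (f x - g x)) =
  \int[lam]_(x in cube) (f x * f x) - (2 * \int[lam]_(x in cube) (f x * g x) -
  \int[lam]_(x in cube) (g x * g x)).
Proof.
move=> bf bg.
have bff := cube_boundedM bf bf; have bfg := cube_boundedM bf bg.
have bgg := cube_boundedM bg bg.
have b2 := cube_boundedM (cube_bounded_cst 2) bfg.
rewrite -(cube_integralZ 2 bfg) -(cube_integralB b2 bgg).
rewrite -(cube_integralB bff (cube_boundedB b2 bgg)).
by apply: eq_Rintegral => x _ /=; ring.
Qed.

(** The cube has volume 1, so this is the nonnegativity of the variance of [|f|]: the integral of
    [(|f| - m) ^ 2] with [m] the mean. *)
Lemma L1norm_le f : cube_bounded f ->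
  L1norm f ^+ 2 <= \int[lam]_(x in cube) (f x * f x).
Proof.
move=> bf; have bn := cube_bounded_norm bf.
set m := L1norm f.
have := integral_sqrB bn (cube_bounded_cst m).
have -> : \int[lam]_(x in cube) (`|f x| * `|f x|) = \int[lam]_(x in cube) (f x * f x).
  by apply: eq_Rintegral => x _; rewrite -!expr2 real_normK ?num_real.
have -> : \int[lam]_(x in cube) (`|f x| * m) = m * m.
  under eq_Rintegral do rewrite mulrC.
  by rewrite cube_integralZ.
rewrite cube_integral_cst => E.
have : 0 <= \int[lam]_(x in cube) ((`|f x| - m) * (`|f x| - m)).
  by apply: Rintegral_ge0 => x _; rewrite -expr2 sqr_ge0.
by rewrite E expr2; lra.
Qed.

Lemma L1norm_ge0 f : 0 <= L1norm f.
Proof. by apply: Rintegral_ge0 => x _. Qed.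

(** The empirical mean enters the risk with the factor 2, once for [f] and once for [g]; this gives
    [4 * Delta]. *)
Lemma oracle_inequality (n : nat) (x : 'I_n -> d.-tuple R) f g p (eps Delta : R) :
  cube_bounded f -> cube_bounded g -> cube_bounded p ->
  empirical_risk x f <= empirical_risk x g ->
  (forall y, cube y -> `|g y - p y| <= eps) ->
  `|n%:R^-1 * (\sum_(i < n) f (x i)) - \int[lam]_(y in cube) (f y * p y)| <= Delta ->
  `|n%:R^-1 * (\sum_(i < n) g (x i)) - \int[lam]_(y in cube) (g y * p y)| <= Delta ->
  L1norm (fun y => p y - f y) ^+ 2 <= eps ^+ 2 + 4 * Delta.
Proof.
move=> bf bg bp; rewrite /empirical_risk !L2normE => risk gp hf hg.
have bpf := cube_boundedB bp bf.
apply: le_trans (L1norm_le bpf) _.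
have -> : \int[lam]_(y in cube) ((p y - f y) * (p y - f y)) =
    \int[lam]_(y in cube) ((f y - p y) * (f y - p y)).
  by apply: eq_Rintegral => y _ /=; ring.
have gpe : \int[lam]_(y in cube) ((g y - p y) * (g y - p y)) <= eps ^+ 2.
  rewrite -[leRHS](cube_integral_cst (eps ^+ 2)).
  apply: cube_integral_le.
  - by apply: cube_boundedM; exact: cube_boundedB.
  - exact: cube_bounded_cst.
  - move=> y yC; rewrite -expr2 -(real_normK (num_real (g y - p y))).
    have h := gp y yC.
    by rewrite lerXn2r ?nnegrE// (le_trans _ h).
rewrite integral_sqrB// in gpe; rewrite integral_sqrB//.
move: risk; rewrite -!mulrA.
move: hf hg gpe; rewrite !ler_norml.
set a := n%:R^-1 * _; set b := n%:R^-1 * _.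
by move=> /andP[f1 f2] /andP[g1 g2] gpe risk; lra.
Qed.

End oracle_inequality.

Section uniform_deviation.
Context (R : realType) (d : nat) (d0 : measure_display) (T : measurableType d0)
  (P : probability T R).

(** One function per nonempty fibre of the code is handled by [concentration], with a union bound
    over codes. Another member of the fibre shifts the empirical mean and the integral by at most
    [delta] each, as [p] has mass 1. The event is fixed before [f], so [f] may depend on the
    sample. *)
Lemma uniform_deviation (p : d.-tuple R -> R) (Mp : R) (n : nat)
    (X : 'I_n -> {RV P >-> d.-tuple R}) (F : set (d.-tuple R -> R))
    (C : finType) (c : (d.-tuple R -> R) -> C) (B tau delta : R) :
  prob_density p -> (forall x, unit_cube d x -> p x <= Mp) ->
  (forall f, F f -> measurable_fun (unit_cube d) f) ->
  (forall f x, F f -> unit_cube d x -> `|f x| <= B) ->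
  (forall f g, F f -> F g -> c f = c g ->
     forall x, unit_cube d x -> `|f x - g x| <= delta) ->
  (forall i t, unit_cube d (X i t)) -> iid_with_density X p ->
  (0 < n)%N -> 0 < B -> 0 < tau ->
  exists E : set T, [/\ measurable E,
    ((1 - #|C|%:R * (2 * expR (- (n%:R * tau ^+ 2 / (32 * B ^+ 2)))))%:E <= P E)%E &
    forall t, E t -> forall f, F f -> `|n%:R^-1 * (\sum_(i < n) f (X i t)) -
       \int[lebesgue_tuple R d]_(x in unit_cube d) (f x * p x)| <= 3 * tau + 2 * delta].
Proof.
move=> pd pM mF FB Fc XC iid n0 B0 tau0.
set eta := 2 * expR _.
have rep (j : C) : exists E : set T, [/\ measurable E, ((1 - eta)%:E <= P E)%E &
    forall t, E t -> forall f, F f -> c f = j -> `|n%:R^-1 * (\sum_(i < n) f (X i t)) -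
       \int[lebesgue_tuple R d]_(x in unit_cube d) (f x * p x)| <= 3 * tau + 2 * delta].
  have [[g [Fg gj]]|nog] := pselect (exists g, F g /\ c g = j); last first.
    exists setT; split => //.
      by rewrite probability_setT lee_fin lerBlDr lerDl mulr_ge0// expR_ge0.
    by move=> t _ f Ff fj; exfalso; apply: nog; exists f.
  have [E [mE PE hE]] := concentration pd pM (mF g Fg) (fun x => FB g x Fg) XC iid n0 B0 tau0.
  exists E; split => // t Et f Ff fj.
  have fg := Fc f g Ff Fg (etrans fj (esym gj)).
  have [mp p0 p1] := pd.
  have pB : cube_bounded p.
    by split => //; exists Mp => x xC; rewrite ger0_norm ?p0 ?pM.
  have bf : cube_bounded f by split; [exact: mF|exists B => x xC; exact: FB].
  have bg : cube_bounded g by split; [exact: mF|exists B => x xC; exact: FB].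
  have h1 : `|n%:R^-1 * (\sum_(i < n) f (X i t)) - n%:R^-1 * (\sum_(i < n) g (X i t))| <= delta.
    have nR : 0 < n%:R :> R by rewrite ltr0n.
    rewrite -mulrBr normrM ger0_norm ?invr_ge0// ler_pdivrMl// -sumrB.
    apply: le_trans (ler_norm_sum _ _ _) _.
    rewrite mulr_natl -[n in _ *+ n](card_ord n) -sumr_const ler_sum// => i _.
    exact: fg.
  have h2 : `|\int[lebesgue_tuple R d]_(x in unit_cube d) (g x * p x) -
      \int[lebesgue_tuple R d]_(x in unit_cube d) (f x * p x)| <= delta.
    have bgp := cube_boundedM bg pB; have bfp := cube_boundedM bf pB.
    rewrite -cube_integralB//.
    have bdp := cube_boundedM (cube_bounded_cst d delta) pB.
    have Ip : \int[lebesgue_tuple R d]_(x in unit_cube d) (delta * p x) = delta.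
      by rewrite cube_integralZ// /Rintegral p1 mulr1.
    rewrite -[leRHS]Ip ler_norml -mulN1r -cube_integralZ//.
    apply/andP; split; apply: cube_integral_le => //.
    - exact: cube_boundedM (cube_bounded_cst d (-1)) bdp.
    - exact: cube_boundedB.
    - move=> x xC; have := fg x xC; rewrite ler_norml -mulrBl mulrA => /andP[a1 a2].
      by rewrite ler_wpM2r ?p0//; lra.
    - exact: cube_boundedB.
    - move=> x xC; have := fg x xC; rewrite ler_norml -mulrBl => /andP[a1 a2].
      by rewrite ler_wpM2r ?p0//; lra.
  have h3 := hE t Et.
  move: h1 h2 h3; rewrite !ler_norml => /andP[? ?] /andP[? ?] /andP[? ?].
  by apply/andP; split; lra.
pose E j := sval (cid (rep j)).
have EP j := svalP (cid (rep j)).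
have mE j : measurable (E j) by case: (EP j).
have mEC j : measurable (~` E j) by exact: measurableC.
exists (~` \big[setU/set0]_(j : C) ~` E j); split.
- by apply: measurableC; apply: bigsetU_measurable => j _.
- rewrite probability_setC; last by apply: bigsetU_measurable => j _.
  rewrite EFinB leeB//; apply: le_trans (measure_bigsetU_le _ _ _ mEC) _.
  apply: (@le_trans _ _ (\sum_(j : C) eta%:E)%E).
    apply: lee_sum => j _; have [_ PE _] := EP j.
    rewrite [leLHS](probability_setC P (mE j)).
    move: PE; rewrite -/(E j) -(fineK (fin_num_measure P _ (mE j))) -EFinB !lee_fin.
    by lra.
  by rewrite sumEFin lee_fin sumr_const mulr_natl.
- move=> t tE f Ff; have [_ _ h] := EP (c f); apply: h => //.
  apply: contrapT => nE; apply: tE; rewrite -(bigcup_seq (index_enum _)).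
  by exists (c f) => //=; rewrite mem_index_enum.
Qed.

End uniform_deviation.

(** * Choice of the architecture and rates *)

Section growth.
Local Open Scope nat_scope.
Variables (r D n : nat).

Definition log_size : nat := (trunc_log 2 n).+1.
(* The largest [q] with 2^(q(4+r)) <= n. *)
Definition grid_exp : nat := trunc_log 2 n %/ (4 + r).
Definition net_depth : nat := (grid_exp * r).+3.
Definition net_width : nat :=
  2 ^ (grid_exp * r) * r * 2 + 2 ^ (grid_exp * r) * 2 + log_size + r + 1.
Definition net_sparsity : nat := net_depth.+1 * net_width * (r * 2 + 4 + log_size).+1.

(* Parameters that agree up to the inverse of [mesh] give products of networks at
   sup-distance at most 4^-q. *)
Definition mesh : nat :=
  D * log_size ^ D * (3 * net_width.+1) ^ net_depth.+1 * 2 ^ (grid_exp * 2).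
(** The number of contents of one slot of a sparse code: empty, or a position with a cell. *)
Definition codes_per_parameter : nat :=
  1 + net_depth.+1 * (net_width * net_width + net_width) * (mesh * 2).+1.

Local Notation T := log_size.
Local Notation q := grid_exp.

Let T0 : 0 < T. Proof. by []. Qed.

Let qT : q <= T.
Proof. by rewrite leqW// leq_div. Qed.

Lemma grid_exp_upper : 0 < n -> 2 ^ (q * (4 + r)) <= n.
Proof.
move=> n0; apply: leq_trans (trunc_logP (isT : 1 < 2) n0).
by rewrite leq_exp2l// leq_trunc_div.
Qed.

Lemma grid_exp_lower : n < 2 ^ (q.+1 * (4 + r)).
Proof.
apply: leq_trans (trunc_log_ltn n (isT : 1 < 2)) _.
by rewrite leq_exp2l// ltn_ceil.
Qed.

Let depth_le : net_depth.+1 <= (r + 4) * T.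
Proof. rewrite /net_depth; have := leq_mul qT (leqnn r); have := T0; nia. Qed.

Let width_le : net_width.+1 <= (3 * r + 5) * (2 ^ (q * r) * T).
Proof.
rewrite /net_width; have e0 : 0 < 2 ^ (q * r) by rewrite expn_gt0.
move: e0 T0; set E := 2 ^ _; set t := T => e0 t0.
have h1 : E <= E * t by rewrite leq_pmulr.
have h2 : t <= E * t by rewrite leq_pmull.
have h3 : r <= r * (E * t) by rewrite leq_pmulr// muln_gt0 e0.
have h4 : E * r <= E * t * r by rewrite leq_mul2r h1 orbT.
nia.
Qed.

(** Depth, width and row bound contribute one factor [T] each. *)
Lemma sparsity_growth :
  net_sparsity <= (r + 4) * (3 * r + 5) * (2 * r + 6) * (2 ^ (q * r) * T ^ 3).
Proof.
have h : (r * 2 + 4 + T).+1 <= (2 * r + 6) * T by have := T0; nia.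
apply: leq_trans (leq_mul (leq_mul depth_le (leqW (leqnn _))) h) _.
apply: leq_trans (leq_mul (leq_mul (leqnn _) width_le) (leqnn _)) _.
by rewrite leq_eqVlt; apply/orP; left; apply/eqP; ring.
Qed.

(** A calculus of exponents: the width is at most exponential in [T], and its power to the depth,
    itself of order [T], is exponential in [T ^ 2]. *)
Let pow2T (c x : nat) := x <= 2 ^ (c * T).
Let pow2TT (c x : nat) := x <= 2 ^ (c * T ^ 2).

Let TTT : T <= T ^ 2. Proof. by rewrite leq_pmulr. Qed.

Let pow2T_cst c : pow2T c c.
Proof.
rewrite /pow2T (leq_trans (ltnW (ltn_expl c (isT : 1 < 2))))// leq_exp2l//.
by rewrite leq_pmulr.
Qed.

Let pow2T_T : pow2T 1 T.
Proof. by rewrite /pow2T mul1n ltnW// ltn_expl. Qed.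

Let pow2T_mul c c' x y : pow2T c x -> pow2T c' y -> pow2T (c + c') (x * y).
Proof. by move=> hx hy; rewrite /pow2T mulnDl expnD leq_mul. Qed.

Let pow2TT_mul c c' x y : pow2TT c x -> pow2TT c' y -> pow2TT (c + c') (x * y).
Proof. by move=> hx hy; rewrite /pow2TT mulnDl expnD leq_mul. Qed.

Let pow2T_TT c x : pow2T c x -> pow2TT c x.
Proof. by move/leq_trans; apply; rewrite leq_exp2l// leq_mul2l TTT orbT. Qed.

Let pow2TT_add c c' x y : pow2TT c x -> pow2TT c' y -> pow2TT (c + c').+1 (x + y).
Proof.
move=> hx hy; have h1 : 1 <= T ^ 2 by rewrite expn_gt0.
apply: (@leq_trans (2 * 2 ^ ((c + c') * T ^ 2))).
  rewrite mul2n -addnn leq_add//.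
    by apply: leq_trans hx _; rewrite leq_exp2l// leq_mul2r leq_addr orbT.
  by apply: leq_trans hy _; rewrite leq_exp2l// leq_mul2r leq_addl orbT.
by rewrite -expnS leq_exp2l// mulSn -add1n leq_add2r.
Qed.

Let pow2TT_exp c c' x y : pow2T c x -> y <= c' * T -> pow2TT (c * c') (x ^ y).
Proof.
move=> hx hy; have [->|x0] := posnP x.
  by case: (y) => [|y']; rewrite ?expn0 ?exp0n// /pow2TT ?expn_gt0.
apply: (@leq_trans ((2 ^ (c * T)) ^ y)).
  by case: (y) => // y'; rewrite leq_exp2r.
rewrite -expnM leq_exp2l//; apply: leq_trans (leq_mul (leqnn (c * T)) hy) _.
by rewrite leq_eqVlt; apply/orP; left; apply/eqP; ring.
Qed.

Let pow2T_le c x y : x <= y -> pow2T c y -> pow2T c x.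
Proof. exact: leq_trans. Qed.

Let hW := 3 * r + 5 + (r + 1).

Let pow2T_width : pow2T hW net_width.+1.
Proof.
apply: pow2T_le width_le _; apply: pow2T_mul (pow2T_cst _) _.
by apply: pow2T_mul pow2T_T; rewrite /pow2T leq_exp2l// mulnC leq_mul2l qT orbT.
Qed.

(** The sum that the rules for [pow2T] and [pow2TT] produce along the expression of
    [codes_per_parameter]; only its independence of [n] matters. *)
Definition code_exponent : nat :=
  let h := 3 * r + 5 + (r + 1) in
  (1 + (r + 4 + 1 + (h + h + h).+1 + (D + 1 * D + (3 + h) * (r + 4) + 2 + 2 + 1).+1)).+1.

Lemma codes_growth : codes_per_parameter <= 2 ^ (code_exponent * T ^ 2).
Proof.
have w : pow2T hW net_width := pow2T_le (leqnSn _) pow2T_width.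
rewrite -/(pow2TT _ _); apply: pow2TT_add (pow2T_TT (pow2T_cst 1)) _.
apply: pow2TT_mul.
  apply: pow2TT_mul.
    exact/pow2T_TT/(pow2T_le depth_le)/(pow2T_mul (pow2T_cst _))/pow2T_T.
  exact: pow2TT_add (pow2T_TT (pow2T_mul w w)) (pow2T_TT w).
rewrite -[(mesh * 2).+1]addn1; apply: pow2TT_add _ (pow2T_TT (pow2T_cst 1)).
apply: pow2TT_mul _ (pow2T_TT (pow2T_cst 2)); apply: pow2TT_mul.
  apply: pow2TT_mul.
    apply: pow2TT_mul (pow2T_TT (pow2T_cst D)) _.
    by apply: pow2TT_exp pow2T_T _; rewrite leq_pmulr.
  by apply: pow2TT_exp depth_le; exact: pow2T_mul (pow2T_cst 3) pow2T_width.
by apply: pow2T_TT; rewrite /pow2T leq_exp2l// mulnC leq_mul2l qT orbT.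
Qed.

End growth.

(** * The class attached to a graph and a sample size *)

Section clique_networks.
Context (R : realType) (d : nat) (e : rel 'I_d) (n : nat).

Local Notation r := (clique_number e).
Local Notation D := #|{set 'I_d}|.
Local Notation T := (log_size n).
Local Notation q := (grid_exp r n).

Definition clique_depth (K : {set 'I_d}) : nat := (q * #|K|).+3.

Definition clique_widths (K : {set 'I_d}) : (clique_depth K).+2.-tuple nat :=
  widths (clique_depth K) (maxnet_width #|K| q T).

Local Notation class :=
  (clique_product_class e clique_widths (net_sparsity r n) (T%:R : R)).

Lemma max_clique_card K : K \in max_cliques e -> (#|K| <= r)%N.
Proof. by rewrite inE => /maxsetp cK; apply: leq_bigmax_cond. Qed.

Lemma clique_widths_first K : nth 0%N (clique_widths K) 0 = #|K|.
Proof. by rewrite nth_widths. Qed.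

Lemma clique_widths_last K : nth 0%N (clique_widths K) (clique_depth K).+1 = 1%N.
Proof. by rewrite nth_widths// maxnet_width_last. Qed.

Lemma grid_card_le K : K \in max_cliques e -> (2 ^ (q * #|K|) <= 2 ^ (q * r))%N.
Proof. by move=> /max_clique_card h; rewrite leq_exp2l// leq_mul. Qed.

Lemma maxnet_width_bound K : K \in max_cliques e ->
  (2 ^ (q * #|K|) * #|K| * 2 + 2 ^ (q * #|K|) * 2 + T + #|K| + 1 <= net_width r n)%N.
Proof.
move=> KC; have h1 := max_clique_card KC; have h2 := grid_card_le KC.
by rewrite /net_width !leq_add// ?leq_mul.
Qed.

Lemma clique_widths_le K i : K \in max_cliques e -> (i <= (clique_depth K).+1)%N ->
  (nth 0%N (clique_widths K) i <= net_width r n)%N.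
Proof.
move=> KC il; rewrite nth_widths// (leq_trans (maxnet_width_le _ _ _ _))//.
exact: maxnet_width_bound.
Qed.

Lemma clique_depth_le K : K \in max_cliques e -> (clique_depth K <= net_depth r n)%N.
Proof. by move=> /max_clique_card h; rewrite !ltnS leq_mul. Qed.

(** The networks stay between 0 and the factors they approximate, so the product estimate involves
    the fixed bound [B]; the growing [T] enters once, through the error of a single network. *)
Lemma class_approx (psi : forall K : {set 'I_d}, #|K|.-tuple R -> R)
    (p : d.-tuple R -> R) (B : nat) :
  (0 < B)%N -> (B <= T)%N ->
  (forall (K : {set 'I_d}) x, unit_cube #|K| x -> 0 <= psi K x <= B%:R) ->
  (forall (K : {set 'I_d}) x y, unit_cube #|K| x -> unit_cube #|K| y ->
     `|psi K x - psi K y| <= B%:R * l1_dist x y) ->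
  (forall x, unit_cube d x -> p x = \prod_(K in max_cliques e) psi K (subvector K x)) ->
  exists2 g, class g & forall x, unit_cube d x ->
    `|g x - p x| <= D%:R * B%:R ^+ D * (2 * T%:R * (r%:R / (2 ^ q)%:R)).
Proof.
move=> B0 BT psiB psiL pE.
have BTR : B%:R <= T%:R :> R by rewrite ler_nat.
have psiT (K : {set 'I_d}) x : unit_cube #|K| x -> 0 <= psi K x <= T%:R.
  by move=> /psiB/andP[-> h]; rewrite (le_trans h).
have psiLT (K : {set 'I_d}) x y : unit_cube #|K| x -> unit_cube #|K| y ->
    `|psi K x - psi K y| <= T%:R * l1_dist x y.
  by move=> xC yC; rewrite (le_trans (psiL _ _ _ xC yC))// ler_wpM2r// l1_dist_ge0.
pose net (K : {set 'I_d}) (x : #|K|.-tuple R) :=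
  layer (maxnet_width #|K| q T) (maxnet_weight R #|K| q)
    (maxnet_bias q T (psi K)) (nth 0 x) (q * #|K|).+3 0.
have apx (K : {set 'I_d}) x := @maxnet_approx R #|K| q T (psi K) isT (psiT K) (psiLT K) x.
exists (fun x => \prod_(K in max_cliques e) net K (subvector K x)).
  exists net; split => // K KC; apply: (@maxnet_nn_class R #|K| q T (psi K) isT (psiT K) (psiLT K)
    (net_sparsity r n)).
  have h := max_clique_card KC.
  rewrite /net_sparsity !leq_mul//; last by rewrite !ltnS !leq_add2r leq_mul.
    by rewrite !ltnS leq_mul.
  exact: maxnet_width_bound.
move=> x xC; rewrite pE//; have B1 : 1 <= B%:R :> R by rewrite ler1n.
apply: finprod_perturb => //.
- move=> K KC; have [h0 h1 _] := apx K _ (unit_cube_subvector (K := K) xC).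
  rewrite ger0_norm// (le_trans h1)//.
  by have /andP[] := psiB K _ (unit_cube_subvector (K := K) xC).
- move=> K KC; have /andP[h0 h1] := psiB K _ (unit_cube_subvector (K := K) xC).
  by rewrite ger0_norm.
- move=> K KC; have [_ h1 h2] := apx K _ (unit_cube_subvector (K := K) xC).
  rewrite distrC ger0_norm ?subr_ge0// (le_trans h2)// ler_wpM2l//.
  by rewrite ler_wpM2r ?invr_ge0// ler_nat max_clique_card.
Qed.

Lemma class_cover : exists c : (d.-tuple R -> R) ->
    {ffun {set 'I_d} -> 'I_(codes_per_parameter r D n ^ net_sparsity r n).-1.+1},
  forall f g, class f -> class g -> c f = c g ->
  forall x, unit_cube d x -> `|f x - g x| <= (2 ^ (q * 2))%:R^-1.
Proof.
set m := (_ ^ _)%N.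
have m0 : (0 < m)%N by rewrite expn_gt0.
have D0 : (0 < D)%N by apply/card_gt0P; exists (finset.set0 : {set 'I_d}).
have mesh0 : (0 < mesh r D n)%N.
  have pos a b : (0 < a)%N -> (0 < a ^ b)%N by move=> a0; rewrite expn_gt0 a0.
  rewrite /mesh muln_gt0 (pos 2)// andbT muln_gt0 (pos (3 * _)%N)// andbT.
  by rewrite muln_gt0 D0 (pos T).
have T1 : 1 <= T%:R :> R by rewrite ler1n.
have [|c hc] := @product_class_cover R d e clique_depth clique_widths
  (net_sparsity r n) T%:R (fun K _ => clique_widths_last K) m.-1 (mesh r D n)
  (net_width r n) T1 mesh0 (fun K i => @clique_widths_le K i) _ (net_depth r n)
  (fun K => @clique_depth_le K).
  move=> K KC; rewrite prednK// /m; case: (net_sparsity r n) => // s.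
  rewrite leq_exp2r// /codes_per_parameter leq_add2l leq_mul// leq_mul//.
  by rewrite ltnS clique_depth_le.
exists c => f g fF gF cfg x xC; apply: le_trans (hc f g fF gF cfg x xC) _.
set k := (3 * (_ + 1)) ^+ _.
have kE : k = ((3 * (net_width r n).+1) ^ (net_depth r n).+1)%:R.
  by rewrite natrX natrM -[(net_width r n).+1%:R]natr1.
have -> : (mesh r D n)%:R = D%:R * T%:R ^+ D * k * (2 ^ (q * 2))%:R :> R.
  by rewrite kE -natrX -!natrM.
have k0 : 0 < k by rewrite kE ltr0n expn_gt0.
have DR : 0 < D%:R :> R by rewrite ltr0n.
have TD : 0 < T%:R ^+ D :> R by rewrite exprn_gt0.
have E0 : 0 < (2 ^ (q * 2))%:R :> R by rewrite ltr0n expn_gt0.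
have cancel (a b y u : R) : 0 < a -> 0 < b -> 0 < y -> 0 < u ->
    a * b * ((a * b * y * u)^-1 * y) = u^-1.
  by move=> *; field; rewrite !gt_eqF.
by rewrite cancel.
Qed.

Lemma expR_pow2 (k : nat) : (2 ^ k)%:R <= expR k%:R :> R.
Proof.
rewrite natrX -[k%:R]mulr1 mulrC expRM_natr lerXn2r ?nnegrE ?expR_ge0//.
by have := @expR_ge1Dx R 1; lra.
Qed.

(** The product is the constant in the logarithm of the number of codes, the added 1 pays for the
    remaining [exp (- T)], and 32 absorbs the denominator of Hoeffding's exponent. *)
Definition deviation_factor : nat :=
  32 * (code_exponent r D * D * ((r + 4) * (3 * r + 5) * (2 * r + 6)) + 1).

Definition deviation : R := deviation_factor%:R * T%:R ^+ (D + 3) / (2 ^ (q * 2))%:R.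

(** The choice of [q] gives [(4 ^ q) ^ 2 * 2 ^ (q * r) <= n], so Hoeffding's exponent is at least
    [c * 2 ^ (q * r) * T ^ 6]. The logarithm of the number of codes has only [T ^ 5]: [T ^ 2] per
    slot times [T ^ 3] from the sparsity. *)
Lemma deviation_tail : (0 < n)%N ->
  (#|{ffun {set 'I_d} -> 'I_(codes_per_parameter r D n ^ net_sparsity r n).-1.+1}|)%:R *
    (2 * expR (- (n%:R * deviation ^+ 2 / (32 * (T%:R ^+ D) ^+ 2)))) <=
  2 * expR (- T%:R) :> R.
Proof.
move=> n0; rewrite card_ffun card_ord prednK ?expn_gt0//.
set g := code_exponent r D; set a := ((r + 4) * (3 * r + 5) * (2 * r + 6))%N.
set s := net_sparsity r n; set E := (2 ^ (q * r))%N.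
have cE : (((codes_per_parameter r D n) ^ s) ^ D <= 2 ^ (g * D * a * E * T ^ 5))%N.
  rewrite -expnM.
  apply: (@leq_trans ((2 ^ (g * T ^ 2)) ^ (s * D))).
    by case: (s * D)%N => // k; rewrite leq_exp2r// codes_growth.
  rewrite -expnM leq_exp2l//.
  apply: leq_trans (leq_mul (leqnn _) (leq_mul (sparsity_growth r n) (leqnn D))) _.
  by rewrite -/a -/E leq_eqVlt; apply/orP; left; apply/eqP; ring.
have cR : (((codes_per_parameter r D n) ^ s) ^ D)%:R <=
    expR (g * D * a * E * T ^ 5)%:R :> R.
  by apply: le_trans (expR_pow2 _); rewrite ler_nat.
rewrite mulrCA ler_pM2l//.
apply: (le_trans (ler_wpM2r (expR_ge0 _) cR)).
rewrite -expRD ler_expR lerBlDr addrC lerBrDr.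
have TR : 1 <= T%:R :> R by rewrite ler1n.
have T0 : 0 < T%:R :> R by rewrite (lt_le_trans ltr01).
have nE : (2 ^ (q * 2))%:R ^+ 2 * E%:R <= n%:R :> R.
  rewrite -natrX -natrM ler_nat (leq_trans _ (grid_exp_upper r n0))//.
  by rewrite -expnM -expnD leq_exp2l// mulnDr -mulnA.
set c := (g * D * a + 1)%N.
have Y : c%:R * E%:R * T%:R ^+ 6 <= n%:R * deviation ^+ 2 / (32 * (T%:R ^+ D) ^+ 2) :> R.
  rewrite ler_pdivlMr ?mulr_gt0 ?exprn_gt0//.
  rewrite /deviation /deviation_factor -/g -/a -/c.
  set u := (2 ^ (q * 2))%:R in nE *.
  have u0 : 0 < u :> R by rewrite ltr0n expn_gt0.
  rewrite expr_div_n [leRHS]mulrA ler_pdivlMr ?exprn_gt0// natrM.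
  have sq (x y z : R) : (32 * x * (y * z ^+ 3)) ^+ 2 =
      32 * x * (32 * x) * z ^+ 6 * y ^+ 2 by ring.
  have assoc (x y z v u2 : R) : x * y * z * (32 * v) * u2 =
      u2 * y * (32 * x * z * v) by ring.
  rewrite exprD sq assoc.
  have c1 : 1 <= c%:R :> R by rewrite ler1n /c addn1.
  apply: ler_pM => //; first by rewrite mulr_ge0// exprn_ge0// ltW.
  rewrite !ler_wpM2r ?exprn_ge0//.
  by rewrite ler_peMr ?mulr_ge0// -[leLHS]mul1r ler_pM// ler1n.
apply: le_trans Y; rewrite natrM natrX natrM /c natrD.
set G : R := (g * D * a)%:R.
have E1 : 1 <= E%:R :> R by rewrite ler1n expn_gt0.
have h1 : T%:R <= E%:R * T%:R ^+ 6 :> R.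
  rewrite -[leLHS]mul1r ler_pM// ?ler0n// -[leLHS]expr1.
  exact: ler_weXn2l.
have h2 : G * E%:R * T%:R ^+ 5 <= G * E%:R * T%:R ^+ 6.
  by rewrite ler_wpM2l ?mulr_ge0// ler_weXn2l.
by rewrite !mulrDl mul1r lerD.
Qed.

End clique_networks.

Section fixed_sample_size.
Context (R : realType) (d : nat) (e : rel 'I_d) (n : nat).

Local Notation r := (clique_number e).
Local Notation D := #|{set 'I_d}|.
Local Notation T := (log_size n).
Local Notation q := (grid_exp r n).

(** With [4 * (3 * tau + 2 * delta) = 12 * tau + 8 * delta], the three terms stem from
    approximation, deviation and cover. *)
Definition rate_constant (B : nat) : R :=
  (D%:R * B%:R ^+ D * (2 * r%:R)) ^+ 2 + 12 * (deviation_factor e)%:R + 8.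

(** The constant on the right is at least 8, hence below its square; bounding by a perfect square
    avoids taking roots. *)
Lemma rate_algebra (A b K t u : R) : 0 < u -> 0 <= b -> 1 <= K -> 0 <= t -> t <= K ->
  (A * (t / u)) ^+ 2 + 4 * (3 * (b * K / u ^+ 2) + 2 * (u ^+ 2)^-1) <=
  ((A ^+ 2 + 12 * b + 8) * (K / u)) ^+ 2.
Proof.
move=> u0 b0 K1 t0 tK.
have u2 : 0 < (u ^+ 2)^-1 by rewrite invr_gt0 exprn_gt0.
have -> : (A * (t / u)) ^+ 2 + 4 * (3 * (b * K / u ^+ 2) + 2 * (u ^+ 2)^-1) =
    (A ^+ 2 * t ^+ 2 + 12 * b * K + 8) * (u ^+ 2)^-1 by field; rewrite gt_eqF.
have -> : ((A ^+ 2 + 12 * b + 8) * (K / u)) ^+ 2 =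
    ((A ^+ 2 + 12 * b + 8) ^+ 2 * K ^+ 2) * (u ^+ 2)^-1 by field; rewrite gt_eqF.
rewrite ler_pM2r//.
have A0 : 0 <= A ^+ 2 by rewrite sqr_ge0.
have h1 : A ^+ 2 * t ^+ 2 <= A ^+ 2 * K ^+ 2.
  by rewrite ler_wpM2l// lerXn2r ?nnegrE// (le_trans t0).
have h2 : b * K <= b * K ^+ 2 by rewrite ler_wpM2l// expr2 ler_peMr// (le_trans ler01).
have h3 : 1 <= K ^+ 2 by rewrite exprn_ege1.
apply: (@le_trans _ _ ((A ^+ 2 + 12 * b + 8) * K ^+ 2)); first by lra.
rewrite ler_wpM2r//; first by rewrite (le_trans ler01).
by rewrite expr2 ler_peMr//; lra.
Qed.

Lemma fixed_sample_bound (psi : forall K : {set 'I_d}, #|K|.-tuple R -> R)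
    (p : d.-tuple R -> R) (Mp : R) (B : nat)
    (d0 : measure_display) (S : measurableType d0) (P : probability S R)
    (X : 'I_n -> {RV P >-> d.-tuple R}) (phat : S -> d.-tuple R -> R) :
  (0 < n)%N -> (0 < B)%N -> (B <= T)%N ->
  (forall (K : {set 'I_d}) x, unit_cube #|K| x -> 0 <= psi K x <= B%:R) ->
  (forall (K : {set 'I_d}) x y, unit_cube #|K| x -> unit_cube #|K| y ->
     `|psi K x - psi K y| <= B%:R * l1_dist x y) ->
  (forall x, unit_cube d x -> p x = \prod_(K in max_cliques e) psi K (subvector K x)) ->
  prob_density p -> (forall x, unit_cube d x -> p x <= Mp) ->
  (forall i t, unit_cube d (X i t)) -> iid_with_density X p ->
  (forall t, minimizers
     (clique_product_class e (clique_widths e n) (net_sparsity r n) (T%:R : R))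
     (empirical_risk (fun i => X i t)) (phat t)) ->
  exists E : set S, [/\ measurable E, ((1 - 2 * expR (- T%:R))%:E <= P E)%E &
    forall t, E t -> L1norm (fun x => p x - phat t x) <=
      rate_constant B * (T%:R ^+ (D + 3) / (2 ^ q)%:R)].
Proof.
move=> n0 B0 BT psiB psiL pE pd pM XC iid mini.
have T1 : 1 <= T%:R :> R by rewrite ler1n.
have T0 : 0 < T%:R :> R by rewrite (lt_le_trans ltr01).
have [c hc] := class_cover R e n.
have u0 : 0 < (2 ^ q)%:R :> R by rewrite ltr0n expn_gt0.
have u2 : (2 ^ (q * 2))%:R = (2 ^ q)%:R ^+ 2 :> R by rewrite expnM natrX.
have wl (K : {set 'I_d}) : K \in max_cliques e ->
  nth 0%N (clique_widths e n K) (clique_depth e n K).+1 = 1%N.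
  by move=> _; exact: clique_widths_last.
have mclass f : clique_product_class e (clique_widths e n) (net_sparsity r n) T%:R f ->
    measurable_fun (unit_cube d) (f : d.-tuple R -> R).
  by move=> cf; apply: measurable_funTS; exact: (measurable_product_class wl cf).
have bclass f x : clique_product_class e (clique_widths e n) (net_sparsity r n) T%:R f ->
    unit_cube d x -> `|f x| <= (T%:R : R) ^+ D.
  by move=> cf xC; exact: product_class_bounded T1 cf xC.
have bbclass f : clique_product_class e (clique_widths e n) (net_sparsity r n) T%:R f ->
    cube_bounded (f : d.-tuple R -> R).
  by move=> cf; split; [exact: mclass|exists (T%:R ^+ D) => x xC; exact: bclass].
have BD : 0 < (T%:R : R) ^+ D by rewrite exprn_gt0.
have dev0 : 0 < deviation R e n.
  rewrite /deviation divr_gt0 ?mulr_gt0 ?exprn_gt0// ltr0n ?expn_gt0//.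
  by rewrite /deviation_factor muln_gt0 addn1.
have [E [mE PE hE]] := uniform_deviation pd pM mclass bclass hc XC iid n0 BD dev0.
exists E; split => //.
  by apply: le_trans PE; rewrite lee_fin lerD2l lerN2; exact: deviation_tail.
move=> t Et.
have [phatF phatmin] := mini t.
have [g gF gp] := class_approx B0 BT psiB psiL pE.
have [mp p0 p1] := pd.
have bp : cube_bounded p.
  by split => //; exists Mp => x xC; rewrite ger0_norm ?p0 ?pM.
(* The event concerns the whole class, so it serves the minimizer and the approximant [g] at
   once. *)
have := oracle_inequality (bbclass _ phatF) (bbclass _ gF) bp (phatmin g gF) gp
  (hE t Et _ phatF) (hE t Et _ gF).
have K1 : 1 <= (T%:R : R) ^+ (D + 3) by rewrite exprn_ege1.
have TK : (T%:R : R) <= T%:R ^+ (D + 3).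
  by rewrite -[leLHS]expr1 ler_weXn2l// addn_gt0 orbT.
have := rate_algebra (D%:R * B%:R ^+ D * (2 * r%:R)) u0 (ler0n R (deviation_factor e))
  K1 (ltW T0) TK.
rewrite -/(rate_constant B) /deviation u2.
have -> : D%:R * B%:R ^+ D * (2 * T%:R * (r%:R / (2 ^ q)%:R)) =
    D%:R * B%:R ^+ D * (2 * r%:R) * (T%:R / (2 ^ q)%:R) :> R.
  by rewrite !mulrA -!(mulrAC _ T%:R).
move=> h1 h2; have := le_trans h2 h1.
rewrite ler_sqr ?nnegrE ?L1norm_ge0//.
apply: mulr_ge0; first by rewrite !addr_ge0// ?sqr_ge0// mulr_ge0.
by rewrite divr_ge0// exprn_ge0.
Qed.

End fixed_sample_size.

(** * Comparison with the stated rate *)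

Section rates.
Context (R : realType) (r n : nat).

(** As [exp (1 / 2) <= 2], the truncated logarithm [t] is at most [2 * ln n]; for [n >= 2] it is at
    least 1, so [t + 1 <= 2 * t]. *)
Lemma log_size_le_ln : (1 < n)%N -> (log_size n)%:R <= 4 * ln n%:R :> R.
Proof.
move=> n1; have n0 : (0 < n)%N by exact: ltnW.
have t1 : (0 < trunc_log 2 n)%N by rewrite trunc_log_gt0.
have nR : 0 < n%:R :> R by rewrite ltr0n.
have half : expR (1 / 2) <= 2 :> R.
  by apply: le_trans (expR_le_quadratic (lexx _)) _; lra.
have h : (trunc_log 2 n)%:R * (1 / 2) <= ln n%:R :> R.
  rewrite -ler_expR lnK ?posrE// expRM_natl.
  apply: (@le_trans _ _ ((2 ^ trunc_log 2 n)%:R)).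
    by rewrite natrX lerXn2r ?nnegrE ?expR_ge0.
  by rewrite ler_nat trunc_logP.
rewrite /log_size -natr1.
have : 1 <= (trunc_log 2 n)%:R :> R by rewrite ler1n.
lra.
Qed.

(** By maximality of [q], [n < 2 ^ ((q + 1) * (4 + r))]; the factor 2 pays for the rounding of
    [q]. *)
Lemma grid_inv_le_rate : (0 < n)%N ->
  (2 ^ grid_exp r n)%:R^-1 <= 2 * n%:R `^ (- (4 + r%:R)^-1) :> R.
Proof.
move=> n0; have nR : 0 < n%:R :> R by rewrite ltr0n.
have r0 : 0 < 4 + r%:R :> R by rewrite ltr_pwDl.
have u0 : 0 < (2 ^ grid_exp r n)%:R :> R by rewrite ltr0n expn_gt0.
have h : n%:R `^ (4 + r%:R)^-1 <= 2 * (2 ^ grid_exp r n)%:R :> R.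
  have E : (2 ^ ((grid_exp r n).+1 * (4 + r)))%:R =
      (2 * (2 ^ grid_exp r n)%:R : R) `^ (4 + r%:R).
    rewrite expnM natrX expnS natrM -[4 + r%:R]natrD powR_mulrn//.
  have -> : 2 * (2 ^ grid_exp r n)%:R =
      ((2 ^ ((grid_exp r n).+1 * (4 + r)))%:R : R) `^ (4 + r%:R)^-1.
    by rewrite E -powRrM mulfV ?gt_eqF// powRr1// mulr_ge0// ltW.
  apply: ge0_ler_powR; rewrite ?nnegrE ?invr_ge0 ?(ltW r0)//.
  by rewrite ler_nat ltnW// grid_exp_lower.
have a0 : 0 < n%:R `^ (4 + r%:R)^-1 :> R by rewrite powR_gt0.
by rewrite powRN ler_pdivlMr// mulrC ler_pdivrMr.
Qed.

End rates.

Lemma finite_bound (R : realType) (I : finType) (a : I -> R) :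
  exists2 B : nat, (0 < B)%N & forall i, a i <= B%:R.
Proof.
exists (\sum_i (Num.truncn (a i)).+1).+1 => // i.
apply: (@le_trans _ _ (Num.truncn (a i)).+1%:R); first by rewrite ltW// truncnS_gt.
by rewrite ler_nat leqW// (bigD1 i)//= leq_addr.
Qed.

Theorem theorem4p2 (R : realType) (d : nat) (e : rel 'I_d) :
  symmetric e ->
  exists (l : nat -> {set 'I_d} -> nat)
    (w : forall (n : nat) (K : {set 'I_d}), (l n K).+2.-tuple nat)
    (s : nat -> nat) (C : nat -> R),
  [/\ forall n K, K \in max_cliques e ->
        nth 0%N (w n K) 0 = #|K| /\ nth 0%N (w n K) (l n K).+1 = 1%N,
      forall n, 0 < C n &
      forall p : d.-tuple R -> R,
        prob_density p -> lipschitz_on_cube p -> positive_on_cube p ->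
        markov_property e p ->
      forall (d0 : measure_display) (T : measurableType d0)
        (P : probability T R) (X : forall n : nat, 'I_n -> {RV P >-> d.-tuple R})
        (phat : nat -> T -> d.-tuple R -> R),
        (forall n i t, unit_cube d (X n i t)) ->
        (forall n, iid_with_density (X n) p) ->
        (forall n t, (0 < n)%N ->
          minimizers (clique_product_class e (w n) (s n) (C n))
            (empirical_risk (fun i => X n i t)) (phat n t)) ->
        Otilde_p P (fun n t => L1norm (fun x => p x - phat n t x))
          (fun n => n%:R `^ (- (4 + (clique_number e)%:R)^-1))].
Proof.
move=> _; exists (clique_depth e), (clique_widths e),
  (net_sparsity (clique_number e)), (fun n => (log_size n)%:R); split.
- by move=> n K _; split; [exact: clique_widths_first|exact: clique_widths_last].
- by move=> n; rewrite ltr0n.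
move=> p pd plip ppos pmark d0 T P X phat XC iid mini.
have [mp p0 p1] := pd.
(* [markov_property] speaks about laws with density [p]; the law of a sample point is one. *)
have dens : has_density (distribution P (X 1%N ord0)) p by apply: (iid 1%N).2.
have [psi [reg pE]] := markov_factorization mp plip ppos dens pmark.
have [cp [Mp [Lp [_ _ pM _]]]] := lipschitz_regular plip ppos.
have regB (K : {set 'I_d}) : exists b : R,
    (forall x, unit_cube #|K| x -> 0 <= psi K x <= b) /\
    (forall x y, unit_cube #|K| x -> unit_cube #|K| y ->
      `|psi K x - psi K y| <= b * l1_dist x y).
  have [c [M [L [c0 L0 fc fL]]]] := reg K; exists (Num.max M L); split.
    move=> x /fc/andP[h1 h2]; rewrite (le_trans (ltW c0))//=.
    by rewrite le_max h2.
  move=> x y xC yC; rewrite (le_trans (fL _ _ xC yC))// ler_wpM2r ?l1_dist_ge0//.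
  by rewrite le_max lexx orbT.
have [B B0 hB] := finite_bound (fun K => sval (cid (regB K))).
have psiB (K : {set 'I_d}) x : unit_cube #|K| x -> 0 <= psi K x <= B%:R.
  have [h _] := svalP (cid (regB K)) => /h/andP[-> h2].
  exact: le_trans h2 (hB K).
have psiL (K : {set 'I_d}) x y : unit_cube #|K| x -> unit_cube #|K| y ->
    `|psi K x - psi K y| <= B%:R * l1_dist x y.
  have [_ h] := svalP (cid (regB K)) => xC yC.
  by rewrite (le_trans (h _ _ xC yC))// ler_wpM2r ?l1_dist_ge0.
exists (#|{set 'I_d}| + 3)%N => eps eps0.
(* The power of 4 converts [log_size n] into [ln n], and 2 comes from the rounding of [q]. *)
exists (rate_constant R e B * (4 ^+ (#|{set 'I_d}| + 3) * 2)).
(* From here on [T] exceeds both [B], so that the approximation applies, and [2 / eps], so that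
   [2 * exp (- T) <= eps]. *)
pose n1 := (2 ^ (B + (Num.truncn (2 / eps)).+1))%N.
exists n1 => // n n1n.
have n0 : (0 < n)%N by rewrite (leq_trans _ n1n)// expn_gt0.
have T1 : (B + (Num.truncn (2 / eps)).+1 <= log_size n)%N.
  by rewrite leqW// trunc_log_max.
have n2 : (1 < n)%N.
  by rewrite (leq_trans _ n1n)// -[X in (X < _)%N](expn0 2) ltn_exp2l// addn_gt0 B0.
have BT : (B <= log_size n)%N by rewrite (leq_trans (leq_addr _ _) T1).
have [E [mE PE hE]] := fixed_sample_bound n0 B0 BT psiB psiL pE pd
  (fun x xC => proj2 (andP (pM x xC))) (XC n) (iid n) (fun t => mini n t n0).
exists E; split => //.
  apply: le_trans PE; rewrite lee_fin lerD2l lerN2.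
  have Te : 2 / eps <= (log_size n)%:R.
    apply: (@le_trans _ _ (Num.truncn (2 / eps)).+1%:R); first by rewrite ltW// truncnS_gt.
    by rewrite ler_nat (leq_trans (leq_addl _ _) T1).
  rewrite expRN ler_pdivrMr ?expR_gt0//.
  move: Te; rewrite ler_pdivrMr// mulrC => /le_trans; apply.
  rewrite ler_pM2l// (le_trans _ (expR_ge1Dx _))// lerDr//.
move=> t Et; have := hE t Et.
set L1 := L1norm _ => hL.
have lnn : 0 < ln n%:R :> R by rewrite ln_gt0// ltr1n.
have a0 : 0 < n%:R `^ (- (4 + (clique_number e)%:R)^-1) :> R.
  by rewrite powR_gt0// ltr0n.
have den0 : 0 < n%:R `^ (- (4 + (clique_number e)%:R)^-1) *
    ln n%:R ^+ (#|{set 'I_d}| + 3) :> R by rewrite mulr_gt0// exprn_gt0.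
rewrite ger0_norm ?divr_ge0 ?L1norm_ge0 ?(ltW den0)// ler_pdivrMr//.
apply: (le_trans hL); rewrite -!mulrA ler_wpM2l//.
  by rewrite !addr_ge0// ?sqr_ge0// mulr_ge0.
have h1 : (log_size n)%:R ^+ (#|{set 'I_d}| + 3) <=
    4 ^+ (#|{set 'I_d}| + 3) * ln n%:R ^+ (#|{set 'I_d}| + 3) :> R.
  by rewrite -exprMn lerXn2r ?nnegrE ?mulr_ge0 ?(ltW lnn)// log_size_le_ln.
have h2 := grid_inv_le_rate R (clique_number e) n0.
have h3 : 0 <= (2 ^ grid_exp (clique_number e) n)%:R^-1 :> R by rewrite invr_ge0.
have := ler_pM (exprn_ge0 _ (ler0n _ _)) h3 h1 h2.
have alg (x y z : R) : x * y * (2 * z) = x * (2 * (z * y)) by ring.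
by rewrite alg.
Qed.
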